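(* Let $\alpha > -1$, $\sigma>0$ and $1 \le p,q \le \infty$. (a) If $\alpha \ge -1/2$, then $\mathcal{J}^{\alpha,\sigma}$ is bounded from $L^p(dx)$ to $L^q(dx)$ if and only if $$\frac{1}p - 2\sigma \le \frac{1}q \le \frac{1}p \quad \text{and} \quad \bigg(\frac{1}p,\frac{1}q\bigg) \notin \big\{(2\sigma,0), (1,1-2\sigma)\big\}.$$ (b) If $\alpha< -1/2$ and $p > 2/(2\alpha+3)$, then $\mathcal{J}^{\alpha,\sigma}$ is bounded from $L^p(dx)$ to $L^q(dx)$ if and only if $$\frac{1}p - 2\sigma \le \frac{1}q \le \frac{1}p \quad \text{and} \quad \frac{1}q > -\alpha-\frac{1}2.$$
   Context: For $\alpha>-1$ let $I_\alpha$ denote the modified Bessel function of the first kind of order $\alpha$, and for $t,x,y>0$ let $$\mathcal W_t^{\alpha}(x,y)=\frac{(xy)^{1/2}}{2t}\exp\Big(-\frac{x^2+y^2}{4t}\Big)I_\alpha\Big(\frac{xy}{2t}\Big).$$ For $\sigma>0$ define $$\mathcal H^{\alpha,\sigma}(x,y)=\frac1{\Gamma(\sigma)}\int_0^\infty e^{-t}\,\mathcal W_t^\alpha(x,y)\,t^{\sigma-1}\,dt,\qquad \mathcal J^{\alpha,\sigma}f(x)=\int_0^\infty \mathcal H^{\alpha,\sigma}(x,y)f(y)\,dy,\qquad x,y>0.$$ All $L^p$ spaces are over $\mathbb{R}_+=(0,\infty)$ with Lebesgue measure. Boundedness from $L^p$ to $L^q$ means that for every $f\in L^p$ the integral defining the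 operator converges for a.e. $x$ and the norm inequality holds with a constant independent of $f$. Convention: $1/\infty=0$. *)

(* Defs.v *)
From HB Require Import structures.
From mathcomp Require Import all_boot all_order all_algebra.
From mathcomp Require Import all_classical all_reals all_analysis.
From mathcomp Require Import measurable_realfun.
Set Implicit Arguments.
Unset Strict Implicit.
Unset Printing Implicit Defensive.
Import Order.TTheory GRing.Theory Num.Theory.
Import numFieldNormedType.Exports.
Local Open Scope classical_set_scope.
Local Open Scope ring_scope.

Section BesselPotential.
Variable R : realType.
Local Notation mu := (@lebesgue_measure R).

Definition Rpos : set R := `]0, +oo[.

(* Euler's integral, used only at s > 0, where it converges. *)
Definition Gamma (s : R) : R :=
  \int[mu]_(t in Rpos) (t `^ (s - 1) * expR (- t)).

(* I_alpha(z) = sum_k (z/2)^(2k+alpha) / (k! Gamma(k+alpha+1)), for alpha > -1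
   and z > 0, so that every argument of Gamma is positive. *)
Definition besselI (alpha z : R) : R :=
  limn (series (fun k : nat =>
    (z / 2) `^ (k.*2%:R + alpha) / (k`!%:R * Gamma (k%:R + alpha + 1)))).

Definition heatW (alpha t x y : R) : R :=
  (x * y) `^ (1 / 2) / (2 * t) * expR (- ((x ^+ 2 + y ^+ 2) / (4 * t)))
  * besselI alpha (x * y / (2 * t)).

(* Extended-real-valued: the integral may be +oo on the diagonal x = y. *)
Definition potentialH (alpha sigma x y : R) : \bar R :=
  ((Gamma sigma)^-1%:E *
   \int[mu]_(t in Rpos)
     (expR (- t) * heatW alpha t x y * t `^ (sigma - 1))%:E)%E.

Definition potentialJ (alpha sigma : R) (f : R -> R) (x : R) : \bar R :=
  (\int[mu]_(y in Rpos) (potentialH alpha sigma x y * (f y)%:E))%E.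

(* L^p norm over (0, +oo): extending by 0 changes neither the integral for
   finite p >= 1 nor the essential supremum of the absolute value. *)
Definition normLp (p : \bar R) (g : R -> \bar R) : \bar R :=
  'N[mu]_p[g \_ Rpos]%E.

Definition inLp (p : \bar R) (g : R -> \bar R) : Prop :=
  measurable_fun Rpos g /\ (normLp p g < +oo)%E.

Definition potentialJ_bounded (alpha sigma : R) (p q : \bar R) : Prop :=
  exists C : R, forall f : R -> R, inLp p (EFin \o f) ->
    [/\ {ae mu, forall x, Rpos x ->
           mu.-integrable Rpos (fun y => potentialH alpha sigma x y * (f y)%:E)%E},
        inLp q (potentialJ alpha sigma f) &
        (normLp q (potentialJ alpha sigma f) <= C%:E * normLp p (EFin \o f))%E].

End BesselPotential.

(* Main.v *)
Require Import Defs.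
From HB Require Import structures.
From mathcomp Require Import all_boot all_order all_algebra.
From mathcomp Require Import all_classical all_reals all_analysis.
From mathcomp Require Import measurable_realfun ess_sup_inf.
From mathcomp Require Import ring lra.

(** The potential kernel H(x,y) of order sigma is no more singular at the
    diagonal than the fractional integration kernel |x-y|^(2 sigma-1), with a
    logarithm or no singularity at all when 2 sigma >= 1, and it decays fast away
    from the diagonal; when alpha < -1/2 it has in addition the singularity
    (xy)^(alpha+1/2) at the axes. The theorem says that only these two features
    decide boundedness.

    Kernel estimates. The basis is the two-sided bound
    I_alpha(z) ~ z^alpha (1+z)^(-alpha-1/2) e^z for z > 0, [besselI_bounds].
    For alpha >= 1/2 the k-th term of the Bessel series is, up to the factor
    (z/2)^alpha, the k-th term of cosh z times a coefficient of size
    (k+1)^(-alpha-1/2), by Bernoulli's inequality, and the mass of cosh z sits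
    at indices comparable with z.
    Smaller alpha follow from the recurrence
    I_alpha = (2 (alpha+1)/z) I_(alpha+1) + I_(alpha+2), all of whose terms are
    positive. Hence the heat kernel is a Gaussian times (z/(1+z))^(alpha+1/2)
    with z = xy/2t, [heatW_bounds], and integration in t gives, for
    0 < delta <= 2 sigma and delta < 1, a bound by the kernel equal to
    |x-y|^(delta-1) at short and |x-y|^(-2) at long distance,
    [potentialH_le_localG]; for alpha < -1/2 two Hardy kernels have to be added,
    [potentialH_le_sing].

    Sufficiency. If 1/p - 1/q < 2 sigma, some delta > 1/p - 1/q is available and
    the local part is handled by Young's inequality, here an instance of a
    weighted Schur test ([schur], [young_localG]). On the line
    1/p - 1/q = 2 sigma the same bound becomes the Hardy-Littlewood-Sobolev
    inequality, [hardy_littlewood_sobolev], whose failure at p = 1 and q = oo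
    explains the two excluded points. The Hardy kernels are bounded by the Schur
    test with power weights ([strong_hardyL], [strong_hardyR]) as soon as
    -alpha-1/2 is less than both 1 - 1/p and 1/q; the former says
    p > 2/(2 alpha+3). For q = oo Hoelder's inequality on each line suffices.
    Bounds for nonnegative functions give the whole statement, including the
    convergence almost everywhere, by [opBounded_potentialJ].

    Necessity. Indicators of long intervals far from the origin force
    1/q <= 1/p, and indicators of short intervals at 1 force
    1/p - 2 sigma <= 1/q. At the excluded points a truncated power or an
    approximate identity produces the divergent integral of 1/u. If
    alpha < -1/2, the image of the indicator of [1,2] is at least a multiple of
    x^(alpha+1/2) on (0,1], so this power has to belong to L^q. *)

Set Implicit Arguments.
Unset Strict Implicit.
Unset Printing Implicit Defensive.
Import Order.TTheory GRing.Theory Num.Theory.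
Import numFieldNormedType.Exports.
Local Open Scope classical_set_scope.
Local Open Scope ring_scope.

(** * Measurability and invariance of the integral *)

Section Measurability.
Variable R : realType.

Lemma measurable_invr : measurable_fun setT (fun x : R => x^-1).
Proof.
rewrite (_ : (fun x : R => x^-1) =
  (fun x : R => if 0 <= x then x `^ (-1) else - (- x) `^ (-1))); last first.
  apply/funext => x; case: ifPn => [x0|]; first by rewrite powR_inv1.
  by rewrite -ltNge => x0; rewrite powR_inv1 ?oppr_ge0 1?ltW// invrN opprK.
apply: measurable_fun_ifT.
- apply: measurable_fun_ler; [exact: measurable_cst|exact: measurable_id].
- exact: measurable_powR.
- apply: measurable_funN; apply: (measurableT_comp (measurable_powR _)).
  exact: measurable_funN.
Qed.

End Measurability.

(** One step of a syntax-directed search for the measurability of an explicit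
    expression in the variables of a product; [mfun] iterates it. *)
Ltac mstep := lazymatch goal with
  | |- measurable_fun _ (fun z => EFin (@?f z)) => apply/measurable_EFinP
  | |- measurable_fun _ (EFin \o _) => apply/measurable_EFinP
  | |- measurable_fun _ (fun _ => ?c) => exact: measurable_cst
  | |- measurable_fun _ (fun z => z) => exact: measurable_id
  | |- measurable_fun _ (fun z => fst z) => exact: measurable_fst
  | |- measurable_fun _ (fun z => snd z) => exact: measurable_snd
  | |- measurable_fun _ (fun z => fst (@?f z)) =>
      apply: (measurableT_comp measurable_fst)
  | |- measurable_fun _ (fun z => snd (@?f z)) =>
      apply: (measurableT_comp measurable_snd)
  | |- measurable_fun _ (fun z => (@?f z + @?g z)%R) =>
      first [apply: measurable_funD | apply: emeasurable_funD]
  | |- measurable_fun _ (fun z => (- @?f z)%R) => apply: measurable_funN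
  | |- measurable_fun _ (fun z => (@?f z * @?g z)%R) =>
      apply: measurable_funM
  | |- measurable_fun _ (fun z => (@?f z * @?g z)%E) =>
      apply: emeasurable_funM
  | |- measurable_fun _ (fun z => (@?f z + @?g z)%E) =>
      apply: emeasurable_funD
  | |- measurable_fun _ (fun z => (@?f z `^ _)%E) =>
      apply: (measurableT_comp (measurable_poweR _))
  | |- measurable_fun _ (fun z => ((@?f z)^-1)%R) =>
      apply: (measurableT_comp (@measurable_invr _))
  | |- measurable_fun _ (fun z => (@?f z ^+ _)%R) => apply: measurable_funX
  | |- measurable_fun _ (fun z => (@?f z `^ _)%R) =>
      apply: (measurableT_comp (measurable_powR _))
  | |- measurable_fun _ (fun z => expR (@?f z)) =>
      apply: (measurableT_comp (@measurable_expR _))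
  | |- measurable_fun _ (fun z => Num.norm (@?f z)) =>
      apply: (measurableT_comp (@normr_measurable _ setT))
  | |- measurable_fun _ (fun z => (@?f z < @?g z)%R) =>
      apply: measurable_fun_ltr
  | |- measurable_fun _ (fun z => (@?f z <= @?g z)%R) =>
      apply: measurable_fun_ler
  | |- measurable_fun _ (fun z => andb (@?f z) (@?g z)) =>
      apply: measurable_and
  | |- measurable_fun _ (fun z => ?f (@?g z)) =>
      apply: (@measurableT_comp _ _ _ _ _ _ f); [assumption|]
  | |- measurable_fun _ _ =>
      first [ exact: oppr_measurable | exact: normr_measurable
            | exact: measurable_expR | exact: measurable_invr
            | exact: measurable_powR | exact: measurable_id
            | exact: measurable_fst | exact: measurable_snd
            | (apply: measurable_fun_ltr; [exact: measurable_cst|exact: measurable_id])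
            | (apply: measurable_fun_ler; [exact: measurable_cst|exact: measurable_id])
            | apply: measurable_fun_ifT ]
  end.
Ltac mfun := repeat first [assumption | mstep].

Section Tonelli.
Variable R : realType.
Notation mu := (@lebesgue_measure R).
Local Open Scope ereal_scope.

Lemma measurable_restrict_snd (E : set R) (mE : measurable E)
    d (T : measurableType d) (k : T * R -> \bar R) :
  measurable_fun setT k ->
  measurable_fun setT (fun z => ((fun y => k (z.1, y)) \_ E) z.2).
Proof.
move=> mk.
rewrite (_ : (fun z => _) = k \_ (snd @^-1` E)); last first.
  apply/funext => -[x y]; rewrite /patch.
  by rewrite (_ : ((x, y) \in snd @^-1` E) = (y \in E))//; apply/idP/idP; rewrite !inE.
apply/(measurable_restrictT _ _).1; last exact: measurable_funTS.
by rewrite -[X in measurable X]setTI; exact: measurable_snd.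
Qed.

Lemma measurable_integral_snd (E : set R) (mE : measurable E)
    d (T : measurableType d) (k : T * R -> \bar R) :
  measurable_fun setT k -> (forall z, 0 <= k z) ->
  measurable_fun setT (fun x => \int[mu]_(y in E) k (x, y)).
Proof.
move=> mk k0.
under eq_fun do rewrite integral_mkcond.
pose h (z : T * R) := ((fun y => k (z.1, y)) \_ E) z.2.
have mh : measurable_fun setT h by exact: measurable_restrict_snd.
have h0 z : 0 <= h z by apply: erestrict_ge0.
exact: (measurable_fun_fubini_tonelli_F (m2 := mu) h mh h0).
Qed.

(** Restricting the integrand to D x E turns this into the theorem for the whole
    plane. *)
Lemma tonelli_setX (D E : set R) (k : R * R -> \bar R) :
  measurable D -> measurable E ->
  measurable_fun setT k -> (forall z, 0 <= k z) ->
  \int[mu]_(x in D) \int[mu]_(y in E) k (x, y) =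
  \int[mu]_(y in E) \int[mu]_(x in D) k (x, y).
Proof.
move=> mD mE mk k0.
pose h := k \_ (D `*` E).
have mDE : measurable (D `*` E) by exact: measurableX.
have mh : measurable_fun setT h.
  by apply/(measurable_restrictT _ _).1 => //; exact: measurable_funTS.
have h0 z : 0 <= h z by apply: erestrict_ge0.
have hE1 x : \int[mu]_y h (x, y) = ((fun x => \int[mu]_(y in E) k (x, y)) \_ D) x.
  rewrite /patch; case: ifPn => xD.
    rewrite [RHS]integral_mkcond; apply: eq_integral => y _.
    by rewrite /h /patch in_setX xD.
  rewrite (eq_integral (cst 0)) ?integral0// => y _.
  by rewrite /h /patch in_setX (negbTE xD).
have hE2 y : \int[mu]_x h (x, y) = ((fun y => \int[mu]_(x in D) k (x, y)) \_ E) y.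
  rewrite /patch; case: ifPn => yE.
    rewrite [RHS]integral_mkcond; apply: eq_integral => x _.
    by rewrite /h /patch in_setX yE andbT.
  rewrite (eq_integral (cst 0)) ?integral0// => x _.
  by rewrite /h /patch in_setX (negbTE yE) andbF.
rewrite integral_mkcond [RHS]integral_mkcond.
transitivity (\int[mu]_x \int[mu]_y h (x, y)).
  by apply: eq_integral => x _; rewrite hE1.
transitivity (\int[mu]_y \int[mu]_x h (x, y)).
  exact: (fubini_tonelli (m1 := mu) (m2 := mu) h mh h0).
by apply: eq_integral => x _; rewrite hE2.
Qed.

End Tonelli.

Section Invariance.
Variable R : realType.
Notation mu := (@lebesgue_measure R).
Local Open Scope ereal_scope.

Lemma lebesgue_measureD (c : R) (A : set R) : measurable A ->
  pushforward mu ((fun x => x + c)%R : _ -> measurableTypeR R) A = mu A.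
Proof.
move=> mA; apply/esym.
have mf : measurable_fun setT (fun x : R => (x + c)%R) by mfun.
pose h : measurableTypeR R -> measurableTypeR R := fun x => (x + c)%R.
have mh : measurable_fun setT h by exact: mf.
pose f : {mfun measurableTypeR R >-> measurableTypeR R} := mfun_Sub (mem_set mh).
apply: (lebesgue_measure_unique (mu := pushforward mu f)) => //= _ [[a b]] _ <-.
rewrite /pushforward /=.
rewrite (_ : _ @^-1` _ = `](a - c)%R, (b - c)%R]%classic); last first.
  by apply/seteqP; split => x /=; rewrite !in_itv /= ltrBlDr lerBrDr.
rewrite !lebesgue_measure_itv/= !lte_fin.
by congr (if _ then _ else _); [apply/idP/idP|rewrite -!EFinB; congr EFin]; lra.
Qed.

Lemma ge0_integral_shift (c : R) (D : set R) (f : R -> \bar R) :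
  measurable D -> measurable_fun setT f -> (forall x, 0 <= f x) ->
  \int[mu]_(x in D) f x =
  \int[mu]_(x in [set x | D (x + c)%R]) f (x + c)%R.
Proof.
move=> mD mf f0.
have mh0 : measurable_fun setT (fun x : R => (x + c)%R) by mfun.
pose h : measurableTypeR R -> measurableTypeR R := fun x => (x + c)%R.
have mh : measurable_fun setT h by exact: mh0.
have := @ge0_integral_pushforward _ _ _ _ _ _ mh mu D f mD (measurable_funTS mf) (fun y _ => f0 y).
move=> /= <-.
by apply: eq_measure_integral => A mA _; rewrite -[LHS](lebesgue_measureD c).
Qed.

Lemma ge0_integral_opp (D : set R) (f : R -> \bar R) :
  measurable D -> measurable_fun setT f -> (forall x, 0 <= f x) ->
  \int[mu]_(x in D) f x = \int[mu]_(x in [set x | D (- x)%R]) f (- x)%R.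
Proof.
move=> mD mf f0.
have mh0 : measurable_fun setT (fun x : R => (- x)%R) by mfun.
pose h : measurableTypeR R -> measurableTypeR R := fun x => (- x)%R.
have mh : measurable_fun setT h by exact: mh0.
have := @ge0_integral_pushforward _ _ _ _ _ _ mh mu D f mD (measurable_funTS mf) (fun y _ => f0 y).
move=> /= <-.
by apply: eq_measure_integral => A mA _; rewrite -[LHS]lebesgue_measureN.
Qed.

(** Translation by x and reflection fold the two half-lines around x onto
    (0, oo), whence the factor 2. *)
Lemma integral_dist_le (g : R -> R) (x : R) (D : set R) :
  measurable D -> measurable_fun setT g -> (forall u, (0 <= g u)%R) ->
  \int[mu]_(y in D) (g `|x - y|)%:E <= 2%:E * \int[mu]_(u in @Rpos R) (g u)%:E.
Proof.
move=> mD mg g0.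
have mgx : measurable_fun setT (fun y : R => (g `|x - y|)%:E) by mfun.
have mR : measurable (@Rpos R) by exact: measurable_itv.
apply: (@le_trans _ _ (\int[mu]_y (g `|x - y|)%:E)).
  by apply: ge0_subset_integral => // y _; rewrite lee_fin.
rewrite (ge0_integral_shift x)//=; last by move=> y; rewrite lee_fin.
have E1 : [set: R] = `]-oo, 0%R[%classic `|` (`]0%R, +oo[%classic `|` [set 0%R]).
  apply/seteqP; split => // y _ /=; rewrite !in_itv /= andbT.
  by case: (ltgtP y 0%R) => //; [left|right; left|right; right].
rewrite [X in \int[mu]_(_ in X) _](_ : _ = [set: R]); last exact/seteqP.
have mg' : measurable_fun setT (fun y : R => (g `|x - (y + x)|)%:E) by mfun.
have mgT A : measurable_fun A (fun y : R => (g `|x - (y + x)|)%:E).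
  exact: measurable_funTS.
have gT0 A (y : R) : A y -> 0 <= (g `|x - (y + x)|)%:E by rewrite lee_fin.
have m1 : measurable (`]-oo, 0%R[%classic : set R) by exact: measurable_itv.
have m2 : measurable (`]0%R, +oo[%classic : set R) by exact: measurable_itv.
have m3 : measurable ([set 0%R] : set R) by exact: measurable_set1.
have d12 : [disjoint `]-oo, 0%R[%classic : set R & `]0%R, +oo[%classic `|` [set 0%R]].
  by apply/disj_setPS => y /= []; rewrite !in_itv/= andbT => y0 [y1|y1]; clear -y0 y1; lra.
have d23 : [disjoint `]0%R, +oo[%classic : set R & [set 0%R]].
  by apply/disj_setPS => y /= []; rewrite !in_itv/= andbT => y0 y1; clear -y0 y1; lra.
rewrite E1 (ge0_integral_setU mu m1 (measurableU _ _ m2 m3) (mgT _) (gT0 _) d12).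
rewrite (ge0_integral_setU mu m2 m3 (mgT _) (gT0 _) d23).
rewrite integral_set1 adde0 (ge0_integral_opp (D := `]-oo, 0%R[%classic))//; last by move=> y; rewrite lee_fin.
rewrite (_ : [set _ | _] = @Rpos R); last first.
  by apply/seteqP; split => y; rewrite /Rpos /= !in_itv/= ?andbT oppr_lt0.
rewrite (_ : 2 = 1 + 1)//= ge0_muleDl// mul1e.
have mN : measurable_fun (@Rpos R) (fun y : R => (g `|x - (- y + x)|)%:E).
  by apply: measurable_funTS; mfun.
have mg1 : measurable_fun (@Rpos R) (fun y : R => (g y)%:E).
  by apply: measurable_funTS; mfun.
apply: leeD; apply: ge0_le_integral => //; try by move=> y _; rewrite lee_fin.
- move=> y; rewrite /Rpos /= in_itv /= andbT => y0.
  by rewrite opprD opprK addrC subrK gtr0_norm ?lexx.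
- exact: mgT.
- move=> y; rewrite /= in_itv /= andbT => y0.
  by rewrite opprD addrC subrK normrN gtr0_norm ?lexx.
Qed.

End Invariance.

(** * Integrals of powers *)

Section PowerIntegrals.
Variable R : realType.
Notation mu := (@lebesgue_measure R).

Lemma gt0_powRD (x r s : R) : 0 < x -> x `^ (r + s) = x `^ r * x `^ s.
Proof. by move=> x0; rewrite powRD// (gt_eqF x0) implybT. Qed.

Lemma le0_ler_powR (r x y : R) : r <= 0 -> 0 < x -> x <= y -> y `^ r <= x `^ r.
Proof.
move=> r0 x0 xy; have y0 : 0 < y by exact: lt_le_trans xy.
rewrite -(opprK r) !(powRN _ (- r)) lef_pV2 ?posrE ?powR_gt0//.
by apply: ge0_ler_powR => //; rewrite ?oppr_ge0// nnegrE ltW.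
Qed.

Lemma powR_ge1 (x r : R) : 1 <= x -> 0 <= r -> 1 <= x `^ r.
Proof. by move=> x1 r0; have := ler_powR x1 r0; rewrite powRr0. Qed.

Lemma continuous_powR_gt0 (a x : R) : 0 < x -> {for x, continuous (fun t : R => t `^ a)}.
Proof.
move=> x0; apply: differentiable_continuous; apply/derivable1_diffP.
by apply: derivable_powR; rewrite in_itv/= x0.
Qed.

Lemma is_derive_powR (a x : R) : 0 < x ->
  is_derive x 1 (fun t : R => t `^ a) (a * x `^ (a - 1)).
Proof.
move=> x0; have x0' : x \in `]0, +oo[%R by rewrite in_itv/= x0.
have := @derivable_powR R 1 a x x0' => /derivableP.
by rewrite -derive1E powR_derive1.
Qed.

Lemma integral_powR_itv (a x y : R) : a != 0 -> 0 < x -> x < y ->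
  (\int[mu]_(t in `[x, y]) (t `^ (a - 1))%:E = ((y `^ a - x `^ a) / a)%:E)%E.
Proof.
move=> a0 x0 xy.
have pos t : t \in `[x, y] -> 0 < t by rewrite in_itv/= => /andP[xt _]; lra.
have pos' t : t \in `]x, y[ -> 0 < t by rewrite in_itv/= => /andP[xt _]; lra.
pose F (t : R) := a^-1 * t `^ a.
have dF (t : R) : 0 < t -> is_derive t 1 F (t `^ (a - 1)).
  move=> t0; have := is_derive_powR a t0 => H.
  by have := is_deriveZ a^-1 H; rewrite /GRing.scale /= mulrA mulVf// mul1r.
have cF (t : R) : 0 < t -> {for t, continuous F}.
  move=> t0; apply: differentiable_continuous; apply/derivable1_diffP.
  by have [] := dF t t0.
rewrite (@continuous_FTC2 _ _ F)//.
- by rewrite /F -EFinB -mulrBr mulrC.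
- apply: continuous_in_subspaceT => t /[!inE] ?.
  by apply: continuous_powR_gt0; exact: pos.
- split.
  + by move=> t /pos' t0; have [] := dF t t0.
  + by apply: cvg_at_right_filter; apply: cF; lra.
  + by apply: cvg_at_left_filter; apply: cF; lra.
- by move=> t /pos' t0; rewrite derive1E; have [_ ->] := dF t t0.
Qed.

(** The integrand may be unbounded at 0, so the fundamental theorem of calculus
    is applied on [A/(n+2), A] and n tends to infinity. *)
Lemma integral_powR_near0 (a A : R) : 0 < a -> 0 < A ->
  (\int[mu]_(t in `]0%R, A]) (t `^ (a - 1))%:E = (A `^ a / a)%:E)%E.
Proof.
move=> a0 A0.
pose F n := `[A / n.+2%:R, A]%classic.
have mt : measurable_fun setT (fun t : R => (t `^ (a - 1))%:E) by mfun.
have hF : \bigcup_i F i = `]0, A]%classic.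
  apply/seteqP; split => [t [n _]|t]; rewrite /F /= !in_itv/=.
    move=> /andP[h1 ->]; rewrite andbT; apply: lt_le_trans h1.
    by rewrite divr_gt0.
  move=> /andP[t0 tA]; exists (Num.truncn (A / t)) => //=.
  rewrite in_itv /= tA andbT ler_pdivrMr// -ler_pdivrMl//.
  rewrite mulrC; apply: ltW; apply: lt_trans (Num.Theory.truncnS_gt _) _.
  by rewrite ltr_nat.
have h : (\int[mu]_(t in F n) (t `^ (a - 1))%:E @[n --> \oo] -->
       \int[mu]_(t in `]0%R, A]) (t `^ (a - 1))%:E)%E.
  rewrite -hF; apply: ge0_nondecreasing_set_cvg_integral.
  - apply/nondecreasing_seqP => n; rewrite subsetEset => t; rewrite /F /= !in_itv/=.
    move=> /andP[h1 ->]; rewrite andbT; apply: le_trans h1.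
    by rewrite ler_pM2l// lef_pV2 ?posrE// ler_nat.
  - by move=> n; exact: measurable_itv.
  - by move=> n; exact: measurable_funTS.
  - by move=> n t _; rewrite lee_fin powR_ge0.
have FE n : (\int[mu]_(t in F n) (t `^ (a - 1))%:E = ((A `^ a - (A / n.+2%:R) `^ a) / a)%:E)%E.
  apply: integral_powR_itv; rewrite ?gt_eqF ?divr_gt0//.
  by rewrite ltr_pdivrMr// ltr_pMr// (ltr_nat R 1).
suff h2 : (\int[mu]_(t in F n) (t `^ (a - 1))%:E @[n --> \oo] --> (A `^ a / a)%:E)%E.
  exact: (cvg_unique _ h h2).
rewrite (_ : (fun n => _) = (fun n => ((A `^ a - (A / n.+2%:R) `^ a) / a)%:E)); last exact/funext.
apply: cvg_EFin; first exact: nearW.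
have c0 : (fun n => (A / n.+2%:R) `^ a) @ \oo --> (0 : R).
  have /cvg_at_rightP := powR_cvg0 a0; apply; split => [n|]; first by rewrite divr_gt0.
  rewrite -(mulr0 A); apply: cvgMr.
  by have := @cvg_harmonic R; rewrite -cvg_shiftS; apply.
have h3 : (fun n => (A `^ a - (A / n.+2%:R) `^ a) / a) @ \oo --> (A `^ a / a : R).
  rewrite (_ : A `^ a / a = (A `^ a - 0) / a); last by rewrite subr0.
  by apply: cvgMl; apply: cvgB => //; exact: cvg_cst.
exact: h3.
Qed.

Lemma powRN_cvg_pinfty (a : R) : 0 < a -> t `^ (- a) @[t --> +oo] --> (0 : R).
Proof.
move=> a0; apply/cvgrPdist_le => e e0; near=> t.
have h : e^-1 `^ a^-1 <= t by near: t; apply: nbhs_pinfty_ge; rewrite num_real.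
have e1 : 0 < e^-1 `^ a^-1 by rewrite powR_gt0// invr_gt0.
have t0 : 0 < t by exact: lt_le_trans h.
rewrite sub0r normrN ger0_norm ?powR_ge0// powRN -[leRHS]invrK.
rewrite lef_pV2 ?posrE ?powR_gt0 ?invr_gt0//.
rewrite -[leLHS]powRr1; last by rewrite invr_ge0 ltW.
rewrite -(mulVf (lt0r_neq0 a0)) powRrM.
by apply: ge0_ler_powR => //; rewrite ?nnegrE ltW.
Unshelve. all: by end_near.
Qed.

Lemma integral_powR_infty (a A : R) : 0 < a -> 0 < A ->
  (\int[mu]_(t in `[A, +oo[) (t `^ (- a - 1))%:E = (A `^ (- a) / a)%:E)%E.
Proof.
move=> a0 A0.
pose F (t : R) := - a^-1 * t `^ (- a).
have dF (t : R) : 0 < t -> is_derive t 1 F (t `^ (- a - 1)).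
  move=> t0; have := is_derive_powR (- a) t0 => H.
  by have := is_deriveZ (- a^-1) H; rewrite /GRing.scale /= mulrA mulrNN mulVf ?gt_eqF// mul1r.
have cF (t : R) : 0 < t -> {for t, continuous F}.
  move=> t0; apply: differentiable_continuous; apply/derivable1_diffP.
  by have [] := dF t t0.
rewrite (@ge0_continuous_FTC2y _ _ F _ 0).
- by rewrite /F -EFinB sub0r mulNr opprK mulrC.
- by move=> x _; exact: powR_ge0.
- apply: continuous_in_subspaceT => t /[!inE]; rewrite /= in_itv/= andbT => At.
  by apply: continuous_powR_gt0; lra.
- rewrite -(mulr0 (- a^-1)); apply: cvgMr.
  exact: powRN_cvg_pinfty.
- by move=> t At; have [] := dF t (lt_trans A0 At).
- by apply: cvg_at_right_filter; apply: cF.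
- by move=> t; rewrite in_itv/= andbT => At; rewrite derive1E; have [_ ->] := dF t (lt_trans A0 At).
Qed.

End PowerIntegrals.

(** * The Gamma function *)

Section Gamma.
Variable R : realType.
Notation mu := (@lebesgue_measure R).

Lemma integral_if (D A : set R) (b : R -> bool) (f : R -> R) :
  A `<=` D -> (forall x, D x -> b x <-> A x) ->
  (\int[mu]_(x in D) (if b x then f x else 0)%:E = \int[mu]_(x in A) (f x)%:E)%E.
Proof.
move=> AD bA; rewrite integral_mkcond [RHS]integral_mkcond.
apply: eq_integral => x _; rewrite /patch.
case: ifPn => [/set_mem xD|xD].
  case: ifPn => bx; first by rewrite mem_set//; exact/(bA x xD).
  by rewrite memNset// => /(bA x xD); rewrite (negbTE bx).
by rewrite memNset// => /AD xD'; rewrite (mem_set xD') in xD.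
Qed.

Lemma integral_const (A : set R) (c : R) : measurable A ->
  (\int[mu]_(t in A) c%:E = c%:E * mu A)%E.
Proof. by move=> mA; exact: integral_cst. Qed.

Lemma powR_le_expR (a : R) : 0 <= a ->
  exists2 C : R, 0 < C & forall t : R, 0 <= t -> t `^ a <= C * expR t.
Proof.
move=> a0; pose n := Num.truncn a; exists (1 + (n.+1)`!%:R) => [|t t0].
  by rewrite ltr_pwDl.
have [t1|/ltW t1] := leP t 1.
  apply: (@le_trans _ _ 1).
    rewrite -(powRr0 t).
    have [->|tn0] := eqVneq t 0.
      rewrite powRr0; have [->|?] := eqVneq a 0; first by rewrite powRr0.
      by rewrite powR0.
    by apply: ger_powR => //; rewrite lt_neqAle eq_sym tn0 t0.
  rewrite -[X in X <= _]mulr1 ler_pM// ?lerDl ?ler0n//.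
  by rewrite -expR0 ler_expR.
apply: (@le_trans _ _ (t `^ n.+1%:R)).
  by apply: ler_powR => //; apply: ltW; exact: truncnS_gt.
rewrite powR_mulrn// mulrDl mul1r ler_wpDl ?expR_ge0//.
rewrite -ler_pdivrMl ?ltr0n ?fact_gt0//.
have := expR_ge1Dxn n t0; rewrite mulrC; lra.
Qed.

Lemma powR_le_expRZ (a e : R) : 0 <= a -> 0 < e ->
  exists2 C : R, 0 < C & forall t : R, 0 <= t -> t `^ a <= C * expR (e * t).
Proof.
move=> a0 e0; have [C C0 h] := powR_le_expR a0.
exists (e `^ (- a) * C) => [|t t0]; first by rewrite mulr_gt0// powR_gt0.
have := h (e * t); rewrite powRM ?(ltW e0)// => /(_ (mulr_ge0 (ltW e0) t0)) ht.
by rewrite -mulrA powRN ler_pdivlMl// ?powR_gt0.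
Qed.

(** The exponent m is free: it is chosen later so that a Gaussian factor turns
    into the power of |x-y| that is wanted. *)
Lemma expRN_le_powRN (m : R) : 0 <= m ->
  exists2 C : R, 0 < C & forall v : R, 0 < v -> expR (- v) <= C * v `^ (- m).
Proof.
move=> m0; have [C C0 h] := powR_le_expR m0; exists C => // v v0.
rewrite expRN powRN -[leLHS]mul1r ler_pdivrMr ?expR_gt0// mulrAC ler_pdivlMr ?powR_gt0//.
by rewrite mul1r h// ltW.
Qed.

(** [Gamma] as an extended real, to which the theorems on nonnegative integrals
    apply without a finiteness hypothesis. *)
Definition EGamma (s : R) : \bar R :=
  (\int[mu]_(t in @Rpos R) (t `^ (s - 1) * expR (- t))%:E)%E.

Lemma measurable_Rpos : measurable (@Rpos R).
Proof. exact: measurable_itv. Qed.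

Lemma RposP (x : R) : Rpos x <-> 0 < x.
Proof. by rewrite /Rpos /= in_itv /= andbT. Qed.

Lemma integral_Rpos_split (r : R) (F : R -> \bar R) : 0 < r ->
  measurable_fun setT F -> (forall t, 0 <= F t)%E ->
  (\int[mu]_(t in @Rpos R) F t =
   \int[mu]_(t in `]0%R, r]) F t + \int[mu]_(t in `]r, +oo[) F t)%E.
Proof.
move=> r0 mF F0; rewrite -ge0_integral_setU//=.
- congr integral; apply/seteqP; split => x; rewrite /Rpos /= !in_itv /= !andbT.
    by move=> x0; case: (leP x r) => x1; [left|right]; rewrite ?x0.
  by move=> [/andP[]//|]; exact: lt_trans.
- exact: measurable_funTS.
- by apply/disj_setPS => y /= []; rewrite !in_itv/= andbT => /andP[_ y0] y1; clear -y0 y1; lra.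
Qed.

Lemma EGamma_fin (s : R) : 0 < s -> (EGamma s < +oo)%E.
Proof.
move=> s0; rewrite /EGamma.
have mf : measurable_fun setT (fun t : R => (t `^ (s - 1) * expR (- t))%:E) by mfun.
have f0 (t : R) : (0 <= (t `^ (s - 1) * expR (- t))%:E)%E.
  by rewrite lee_fin mulr_ge0 ?powR_ge0 ?expR_ge0.
have s1 : 0 <= s + 1 by lra.
have [C C0 h] := expRN_le_powRN s1.
rewrite (integral_Rpos_split ltr01 mf f0); apply: lte_add_pinfty.
  apply: (@le_lt_trans _ _ (\int[mu]_(t in `]0%R, 1%R]) (t `^ (s - 1))%:E)%E).
    apply: ge0_le_integral => //; [exact: measurable_funTS|by apply: measurable_funTS; mfun|].
    move=> t; rewrite /= in_itv/= => /andP[t0 _].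
    by rewrite lee_fin ler_piMr ?powR_ge0// expR_le1 oppr_le0 ltW.
  by rewrite integral_powR_near0// ltry.
apply: (@le_lt_trans _ _ (\int[mu]_(t in `[1%R, +oo[) (C%:E * (t `^ (- 1 - 1))%:E))%E).
  apply: (@le_trans _ _ (\int[mu]_(t in `]1%R, +oo[) (C%:E * (t `^ (- 1 - 1))%:E))%E).
    apply: ge0_le_integral => //; [exact: measurable_funTS|by apply: measurable_funTS; mfun|].
    move=> t; rewrite /= in_itv/= andbT => t1; have t0 : 0 < t by lra.
    rewrite -EFinM lee_fin (le_trans (ler_wpM2l (powR_ge0 _ _) (h t t0)))//.
    by rewrite mulrCA -gt0_powRD// (_ : s - 1 + - (s + 1) = -1 - 1)//; clear; lra.
  apply: ge0_subset_integral => //=; first by apply: measurable_funTS; mfun.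
    by move=> t _; rewrite -EFinM lee_fin mulr_ge0 ?powR_ge0 ?(ltW C0).
  by move=> t; rewrite /= !in_itv/= !andbT => /ltW.
rewrite ge0_integralZl//=.
- by rewrite integral_powR_infty// -EFinM ltry.
- by apply: measurable_funTS; mfun.
- by move=> t _; rewrite lee_fin powR_ge0.
- by rewrite lee_fin ltW.
Qed.

Lemma GammaE (s : R) : 0 < s -> (Gamma s)%:E = EGamma s.
Proof.
move=> s0; rewrite /Gamma /Rintegral fineK// ge0_fin_numE ?EGamma_fin//.
by apply: integral_ge0 => t _; rewrite lee_fin mulr_ge0 ?powR_ge0 ?expR_ge0.
Qed.

Lemma Gamma_gt0 (s : R) : 0 < s -> 0 < Gamma s.
Proof.
move=> s0; rewrite -lte_fin GammaE//.
have mf : measurable_fun setT (fun t : R => (t `^ (s - 1) * expR (- t))%:E) by mfun.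
pose c : R := (Num.min 1 (2 `^ (s - 1))) * expR (- 2).
have c0 : 0 < c by rewrite mulr_gt0 ?expR_gt0// lt_min ltr01 powR_gt0.
apply: (@lt_le_trans _ _ (\int[mu]_(t in `[1%R, 2%R]) (c%:E))%E).
  rewrite integral_const; last exact: measurable_itv.
  rewrite lebesgue_measure_itv/= lte_fin ltr1n -EFinB -EFinM lte_fin.
  by rewrite mulr_gt0//; lra.
apply: (@le_trans _ _ (\int[mu]_(t in `[1%R, 2%R]) (t `^ (s - 1) * expR (- t))%:E)%E).
  apply: ge0_le_integral => //.
  - by move=> t _; rewrite lee_fin ltW.
  - by apply: measurable_funTS; mfun.
  - move=> t; rewrite /= in_itv/= => /andP[t1 t2]; rewrite lee_fin ler_pM ?expR_ge0//.
    + rewrite ge_min; have [s1|s1] := leP 1 s.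
        by rewrite (le_trans _ (ler_powR t1 (_ : 0 <= s - 1))) ?powRr0 ?subr_ge0.
      by rewrite le0_ler_powR ?orbT//; [rewrite subr_le0 ltW|lra].
    + by rewrite ler_expR lerN2.
apply: ge0_subset_integral => //=.
- exact: measurable_Rpos.
- by apply: measurable_funTS; mfun.
- by move=> t _; rewrite lee_fin mulr_ge0 ?powR_ge0 ?expR_ge0.
- by move=> t; rewrite /Rpos /= !in_itv/= andbT => /andP[? _]; lra.
Qed.

Lemma integral_expRN (t : R) :
  (\int[mu]_(u in `[t, +oo[) (expR (- u))%:E = (expR (- t))%:E)%E.
Proof.
pose F (u : R) := - expR (- u).
have dF (u : R) : is_derive u 1 F (expR (- u)).
  by apply: is_derive_eq; rewrite /GRing.scale /= mulrN1 opprK.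
have cF (u : R) : {for u, continuous F}.
  by apply: differentiable_continuous; apply/derivable1_diffP; have [] := dF u.
rewrite (@ge0_continuous_FTC2y _ _ F _ 0).
- by rewrite /F -EFinB sub0r opprK.
- by move=> u _; exact: expR_ge0.
- apply: continuous_in_subspaceT => u _; apply: continuous_comp.
    exact: opp_continuous.
  exact: continuous_expR.
- by rewrite -oppr0; apply: cvgN; exact: cvgr_expR.
- by move=> u _; have [] := dF u.
- by apply: cvg_at_right_filter; apply: cF.
- by move=> u _; rewrite derive1E; have [_ ->] := dF u.
Qed.

(** Instead of integrating by parts, e^(-t) is written as the integral of
    e^(-u) over u >= t and the order of integration is exchanged. *)
Lemma GammaS (s : R) : 0 < s -> Gamma (s + 1) = s * Gamma s.
Proof.
move=> s0; apply/EFin_inj; rewrite EFinM !GammaE ?addr_gt0// /EGamma.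
rewrite -ge0_integralZl//=; last 4 first.
- exact: measurable_Rpos.
- by apply: measurable_funTS; mfun.
- by move=> t _; rewrite lee_fin mulr_ge0 ?powR_ge0 ?expR_ge0.
- by rewrite lee_fin ltW.
pose k (z : R * R) := (if z.1 <= z.2 then s * z.1 `^ (s - 1) * expR (- z.2) else 0)%:E.
have mk : measurable_fun setT k by rewrite /k; mfun.
have k0 z : (0 <= k z)%E.
  rewrite /k; case: ifP => _; rewrite lee_fin// mulr_ge0 ?expR_ge0// mulr_ge0 ?powR_ge0//.
  exact: ltW.
transitivity (\int[mu]_(u in @Rpos R) \int[mu]_(t in @Rpos R) k (t, u))%E.
  apply: eq_integral => u /set_mem /RposP u0.
  transitivity (\int[mu]_(t in `]0%R, u]) (s * t `^ (s - 1) * expR (- u))%:E)%E; last first.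
    apply/esym; apply: integral_if.
    - by move=> t; rewrite /= in_itv/= => /andP[? _]; exact/RposP.
    - by move=> t /RposP t0; rewrite /= in_itv/= t0.
  under eq_integral do rewrite mulrAC EFinM.
  rewrite ge0_integralZl//=; last 3 first.
  - by apply: measurable_funTS; mfun.
  - by move=> t _; rewrite lee_fin powR_ge0.
  - by rewrite lee_fin mulr_ge0 ?expR_ge0 ?ltW.
  rewrite integral_powR_near0// -EFinM addrK; congr EFin.
  by field; rewrite gt_eqF.
rewrite -(tonelli_setX measurable_Rpos measurable_Rpos mk k0).
apply: eq_integral => t /set_mem /RposP t0.
transitivity (\int[mu]_(u in `[t, +oo[) (s * t `^ (s - 1) * expR (- u))%:E)%E.
  apply: integral_if.
  - by move=> u; rewrite /= in_itv/= andbT => ?; apply/RposP; exact: lt_le_trans t0 _.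
  - by move=> u /RposP u0; rewrite /= in_itv/= andbT.
under eq_integral do rewrite EFinM.
rewrite ge0_integralZl//=; last 2 first.
- by apply: measurable_funTS; mfun.
- by rewrite lee_fin mulr_ge0 ?powR_ge0 ?ltW.
by rewrite integral_expRN -!EFinM mulrA.
Qed.

End Gamma.

(** * Exponential sums and the Bessel series *)

Section ExpSums.
Variable R : realType.

(** The Taylor terms of cosh. *)
Definition even_term (x : R) (k : nat) : R := x ^+ k.*2 / (k.*2)`!%:R.

Lemma even_term_ge0 (x : R) k : 0 <= even_term x k.
Proof.
by rewrite /even_term divr_ge0// -mul2n exprM exprn_ge0// sqr_ge0.
Qed.

Lemma series_exp_le (x : R) n : 0 <= x -> series (exp_coeff x) n <= expR x.
Proof.
move=> x0; apply: nondecreasing_cvgn_le; last exact: is_cvg_series_exp_coeff.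
apply/nondecreasing_series => k _ _; exact: exp_coeff_ge0.
Qed.

Lemma series_double (u : nat -> R) N :
  series u N.+1.*2 = series u N.*2 + u N.*2 + u N.*2.+1.
Proof. by rewrite doubleS /series/= !big_nat_recr. Qed.

Lemma sum_even_le (x : R) N : 0 <= x -> \sum_(k < N) even_term x k <= expR x.
Proof.
move=> x0; apply: le_trans (series_exp_le N.*2 x0).
elim: N => [|N ih]; first by rewrite big_ord0 /series/= big_geq.
rewrite big_ord_recr /= doubleS /series/= !big_nat_recr//= -addrA lerD//.
by rewrite lerDl exp_coeff_ge0.
Qed.

(** The mean of the index 2k under the weights of cosh x is x tanh x; this is the
    moment bound that makes Markov's inequality available. *)
Lemma sum_even_mean_le (x : R) N : 0 <= x ->
  \sum_(k < N) even_term x k * k.*2%:R <= x * expR x.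
Proof.
move=> x0; case: N => [|N].
  by rewrite big_ord0 mulr_ge0// expR_ge0.
apply: (@le_trans _ _ (x * series (exp_coeff x) N.*2)); last first.
  by rewrite ler_wpM2l// series_exp_le.
elim: N => [|N ih].
  by rewrite big_ord1 /series/= big_geq// mulr0n !mulr0.
rewrite big_ord_recr series_double -addrA [leRHS]mulrDr lerD//.
rewrite [leRHS]mulrDr ler_wpDl ?mulr_ge0 ?exp_coeff_ge0 ?exprn_ge0//.
rewrite (_ : nat_of_ord ord_max = N.+1)//.
rewrite /even_term doubleS factS natrM exprS.
rewrite -[exp_coeff x _]/(x ^+ N.*2.+1 / (N.*2.+1)`!%:R).
set m := N.*2.+2%:R; set f := (N.*2.+1)`!%:R.
have f0 : 0 < f :> R by rewrite ltr0n fact_gt0.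
have m0 : 0 < m :> R by rewrite ltr0n.
clearbody m f; rewrite le_eqVlt; apply/orP; left; apply/eqP.
by field; rewrite !gt_eqF.
Qed.

(** Odd Taylor terms of exp are dominated by their even neighbours through
    the arithmetic-geometric mean, so cosh keeps a fixed part of exp. *)
Lemma sum_even_ge (x : R) : 0 <= x ->
  exists N, expR x / 5 <= \sum_(k < N) even_term x k.
Proof.
move=> x0.
have step N : series (exp_coeff x) N.*2 <=
    5 / 2 * (\sum_(k < N) even_term x k) + even_term x N / 2.
  elim: N => [|N ih].
    by rewrite /series/= big_geq// big_ord0 mulr0 add0r divr_ge0// even_term_ge0.
  rewrite series_double big_ord_recr/=.
  suff : exp_coeff x N.*2.+1 <= even_term x N + even_term x N.+1 / 2.
    have -> : exp_coeff x N.*2 = even_term x N by [].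
    move: ih; lra.
  rewrite /even_term doubleS !factS !natrM !exprS.
  rewrite -[exp_coeff x _]/(x ^+ N.*2.+1 / (N.*2.+1)`!%:R) factS natrM exprS.
  set f := (N.*2`!)%:R; set y := x ^+ N.*2; set m : R := N.*2.+1%:R.
  have -> : N.*2.+2%:R = m + 1 :> R by rewrite /m -(natr1 N.*2.+1).
  have m1 : 1 <= m by rewrite ler1n.
  have f0 : 0 < f by rewrite ltr0n fact_gt0.
  have y0 : 0 <= y by rewrite exprn_ge0.
  clearbody f y m.
  have -> : x * y / (m * f) = y / f * (x / m) by field; rewrite !gt_eqF//; lra.
  have -> : y / f + x * (x * y) / ((m + 1) * (m * f)) / 2 =
     y / f * (1 + x ^+ 2 / ((m + 1) * m * 2)).
    by field; rewrite !gt_eqF//; lra.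
  rewrite ler_wpM2l// ?divr_ge0//; first lra.
  have -> : 1 + x ^+ 2 / ((m + 1) * m * 2) = ((m + 1) * m * 2 + x ^+ 2) / ((m + 1) * m * 2).
    by field; rewrite !gt_eqF//; lra.
  rewrite ler_pdivlMr; last by rewrite !mulr_gt0//; lra.
  have -> : x / m * ((m + 1) * m * 2) = x * (m + 1) * 2 by field; rewrite gt_eqF//; lra.
  (* m = 2N+1: neighbouring even terms bound the odd one by this square *)
  have : 0 <= (x - (m + 1)) ^+ 2 by exact: sqr_ge0.
  nra.
have : \forall n \near \oo, expR x / 2 <= series (exp_coeff x) n.
  apply: (cvgr_ge (expR x)); first exact: is_cvg_series_exp_coeff.
  by have := expR_gt0 x; lra.
move=> [n _ hn].
have /hn hn' : (n <= n.*2)%N by rewrite -addnn leq_addr.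
exists n.+1; rewrite big_ord_recr/=.
have := step n; have := even_term_ge0 x n; move: hn' => /=; lra.
Qed.
End ExpSums.

Section Bernoulli.
Variable R : realType.
(** Young's inequality for the exponents b and b/(b-1), applied to the pair
    (1 + y, 1). *)
Lemma bernoulli_powR (b y : R) : 1 <= b -> -1 < y -> 1 + b * y <= (1 + y) `^ b.
Proof.
move=> b1 y1; have y0 : 0 <= 1 + y by lra.
have [->|bn1] := eqVneq b 1; first by rewrite mul1r powRr1.
have b0 : 0 < b by lra.
have b1' : 1 < b by rewrite lt_neqAle eq_sym bn1.
pose q := b / (b - 1).
have q0 : 0 < q by rewrite divr_gt0// subr_gt0.
have := @conjugate_powR _ (1 + y) 1 b q y0 ler01 b0 q0.
rewrite powR1 mulr1 mul1r => h.
have : 1 + y <= (1 + y) `^ b / b + q^-1.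
  by apply: h; rewrite /q invf_div; field; rewrite gt_eqF.
have -> : q^-1 = 1 - b^-1 by rewrite /q invf_div; field; rewrite gt_eqF.
move=> {}h; have : b * (1 + y) <= b * ((1 + y) `^ b / b + (1 - b^-1)) by rewrite ler_pM2l.
have -> : b * ((1 + y) `^ b / b + (1 - b^-1)) = (1 + y) `^ b + b - 1 by field; rewrite gt_eqF.
lra.
Qed.
End Bernoulli.

Section BesselSeries.
Variable R : realType.
Implicit Types (a z : R).

Definition besselTerm a z (k : nat) : R :=
  (z / 2) `^ (k.*2%:R + a) / (k`!%:R * Gamma (k%:R + a + 1)).

Definition besselSum a z (N : nat) : R := \sum_(k < N) besselTerm a z k.

(** The model for I_a, interpolating between z^a at 0 and z^(-1/2) e^z at
    infinity. *)
Definition besselCmp a z : R := z `^ a * (1 + z) `^ (- (a + 1 / 2)) * expR z.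

Lemma besselCmp_gt0 a z : 0 < z -> 0 < besselCmp a z.
Proof. by move=> z0; rewrite !mulr_gt0 ?powR_gt0 ?expR_gt0//; lra. Qed.

Lemma besselTerm_ge0 a z k : -1 < a -> 0 <= besselTerm a z k.
Proof.
move=> a1; rewrite divr_ge0 ?powR_ge0// mulr_ge0// ltW// Gamma_gt0//.
have := ler0n R k; lra.
Qed.

Lemma besselCmpS a z : 0 < z -> besselCmp (a + 1) z = besselCmp a z * (z / (1 + z)).
Proof.
move=> z0; rewrite /besselCmp gt0_powRD// powRr1 ?ltW//.
rewrite (_ : - (a + 1 + 1 / 2) = - (a + 1 / 2) + (- 1)); last by lra.
rewrite gt0_powRD ?addr_gt0// powR_inv1 ?addr_ge0 ?ltW//.
by field; rewrite gt_eqF// addr_gt0.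
Qed.

(** The coefficientwise form of
    I_a = (2 (a+1)/z) I_(a+1) + I_(a+2). As every term is nonnegative, upper and
    lower bounds pass from a+1 and a+2 to a. *)
Lemma besselTermS a z k : -1 < a -> 0 < z -> besselTerm a z k =
  2 * (a + 1) / z * besselTerm (a + 1) z k +
  (if k is k'.+1 then besselTerm (a + 2) z k' else 0).
Proof.
move=> a1 z0; have z2 : 0 < z / 2 by rewrite divr_gt0.
rewrite /besselTerm (addrA k.*2%:R a 1) (addrA k%:R a 1).
rewrite (gt0_powRD (k.*2%:R + a) 1 z2) powRr1 ?(ltW z2)//.
have k0 := ler0n R k.
have G0 : 0 < Gamma (k%:R + a + 1) by rewrite Gamma_gt0//; lra.
rewrite (GammaS (s := k%:R + a + 1)); last lra.
case: k k0 G0 => [|k] k0 G0.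
  rewrite addr0 fact0 mul1r; field; rewrite !gt_eqF//; first lra.
rewrite (_ : k.*2%:R + (a + 2) = k.+1.*2%:R + a); last first.
  by rewrite doubleS -!(natr1 _.+1) -!natr1; lra.
rewrite (_ : k%:R + (a + 2) + 1 = k.+1%:R + a + 1 + 1); last by rewrite -natr1; lra.
rewrite (GammaS (s := k.+1%:R + a + 1)); last lra.
rewrite factS natrM -natr1.
move: k0 G0; rewrite -natr1 => k0 G0; set f := k`!%:R.
have f0 : 0 < f :> R by rewrite ltr0n fact_gt0.
by field; rewrite !gt_eqF//; lra.
Qed.

Lemma besselSumS a z N : -1 < a -> 0 < z ->
  besselSum a z N.+1 =
  2 * (a + 1) / z * besselSum (a + 1) z N.+1 + besselSum (a + 2) z N.
Proof.
move=> a1 z0; rewrite /besselSum mulr_sumr.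
under eq_bigr do rewrite besselTermS//.
by rewrite big_split/=; congr +%R; rewrite big_ord_recl/= add0r.
Qed.

(** Bounds on the partial sums, uniform in N, which imply convergence of the
    series as well. *)
Definition bessel_upper a := exists2 C : R, 0 < C &
  forall z N, 0 < z -> besselSum a z N <= C * besselCmp a z.

Definition bessel_lower a := exists2 c : R, 0 < c &
  forall z, 0 < z -> exists N, c * besselCmp a z <= besselSum a z N.

Lemma le_besselSum a z : -1 < a -> {homo besselSum a z : m n / (m <= n)%N >-> m <= n}.
Proof.
move=> a1; apply/nondecreasing_seqP => n.
by rewrite /besselSum big_ord_recr/= lerDl besselTerm_ge0.
Qed.

(** Relative to [besselCmp] of a, the two terms of the recurrence contribute
    the factors 1/(1+z) and (z/(1+z))^2, both at most 1. *)
Lemma bessel_upper_down a : -1 < a -> bessel_upper (a + 1) -> bessel_upper (a + 2) ->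
  bessel_upper a.
Proof.
move=> a1 [C1 C10 h1] [C2 C20 h2].
exists (2 * (a + 1) * C1 + C2) => [|z N z0].
  by rewrite addr_gt0// !mulr_gt0//; lra.
apply: (@le_trans _ _ (besselSum a z N.+1)); first exact: le_besselSum.
rewrite besselSumS//.
have B0 := besselCmp_gt0 a z0.
have z1 : 0 < 1 + z by lra.
rewrite [leRHS]mulrDl lerD//.
  apply: (@le_trans _ _ (2 * (a + 1) / z * (C1 * besselCmp (a + 1) z))).
    by rewrite ler_wpM2l ?h1// divr_ge0 ?mulr_ge0//; lra.
  rewrite besselCmpS// (_ : _ * _ = 2 * (a + 1) * C1 * besselCmp a z * (1 + z)^-1); last first.
    by field; rewrite !gt_eqF.
  rewrite ler_piMr//; first by apply: mulr_ge0; [apply: mulr_ge0; lra|exact: ltW].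
  by rewrite invf_le1//; lra.
apply: (le_trans (h2 z N z0)).
rewrite ler_pM2l// (_ : a + 2 = a + 1 + 1); last lra.
rewrite !besselCmpS// -mulrA ler_piMr ?(ltW B0)//.
by rewrite mulr_ile1 ?divr_ge0 ?ler_pdivrMr//; lra.
Qed.

(** The factors 1/(1+z) and (z/(1+z))^2 are not small together: their sum is at
    least 1/2. *)
Lemma bessel_lower_down a : -1 < a -> bessel_lower (a + 1) -> bessel_lower (a + 2) ->
  bessel_lower a.
Proof.
move=> a1 [c1 c10 h1] [c2 c20 h2].
pose c := Num.min (2 * (a + 1) * c1) c2.
have c0 : 0 < c by rewrite lt_min c20 andbT !mulr_gt0//; lra.
exists (c / 2) => [|z z0]; first by rewrite divr_gt0.
have [N1 {}h1] := h1 z z0; have [N2 {}h2] := h2 z z0.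
exists (maxn N1 N2).+1; rewrite besselSumS//.
have B0 := besselCmp_gt0 a z0.
have z1 : 0 < 1 + z by lra.
have e1 : 2 * (a + 1) / z * (c1 * besselCmp (a + 1) z) <=
   2 * (a + 1) / z * besselSum (a + 1) z (maxn N1 N2).+1.
  rewrite ler_wpM2l ?divr_ge0 ?mulr_ge0//; try lra.
  apply: (le_trans h1); apply: le_besselSum; first lra.
  by rewrite (leq_trans (leq_maxl _ N2))// ltnW.
have e2 : c2 * besselCmp (a + 2) z <= besselSum (a + 2) z (maxn N1 N2).
  by apply: (le_trans h2); apply: le_besselSum; [lra|exact: leq_maxr].
apply: (le_trans _ (lerD e1 e2)).
rewrite (_ : a + 2 = a + 1 + 1); last lra.
rewrite !besselCmpS//.
have cl1 : c <= 2 * (a + 1) * c1 by rewrite ge_min lexx.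
have cl2 : c <= c2 by rewrite ge_min lexx orbT.
have -> : 2 * (a + 1) / z * (c1 * (besselCmp a z * (z / (1 + z)))) =
  besselCmp a z * ((2 * (a + 1) * c1) * (1 + z)^-1) by field; rewrite !gt_eqF.
have -> : c2 * (besselCmp a z * (z / (1 + z)) * (z / (1 + z))) =
  besselCmp a z * (c2 * (z / (1 + z)) ^+ 2) by field; rewrite !gt_eqF.
rewrite -mulrDr mulrC ler_pM2l//.
apply: (@le_trans _ _ (c * (1 + z)^-1 + c * (z / (1 + z)) ^+ 2)); last first.
  by rewrite lerD// ler_wpM2r ?invr_ge0 ?sqr_ge0// ltW.
have -> : c * (1 + z)^-1 + c * (z / (1 + z)) ^+ 2 = c * ((1 + z + z ^+ 2) / (1 + z) ^+ 2).
  by field; rewrite gt_eqF.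
rewrite ler_pM2l// ler_pdivlMr ?exprn_gt0//; nra.
Qed.

End BesselSeries.

(** * Two-sided estimate of the Bessel function *)

Section BesselBase.
Variable R : realType.
Implicit Types (a z : R).

(** The quotient of a Bessel term by the corresponding term of cosh, without
    the factor (z/2)^a; see [besselTermE]. *)
Definition besselRatio a (k : nat) : R :=
  (k.*2)`!%:R / (4 ^+ k * k`!%:R * Gamma (k%:R + a + 1)).

Lemma besselRatio_gt0 a k : -1 < a -> 0 < besselRatio a k.
Proof.
move=> a1; have k0 := ler0n R k.
by rewrite divr_gt0 ?mulr_gt0 ?exprn_gt0 ?ltr0n ?fact_gt0 ?Gamma_gt0//; lra.
Qed.

Lemma besselRatioS a k : -1 < a ->
  besselRatio a k.+1 = besselRatio a k * ((k%:R + 1 / 2) / (k%:R + a + 1)).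
Proof.
move=> a1; have k0 := ler0n R k; rewrite /besselRatio.
have G0 : 0 < Gamma (k%:R + a + 1) by rewrite Gamma_gt0//; lra.
rewrite (_ : k.+1%:R + a + 1 = k%:R + a + 1 + 1); last by rewrite -natr1; lra.
rewrite GammaS; last lra.
have -> : (k.+1.*2)`!%:R = (2 * k%:R + 2) * (2 * k%:R + 1) * (k.*2)`!%:R :> R.
  rewrite doubleS !factS !natrM -!natr1 -mul2n natrM; ring.
rewrite exprS factS natrM -natr1.
have f0 : 0 < k`!%:R :> R by rewrite ltr0n fact_gt0.
have e0 : 0 < 4 ^+ k :> R by rewrite exprn_gt0.
move: (4 ^+ k) (k`!%:R) (Gamma _) ((k.*2)`!%:R) e0 f0 G0 => e f G h e0 f0 G0.
field; rewrite !gt_eqF//; lra.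
Qed.

Lemma besselTermE a z k : 0 < z ->
  besselTerm a z k = (z / 2) `^ a * (even_term z k * besselRatio a k).
Proof.
move=> z0; rewrite /besselTerm /even_term /besselRatio gt0_powRD ?divr_gt0//.
rewrite powR_mulrn ?divr_ge0 ?ltW// -mul2n !exprM expr_div_n.
rewrite (_ : 2 ^+ 2 = 4); last by rewrite -natrX.
rewrite expr_div_n !invfM mul2n.
have f0 : 0 < (k.*2)`!%:R :> R by rewrite ltr0n fact_gt0.
move: (k`!%:R) (Gamma _) ((k.*2)`!%:R) ((z / 2) `^ a) f0 => f G h w h0.
have hi : h^-1 * h = 1 by rewrite mulVf// gt_eqF.
by rewrite -[LHS]mul1r -hi; ring.
Qed.

(** For b = a + 1/2 the factor x/(x+b) at x = k + 1/2 is the quotient of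
    consecutive [besselRatio], so that [besselRatio] times (k+1/2)^b
    increases with k. *)
Lemma bernoulli_up (x b : R) : 1 <= b -> 0 < x ->
  x `^ b <= x / (x + b) * (x + 1) `^ b.
Proof.
move=> b1 x0; have q0 : 0 < x^-1 by rewrite invr_gt0.
have xb : 0 < x + b by lra.
have := bernoulli_powR b1 (lt_trans (ltrN10 R) q0) => h.
rewrite (_ : x + 1 = x * (1 + x^-1)); last by field; rewrite gt_eqF.
rewrite powRM; [|exact: ltW|by rewrite addr_ge0// ltW].
rewrite mulrCA ler_peMr ?powR_ge0// mulrAC ler_pdivlMr// mul1r.
apply: le_trans (_ : x * (1 + b * x^-1) <= _); last by rewrite ler_pM2l.
by rewrite mulrDr mulr1 mulrCA mulfV ?gt_eqF// mulr1.
Qed.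

(** The companion of [bernoulli_up]: at y = k + a it shows that [besselRatio]
    times (k+a)^b decreases. *)
Lemma bernoulli_down (y b : R) : 1 <= b -> 0 < y ->
  (y + 1 - b) / (y + 1) * (y + 1) `^ b <= y `^ b.
Proof.
move=> b1 y0; have y1 : 0 < y + 1 by lra.
have q0 : 0 < (y + 1)^-1 by rewrite invr_gt0.
have q1 : (y + 1)^-1 < 1 by rewrite invf_lt1; lra.
have := @bernoulli_powR R b (- (y + 1)^-1) b1; rewrite ltrN2 => /(_ q1) h.
rewrite [in leRHS](_ : y = (y + 1) * (1 - (y + 1)^-1)); last first.
  by field; rewrite gt_eqF.
rewrite powRM; [|exact: ltW|by rewrite subr_ge0 ltW].
rewrite mulrC ler_pM2l ?powR_gt0//; apply: le_trans h.
by rewrite mulrDl mulfV ?gt_eqF// mulNr mulrN.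
Qed.

Lemma besselRatio_ge a k : 1 / 2 <= a ->
  besselRatio a 0 * (1 / 2) `^ (a + 1 / 2) * (k%:R + 1) `^ (- (a + 1 / 2)) <= besselRatio a k.
Proof.
move=> a1; have aN1 : -1 < a by lra.
have r0 j : 0 < besselRatio a j by exact: besselRatio_gt0.
have := erefl (a + 1 / 2); move: {2}(a + 1 / 2) => b bE.
rewrite bE; have b1 : 1 <= b by lra.
have mono : besselRatio a 0 * (1 / 2) `^ b <= besselRatio a k * (k%:R + 1 / 2) `^ b.
  elim: k => [|k ih]; first by rewrite mulr0n add0r.
  apply: (le_trans ih); have k0 := ler0n R k.
  rewrite besselRatioS// -mulrA ler_pM2l//.
  have x0 : 0 < k%:R + 1 / 2 :> R by apply: ltr_wpDl.
  rewrite (_ : k%:R + a + 1 = (k%:R + 1 / 2) + b); last by rewrite -bE; clear; lra.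
  rewrite (_ : k.+1%:R + 1 / 2 = (k%:R + 1 / 2) + 1); last by rewrite -natr1 addrAC.
  exact: bernoulli_up.
have k0 := ler0n R k.
have p1 : 0 < k%:R + 1 :> R by apply: ltr_wpDl.
rewrite powRN ler_pdivrMr ?powR_gt0//; apply: (le_trans mono).
rewrite ler_pM2l//; clear -p1 b1 k0; apply: ge0_ler_powR; rewrite ?nnegrE; lra.
Qed.

Lemma besselRatio_le a k : 1 / 2 <= a ->
  besselRatio a k <= besselRatio a 0 * a `^ (a + 1 / 2) * 2 `^ (a + 1 / 2) * (k%:R + 1) `^ (- (a + 1 / 2)).
Proof.
move=> a1; have aN1 : -1 < a by lra.
have r0 j : 0 < besselRatio a j by exact: besselRatio_gt0.
have := erefl (a + 1 / 2); move: {2}(a + 1 / 2) => b bE.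
rewrite bE; have b1 : 1 <= b by lra.
have mono : besselRatio a k * (k%:R + a) `^ b <= besselRatio a 0 * a `^ b.
  elim: k => [|k ih]; first by rewrite mulr0n add0r.
  apply: le_trans ih; have k0 := ler0n R k.
  rewrite besselRatioS// -mulrA ler_pM2l//.
  have y0 : 0 < k%:R + a by clear -k0 a1; lra.
  rewrite (_ : k%:R + 1 / 2 = k%:R + a + 1 - b); last by rewrite -bE; clear; lra.
  rewrite (_ : k.+1%:R + a = (k%:R + a) + 1); last by rewrite -natr1 addrAC.
  exact: bernoulli_down.
have k0 := ler0n R k.
have p0 : 0 < k%:R + a by clear -k0 a1; lra.
have p1 : 0 < k%:R + 1 :> R by apply: ltr_wpDl.
rewrite powRN ler_pdivlMr ?powR_gt0//.
apply: (@le_trans _ _ (besselRatio a k * (k%:R + a) `^ b * 2 `^ b)); last first.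
  by rewrite ler_pM2r ?powR_gt0.
rewrite -mulrA ler_pM2l// -(powRM _ (ltW p0))//.
clear -p0 p1 b1 a1 k0; apply: ge0_ler_powR; rewrite ?nnegrE; lra.
Qed.

Lemma expRN_le_exp2N (k : nat) : expR (- k%:R) <= 2 ^- k :> R.
Proof.
rewrite expRN lef_pV2 ?posrE ?expR_gt0 ?exprn_gt0//.
rewrite -[X in expR X]mulr1 expRM_natl lerXn2r ?nnegrE ?expR_ge0//.
by have := expR_ge1Dx (1 : R); lra.
Qed.

(** Indices k much smaller than z would violate (k+1)^(-b) <= C (1+z)^(-b). The
    correction e^(z/2) 4^(-k) covers them, and it stays harmless after
    summation because even_term z k 4^(-k) = even_term (z/2) k. *)
Lemma powR_ratio_le (b : R) : 0 <= b -> exists2 C : R, 0 < C & forall z k, 0 < z ->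
  (k%:R + 1) `^ (- b) <= C * (1 + z) `^ (- b) * (1 + expR (z / 2) * 4 ^- k).
Proof.
move=> b0; have e0 : 0 < 1 / 4 :> R by lra.
have [C1 C10 h1] := @powR_le_expRZ R b (1 / 4) b0 e0.
pose C2 := C1 * expR (1 / 4); have C20 : 0 < C2 by rewrite mulr_gt0// expR_gt0.
exists (8 `^ b + C2) => [|z k z0]; first by rewrite addr_gt0// powR_gt0.
have k0 := ler0n R k.
have p1 : 0 < k%:R + 1 :> R by lra.
have z1 : 0 < 1 + z by lra.
have X0 : 0 <= expR (z / 2) * 4 ^- k by rewrite mulr_ge0 ?expR_ge0// invr_ge0 exprn_ge0.
have e8 : 0 <= 8 `^ b * (1 + z) `^ (- b) by rewrite mulr_ge0 ?powR_ge0.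
have e9 : 0 <= C2 * (1 + z) `^ (- b) by rewrite mulr_ge0 ?powR_ge0 ?ltW.
have [zk|zk] := leP z (8 * k%:R).
  apply: (@le_trans _ _ (8 `^ b * (1 + z) `^ (- b))); last first.
    rewrite -[leLHS]mulr1 ler_pM//; last by rewrite lerDl.
    by rewrite ler_pM2r ?powR_gt0// lerDl ltW.
  rewrite (powRN (k%:R + 1)) (powRN (1 + z)) ler_pdivlMr ?powR_gt0//.
  rewrite mulrC ler_pdivrMr ?powR_gt0// -(powRM _ (ler0n R 8) (ltW p1)).
  by clear -zk z1 b0 k0; apply: ge0_ler_powR; rewrite ?nnegrE; lra.
apply: (@le_trans _ _ 1).
  by rewrite powRN invf_le1 ?powR_gt0// powR_ge1// lerDr.
have h2 : (1 + z) `^ b <= C2 * (expR (z / 2) * 4 ^- k).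
  apply: (le_trans (h1 (1 + z) (ltW z1))).
  rewrite /C2 -[leRHS]mulrA ler_pM2l// mulrDr mulr1 expRD ler_pM2l ?expR_gt0//.
  have -> : 4 ^- k = 2 ^- k.*2 :> R by rewrite -mul2n exprM (_ : 2 ^+ 2 = 4)//; rewrite -natrX.
  apply: (@le_trans _ _ (expR (z / 2) * expR (- k.*2%:R))); last first.
    by rewrite ler_pM2l ?expR_gt0// expRN_le_exp2N.
  by rewrite -expRD ler_expR -mul2n natrM; clear -zk; lra.
rewrite powRN mulrAC ler_pdivlMr ?powR_gt0// mul1r; apply: (le_trans h2).
rewrite ler_pM//; first exact: ltW.
  by rewrite lerDr powR_ge0.
by rewrite lerDr.
Qed.

Lemma bessel_upper_base a : 1 / 2 <= a -> bessel_upper a.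
Proof.
move=> a1; set b := a + 1 / 2; have b0 : 0 <= b by rewrite /b; lra.
have [C C0 hC] := powR_ratio_le b0.
pose D := besselRatio a 0 * a `^ b * 2 `^ b.
have D0 : 0 < D.
  by apply: mulr_gt0; [apply: mulr_gt0; [apply: besselRatio_gt0|apply: powR_gt0]|apply: powR_gt0]; clear -a1; lra.
exists (2 `^ (- a) * (D * C * 2)) => [|z N z0]; first by rewrite mulr_gt0 ?powR_gt0// mulr_gt0// mulr_gt0.
rewrite /besselSum.
have z2 : 0 <= z / 2 by lra.
under eq_bigr do rewrite besselTermE//.
rewrite -mulr_sumr.
have -> : (z / 2) `^ a = 2 `^ (- a) * z `^ a.
  by rewrite powRM ?invr_ge0 ?ltW// -powR_inv1// -powRrM mulN1r mulrC.
rewrite -(mulrA _ (D * C * 2)) -mulrA ler_pM2l ?powR_gt0//.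
rewrite [leRHS](_ : _ = z `^ a * (D * C * 2 * ((1 + z) `^ (- b) * expR z))); last first.
  by rewrite /besselCmp -/b; ring.
rewrite ler_pM2l ?powR_gt0//.
have z1 : 0 < 1 + z by lra.
apply: (@le_trans _ _ (\sum_(k < N) D * C * (1 + z) `^ (- b) *
    (even_term z k + expR (z / 2) * even_term (z / 2) k))).
  apply: ler_sum => k _.
  apply: (@le_trans _ _ (even_term z k * (D * (k%:R + 1) `^ (- b)))).
    by rewrite ler_wpM2l ?even_term_ge0// besselRatio_le.
  apply: (@le_trans _ _ (even_term z k * (D * (C * (1 + z) `^ (- b) * (1 + expR (z / 2) * 4 ^- k))))).
    by rewrite ler_wpM2l ?even_term_ge0// ler_pM2l// hC.
  rewrite le_eqVlt; apply/orP; left; apply/eqP.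
  have -> : even_term (z / 2) k = even_term z k * 4 ^- k.
    rewrite /even_term expr_div_n -(mul2n k) !(exprM 2) (_ : 2 ^+ 2 = 4); last by rewrite -natrX.
    by rewrite mulrAC.
  ring.
rewrite -mulr_sumr big_split /= -mulr_sumr.
rewrite (_ : D * C * 2 * ((1 + z) `^ (- b) * expR z) = D * C * (1 + z) `^ (- b) * (expR z + expR z)); last by ring.
have P0 : 0 < D * C * (1 + z) `^ (- b) by rewrite mulr_gt0 ?powR_gt0// mulr_gt0.
rewrite (ler_pM2l P0); apply: lerD; first by apply: sum_even_le; exact: ltW.
rewrite [X in _ <= expR X](_ : _ = z / 2 + z / 2); last lra.
by rewrite expRD ler_pM2l ?expR_gt0// sum_even_le.
Qed.

(** By Markov's inequality most of the mass of cosh z lies at indices with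
    2k + 1 <= 10 (1+z), where (k+1)^(-b) is at least (10 (1+z))^(-b). *)
Lemma bessel_lower_base a : 1 / 2 <= a -> bessel_lower a.
Proof.
move=> a1; set b := a + 1 / 2; have b0 : 0 <= b by rewrite /b; lra.
pose D := besselRatio a 0 * (1 / 2) `^ b.
have D0 : 0 < D.
  by apply: mulr_gt0; [apply: besselRatio_gt0|apply: powR_gt0]; clear -a1; lra.
exists (2 `^ (- a) * (D * 10 `^ (- b) / 10)) => [|z z0].
  by rewrite mulr_gt0 ?powR_gt0// divr_gt0// mulr_gt0// powR_gt0.
have [N hN] := sum_even_ge (ltW z0); exists N.
have z2 : 0 <= z / 2 by lra.
have z1 : 0 < 1 + z by lra.
rewrite /besselSum; under eq_bigr do rewrite besselTermE//.
rewrite -mulr_sumr.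
have -> : (z / 2) `^ a = 2 `^ (- a) * z `^ a.
  by rewrite powRM ?invr_ge0 ?ltW// -powR_inv1// -powRrM mulN1r mulrC.
rewrite -[leRHS]mulrA -[leLHS]mulrA ler_pM2l ?powR_gt0//.
rewrite [leLHS](_ : _ = z `^ a * (D * 10 `^ (- b) / 10 * ((1 + z) `^ (- b) * expR z))); last first.
  by rewrite /besselCmp -/b; ring.
rewrite ler_pM2l ?powR_gt0//.
(* 1 - (2k+1)/(10(1+z)) is positive only where 2k+1 < 10(1+z) *)
apply: (@le_trans _ _ (\sum_(k < N) D * 10 `^ (- b) * (1 + z) `^ (- b) *
    (even_term z k - (even_term z k * k.*2%:R + even_term z k) / (10 * (1 + z))))).
  rewrite -mulr_sumr sumrB -mulr_suml big_split /=.
  rewrite (_ : D * 10 `^ (- b) / 10 * ((1 + z) `^ (- b) * expR z) =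
    D * 10 `^ (- b) * (1 + z) `^ (- b) * (expR z / 10)); last by ring.
  have P0 : 0 < D * 10 `^ (- b) * (1 + z) `^ (- b) by rewrite mulr_gt0 ?powR_gt0// mulr_gt0// powR_gt0.
  rewrite (ler_pM2l P0).
  have h1 := sum_even_mean_le N (ltW z0); have h2 := sum_even_le N (ltW z0).
  have : (\sum_(i < N) even_term z i * i.*2%:R + \sum_(i < N) even_term z i) / (10 * (1 + z)) <= expR z / 10.
    rewrite ler_pdivrMr ?mulr_gt0//; lra.
  lra.
apply: ler_sum => k _; have k0 := ler0n R k.
have e0 := even_term_ge0 z k.
apply: (@le_trans _ _ (even_term z k * (D * (k%:R + 1) `^ (- b)))); last first.
  by rewrite ler_wpM2l// besselRatio_ge.
have -> : D * 10 `^ (- b) * (1 + z) `^ (- b) *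
   (even_term z k - (even_term z k * k.*2%:R + even_term z k) / (10 * (1 + z))) =
   even_term z k * (D * ((10 `^ (- b) * (1 + z) `^ (- b)) * (1 - (k.*2%:R + 1) / (10 * (1 + z))))).
  by field; rewrite gt_eqF.
rewrite ler_wpM2l// ler_pM2l// -powRM; try lra.
have k2 : k.*2%:R = 2 * k%:R :> R by rewrite -mul2n natrM.
have [h|h] := leP (k.*2%:R + 1 : R) (10 * (1 + z)).
  apply: (@le_trans _ _ ((10 * (1 + z)) `^ (- b))).
    rewrite ler_piMr ?powR_ge0// lerBlDr lerDl divr_ge0 ?mulr_ge0//; lra.
  by apply: le0_ler_powR; lra.
apply: (@le_trans _ _ 0); last exact: powR_ge0.
rewrite mulr_ge0_le0 ?powR_ge0// subr_le0 ler_pdivlMr ?mulr_gt0//; lra.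
Qed.

(** Two descents by at most one unit each: from a >= 1/2 to a >= -1/2, then to
    a > -1. *)
Lemma bessel_upper_lower a : -1 < a -> bessel_upper a /\ bessel_lower a.
Proof.
have base (c : R) : 1 / 2 <= c -> bessel_upper c /\ bessel_lower c.
  by move=> ?; split; [exact: bessel_upper_base|exact: bessel_lower_base].
have down (c : R) : -1 < c -> (bessel_upper (c + 1) /\ bessel_lower (c + 1)) ->
   (bessel_upper (c + 2) /\ bessel_lower (c + 2)) -> bessel_upper c /\ bessel_lower c.
  by move=> ? [? ?] [? ?]; split; [exact: bessel_upper_down|exact: bessel_lower_down].
have mid (c : R) : - (1 / 2) <= c -> bessel_upper c /\ bessel_lower c.
  by move=> c1; apply: down; [lra|apply: base; lra|apply: base; lra].
by move=> a1; apply: down => //; apply: mid; lra.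
Qed.

Lemma besselI_cvg a z : -1 < a -> 0 < z -> besselSum a z @ \oo --> besselI a z.
Proof.
move=> a1 z0; have [[C C0 hC] _] := bessel_upper_lower a1.
have E : besselSum a z = series (fun k : nat => (z / 2) `^ (k.*2%:R + a) / (k`!%:R * Gamma (k%:R + a + 1))).
  by apply/funext => n; rewrite /besselSum /series /= big_mkord.
rewrite /besselI -E; apply: nondecreasing_is_cvgn.
  exact: le_besselSum.
by exists (C * besselCmp a z) => _ [n _ <-]; exact: hC.
Qed.

Lemma besselI_bounds a : -1 < a -> exists c C : R, [/\ 0 < c, 0 < C &
  forall z, 0 < z -> c * besselCmp a z <= besselI a z <= C * besselCmp a z].
Proof.
move=> a1; have [[C C0 hC] [c c0 hc]] := bessel_upper_lower a1.
exists c, C; split => // z z0; have cvgI := besselI_cvg a1 z0.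
have E := cvg_lim (@Rhausdorff R) cvgI.
apply/andP; split.
  have [N hN] := hc z z0; apply: (le_trans hN).
  rewrite -E; apply: nondecreasing_cvgn_le; first exact: le_besselSum.
  by apply/cvg_ex; exists (besselI a z).
rewrite -E; apply: limr_le; first by apply/cvg_ex; exists (besselI a z).
by apply: nearW => n; exact: hC.
Qed.

End BesselBase.

(** * Heat kernel and potential kernel *)

Section IntegralTools.
Variable R : realType.
Notation mu := (@lebesgue_measure R).
Local Open Scope ereal_scope.

(** Whatever the domain of integration, measurability is asked for on the whole
    line, the form that [mfun] proves; likewise in the lemmas that follow. *)
Lemma int_le (D : set R) (F G : R -> \bar R) : measurable D ->
  measurable_fun setT F -> measurable_fun setT G ->
  (forall x : R, D x -> 0 <= F x) -> (forall x : R, D x -> F x <= G x) ->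
  \int[mu]_(x in D) F x <= \int[mu]_(x in D) G x.
Proof.
by move=> mD mF mG F0 FG; apply: ge0_le_integral => //; apply: measurable_funTS.
Qed.

Lemma int_sub (D E : set R) (F : R -> \bar R) : measurable D -> measurable E ->
  measurable_fun setT F -> (forall x : R, E x -> 0 <= F x) -> D `<=` E ->
  \int[mu]_(x in D) F x <= \int[mu]_(x in E) F x.
Proof.
by move=> mD mE mF F0 DE; apply: ge0_subset_integral => //; apply: measurable_funTS.
Qed.

Lemma int_scale (D : set R) (c : R) (F : R -> \bar R) : measurable D ->
  measurable_fun setT F -> (0 <= c)%R -> (forall x : R, D x -> 0 <= F x) ->
  \int[mu]_(x in D) (c%:E * F x) = c%:E * \int[mu]_(x in D) F x.
Proof.
move=> mD mF c0 F0; apply: ge0_integralZl => //; exact: measurable_funTS.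
Qed.

Lemma int_scaleR (D : set R) (c : R) (f : R -> R) : measurable D ->
  measurable_fun setT f -> (0 <= c)%R -> (forall x : R, D x -> (0 <= f x)%R) ->
  \int[mu]_(x in D) (c * f x)%:E = c%:E * \int[mu]_(x in D) (f x)%:E.
Proof.
move=> mD mf c0 f0; under eq_integral do rewrite EFinM.
by apply: int_scale => //; mfun.
Qed.

Lemma int_add (D : set R) (F G : R -> \bar R) : measurable D ->
  measurable_fun setT F -> measurable_fun setT G ->
  (forall x : R, D x -> 0 <= F x) -> (forall x : R, D x -> 0 <= G x) ->
  \int[mu]_(x in D) (F x + G x) = \int[mu]_(x in D) F x + \int[mu]_(x in D) G x.
Proof.
by move=> mD mF mG F0 G0; apply: ge0_integralD => //; apply: measurable_funTS.
Qed.

End IntegralTools.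

Section HeatKernel.
Variable R : realType.
Implicit Types (a t x y : R).

(** The Gaussian times (z/(1+z))^(a+1/2) with z = xy/2t: the boundary factor is
    the only trace of a. *)
Definition heatCmp a t x y : R := t `^ (- (1 / 2)) * expR (- ((x - y) ^+ 2 / (4 * t))) *
  ((x * y / (2 * t)) / (1 + x * y / (2 * t))) `^ (a + 1 / 2).

Lemma heatCmpE a t x y : 0 < t -> 0 < x -> 0 < y ->
  (x * y) `^ (1 / 2) / (2 * t) * expR (- ((x ^+ 2 + y ^+ 2) / (4 * t)))
  * besselCmp a (x * y / (2 * t)) = 2 `^ (- (1 / 2)) * heatCmp a t x y.
Proof.
move=> t0 x0 y0; rewrite /heatCmp.
have z0 : 0 < x * y / (2 * t) by rewrite !(mulr_gt0, invr_gt0).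
have E : x * y = 2 * t * (x * y / (2 * t)) by field; rewrite gt_eqF.
have E2 : expR (- ((x ^+ 2 + y ^+ 2) / (4 * t))) * expR (x * y / (2 * t)) =
  expR (- ((x - y) ^+ 2 / (4 * t))).
  by rewrite -expRD; congr expR; field; rewrite gt_eqF.
rewrite -E2 [in (x * y) `^ _]E; move: (x * y / (2 * t)) z0 => z z0.
rewrite /besselCmp; have z1 : 0 < 1 + z by rewrite addr_gt0.
rewrite !powRM ?ltW ?mulr_gt0 ?invr_gt0//.
rewrite -(powR_inv1 (ltW z1)) -powRrM mulN1r.
rewrite (_ : (2 * t)^-1 = 2 `^ (-1) * t `^ (-1)); last first.
  by rewrite !powR_inv1 ?(ltW t0)// invfM.
rewrite (gt0_powRD a (1 / 2) z0).
rewrite (_ : - (1 / 2) = -1 + 1 / 2); last by lra.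
rewrite !(gt0_powRD (-1) (1 / 2)) //.
ring.
Qed.

Lemma heatW_bounds a : -1 < a -> exists c C : R, [/\ 0 < c, 0 < C &
  forall t x y, 0 < t -> 0 < x -> 0 < y ->
  c * heatCmp a t x y <= heatW a t x y <= C * heatCmp a t x y].
Proof.
move=> a1; have [c [C [c0 C0 h]]] := besselI_bounds a1.
have p2 : 0 < 2 `^ (- (1 / 2)) :> R by rewrite powR_gt0.
exists (c * 2 `^ (- (1 / 2))), (C * 2 `^ (- (1 / 2))); split; [exact: mulr_gt0|exact: mulr_gt0|].
move=> t x y t0 x0 y0.
have z0 : 0 < x * y / (2 * t) by rewrite !(mulr_gt0, invr_gt0).
have /andP[h1 h2] := h _ z0.
have P0 : 0 < (x * y) `^ (1 / 2) / (2 * t) * expR (- ((x ^+ 2 + y ^+ 2) / (4 * t))).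
  by rewrite mulr_gt0 ?expR_gt0// divr_gt0 ?powR_gt0 ?mulr_gt0.
rewrite -!(mulrA _ (2 `^ _)) -heatCmpE// /heatW.
by rewrite (mulrCA c) (mulrCA C) !(ler_pM2l P0) h1 h2.
Qed.

Lemma heatCmp_ge0 a t x y : 0 <= heatCmp a t x y.
Proof. by rewrite !mulr_ge0 ?powR_ge0 ?expR_ge0. Qed.

Lemma heatCmp_le a t x y : - (1 / 2) <= a -> 0 < t -> 0 < x -> 0 < y ->
  heatCmp a t x y <= t `^ (- (1 / 2)) * expR (- ((x - y) ^+ 2 / (4 * t))).
Proof.
move=> a1 t0 x0 y0; rewrite /heatCmp ler_piMr ?mulr_ge0 ?powR_ge0 ?expR_ge0//.
have z0 : 0 < x * y / (2 * t) by rewrite !(mulr_gt0, invr_gt0).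
rewrite -[leRHS](_ : 1 `^ (a + 1 / 2) = 1); last by rewrite powR1.
apply: ge0_ler_powR; rewrite ?nnegrE//; first by clear -a1; lra.
  by rewrite divr_ge0// ?addr_ge0// ltW.
by rewrite ler_pdivrMr ?addr_gt0// mul1r lerDr.
Qed.

Lemma powR_addr_le (g w : R) : 0 <= g -> 0 < w -> (1 + w) `^ g <= 2 `^ g * (1 + w `^ g).
Proof.
move=> g0 w0; have w1 : 0 <= w by exact: ltW.
rewrite mulrDr mulr1 -powRM//; have [wl|wl] := leP w 1.
  rewrite (@le_trans _ _ (2 `^ g))// ?lerDl ?powR_ge0//.
  by apply: ge0_ler_powR; rewrite ?nnegrE//; lra.
rewrite (@le_trans _ _ ((2 * w) `^ g))// ?lerDr ?powR_ge0//.
by apply: ge0_ler_powR; rewrite ?nnegrE//; lra.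
Qed.

(** For a < -1/2 the boundary factor is (1 + 1/z)^g with 1/z = 2t/(xy), which
    is at most a multiple of 1 + (t/(xy))^g. *)
Lemma heatCmp_le_sing a g t x y : g = - (a + 1 / 2) -> a < - (1 / 2) ->
  0 < t -> 0 < x -> 0 < y ->
  heatCmp a t x y <= t `^ (- (1 / 2)) * expR (- ((x - y) ^+ 2 / (4 * t))) *
    (4 `^ g * (1 + t `^ g * (x * y) `^ (- g))).
Proof.
move=> gE a1 t0 x0 y0; rewrite /heatCmp; have g0 : 0 <= g by lra.
rewrite ler_wpM2l ?mulr_ge0 ?powR_ge0 ?expR_ge0//.
have -> : a + 1 / 2 = - g by rewrite gE opprK.
have xy0 : 0 < x * y by rewrite mulr_gt0.
have z0 : 0 < x * y / (2 * t) by rewrite divr_gt0// mulr_gt0.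
have w0 : 0 < 2 * t / (x * y) by rewrite divr_gt0// mulr_gt0.
have -> : (x * y / (2 * t) / (1 + x * y / (2 * t))) = (1 + 2 * t / (x * y))^-1.
  by field; rewrite !gt_eqF//= addr_gt0// mulr_gt0.
rewrite -(powR_inv1 (ltW (addr_gt0 ltr01 w0))) -powRrM mulrNN mul1r.
apply: (le_trans (powR_addr_le g0 w0)).
rewrite powRM ?mulr_ge0 ?invr_ge0 ?(ltW t0) ?(ltW xy0)//.
rewrite (powRM _ _ (ltW t0))// -(powR_inv1 (ltW xy0)) -powRrM mulN1r.
have p2 : 1 <= 2 `^ g by rewrite powR_ge1// ler1n.
have -> : 4 `^ g = 2 `^ g * 2 `^ g by rewrite -powRM//; congr (_ `^ _); ring.
have q0 : 0 <= t `^ g * (x * y) `^ (- g) by rewrite mulr_ge0 ?powR_ge0.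
rewrite -(mulrA (2 `^ g) (t `^ g)); move: (2 `^ g) (_ * (x * y) `^ _) p2 q0 => p q p2 q0.
nra.
Qed.

Lemma heatW_ge0 a t x y : -1 < a -> 0 < t -> 0 < x -> 0 < y -> 0 <= heatW a t x y.
Proof.
move=> a1 t0 x0 y0; have [c [C [c0 C0 h]]] := heatW_bounds a1.
have /andP[h1 _] := h t x y t0 x0 y0.
by apply: le_trans h1; rewrite mulr_ge0 ?heatCmp_ge0// ltW.
Qed.

(** A pointwise limit of the partial sums; the test 0 < z confines the claim to
    the range where the series is known to converge. *)
Lemma measurable_besselI a : -1 < a ->
  measurable_fun setT (fun z : R => if 0 < z then besselI a z else 0).
Proof.
move=> a1.
pose h N (z : R) : R := if 0 < z then besselSum a z N else 0.
have mh N : measurable_fun setT (h N).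
  apply: measurable_fun_ifT => //; first by mfun.
  rewrite /besselSum; elim: N => [|N ih].
    rewrite (_ : (fun t => _) = cst 0); first exact: measurable_cst.
    by apply/funext => t; rewrite big_ord0.
  rewrite (_ : (fun t => _) = (fun t => \sum_(k < N) besselTerm a t k +
    (t / 2) `^ (N.*2%:R + a) / (N`!%:R * Gamma (N%:R + a + 1)))).
    by mfun.
  by apply/funext => t; rewrite big_ord_recr.
apply: (measurable_fun_cvg mh) => z _; rewrite /h; case: ifPn => z0; last exact: cvg_cst.
exact: besselI_cvg.
Qed.

(** The integrand of the potential kernel, extended by 0 outside the open octant
    so as to be measurable and nonnegative on the whole space. *)
Definition potentialIntegrand (a sigma : R) (z : R * R * R) : R :=
  if (0 < z.1.1) && (0 < z.1.2) && (0 < z.2) then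
    expR (- z.2) * heatW a z.2 z.1.1 z.1.2 * z.2 `^ (sigma - 1) else 0.

Lemma measurable_potentialIntegrand a sigma : -1 < a ->
  measurable_fun setT (potentialIntegrand a sigma).
Proof.
move=> a1.
pose b (z : R) := if 0 < z then besselI a z else 0.
have mb : measurable_fun setT b by exact: measurable_besselI.
rewrite (_ : potentialIntegrand a sigma = fun z : R * R * R =>
  if (0 < z.1.1) && (0 < z.1.2) && (0 < z.2) then
    expR (- z.2) * ((z.1.1 * z.1.2) `^ (1 / 2) / (2 * z.2) *
      expR (- ((z.1.1 ^+ 2 + z.1.2 ^+ 2) / (4 * z.2))) *
      b (z.1.1 * z.1.2 / (2 * z.2))) * z.2 `^ (sigma - 1) else 0); last first.
  apply/funext => -[[x y] t]; rewrite /potentialIntegrand /=.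
  case: ifPn => // /andP[/andP[x0 y0] t0]; rewrite /heatW /b.
  by rewrite !(mulr_gt0, invr_gt0).
by mfun.
Qed.

Lemma potentialIntegrand_ge0 a sigma z : -1 < a -> 0 <= potentialIntegrand a sigma z.
Proof.
move=> a1; rewrite /potentialIntegrand; case: ifPn => // /andP[/andP[x0 y0] t0].
by apply: mulr_ge0; [apply: mulr_ge0; [exact: expR_ge0|exact: heatW_ge0]|exact: powR_ge0].
Qed.

End HeatKernel.

Section PotentialKernel.
Variable R : realType.
Notation mu := (@lebesgue_measure R).
Implicit Types (a x y u s sigma : R).
Local Open Scope ereal_scope.

(** The potential kernel extended by 0, a nonnegative measurable function on the
    plane. *)
Definition kernelH a sigma (z : R * R) : \bar R :=
  (Gamma sigma)^-1%:E * \int[mu]_(t in @Rpos R) (potentialIntegrand a sigma (z, t))%:E.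

Lemma measurable_kernelH a sigma : (-1 < a)%R -> measurable_fun setT (kernelH a sigma).
Proof.
move=> a1; apply: emeasurable_funM; first exact: measurable_cst.
have mI := measurable_potentialIntegrand sigma a1.
have mE : measurable_fun setT (fun z : R * R * R => (potentialIntegrand a sigma z)%:E) by mfun.
apply: (measurable_integral_snd (@measurable_Rpos R) mE).
by move=> z; rewrite lee_fin potentialIntegrand_ge0.
Qed.

Lemma kernelH_ge0 a sigma z : (-1 < a)%R -> (0 < sigma)%R -> 0 <= kernelH a sigma z.
Proof.
move=> a1 s0; rewrite mule_ge0 ?lee_fin ?invr_ge0 ?(ltW (Gamma_gt0 s0))//.
by apply: integral_ge0 => t _; rewrite lee_fin potentialIntegrand_ge0.
Qed.

Lemma kernelHE a sigma x y : (0 < x)%R -> (0 < y)%R ->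
  kernelH a sigma (x, y) = potentialH a sigma x y.
Proof.
move=> x0 y0; congr (_ * _); apply: eq_integral => t /set_mem /RposP t0.
by rewrite /potentialIntegrand /= x0 y0 t0.
Qed.

(** The t-integral left after the boundary factor is removed; up to constants it
    is a Macdonald function times a power of u. *)
Definition besselK s u : \bar R :=
  \int[mu]_(t in @Rpos R) (expR (- t) * t `^ (s - 3 / 2) * expR (- (u ^+ 2 / (4 * t))))%:E.

Lemma measurable_besselK_integrand s u : measurable_fun setT
  (fun t : R => expR (- t) * t `^ (s - 3 / 2) * expR (- (u ^+ 2 / (4 * t))))%R.
Proof. by mfun. Qed.

Lemma measurable_potentialIntegrand_snd a sigma (z : R * R) : (-1 < a)%R ->
  measurable_fun setT (fun t : R => potentialIntegrand a sigma (z, t)).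
Proof.
move=> a1; apply: (measurableT_comp (measurable_potentialIntegrand sigma a1)).
exact: pair1_measurable.
Qed.

Lemma potentialH_le_besselK a sigma : (- (1 / 2) <= a)%R -> (0 < sigma)%R ->
  exists2 C : R, (0 < C)%R & forall x y, (0 < x)%R -> (0 < y)%R ->
  potentialH a sigma x y <= C%:E * besselK sigma (x - y).
Proof.
move=> a1 s0; have aN1 : (-1 < a)%R by lra.
have [c [C [c0 C0 h]]] := heatW_bounds aN1.
have G0 : (0 < (Gamma sigma)^-1)%R by rewrite invr_gt0 Gamma_gt0.
exists ((Gamma sigma)^-1 * C)%R => [|x y x0 y0]; first by rewrite mulr_gt0.
rewrite -kernelHE// EFinM -muleA lee_pmul2l ?fin_num_fun//.
have mK := measurable_besselK_integrand sigma (x - y).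
have mI := measurable_potentialIntegrand_snd sigma (x, y) aN1.
rewrite -int_scaleR//; [|exact: measurable_Rpos|exact: ltW|]; last first.
  by move=> t _; rewrite !mulr_ge0 ?expR_ge0 ?powR_ge0.
apply: int_le; [exact: measurable_Rpos|by mfun|by mfun|..].
  by move=> t _; rewrite lee_fin potentialIntegrand_ge0.
move=> t /RposP t0; rewrite lee_fin /potentialIntegrand /= x0 y0 t0 /=.
have /andP[_ h2] := h t x y t0 x0 y0.
apply: (@le_trans _ _ (expR (- t) * (C * heatCmp a t x y) * t `^ (sigma - 1))%R).
  by rewrite ler_wpM2r ?powR_ge0// ler_wpM2l ?expR_ge0.
rewrite (_ : (sigma - 3 / 2 = (sigma - 1) - 1 / 2)%R); last by clear; lra.
rewrite (gt0_powRD (sigma - 1) _ t0).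
have := heatCmp_le a1 t0 x0 y0.
set q := heatCmp _ _ _ _; set e1 := expR (- t); set e2 := expR _.
set p1 := (t `^ _)%R; set p2 := (t `^ _)%R => qle.
have -> : (C * (e1 * (p2 * p1) * e2) = e1 * (C * (p1 * e2)) * p2)%R by ring.
by rewrite ler_wpM2r ?powR_ge0// ler_wpM2l ?expR_ge0// ler_pM2l.
Qed.

(** The second term of [heatCmp_le_sing] raises the power of t by -(a+1/2), that
    is, it raises the order of the potential. *)
Lemma potentialH_le_besselK_sing a sigma : (-1 < a)%R -> (a < - (1 / 2))%R -> (0 < sigma)%R ->
  exists2 C : R, (0 < C)%R & forall x y, (0 < x)%R -> (0 < y)%R ->
  potentialH a sigma x y <= C%:E * (besselK sigma (x - y) +
    ((x * y) `^ (a + 1 / 2))%:E * besselK (sigma - (a + 1 / 2)) (x - y)).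
Proof.
move=> aN1 a1 s0.
have [c [C [c0 C0 h]]] := heatW_bounds aN1.
have G0 : (0 < (Gamma sigma)^-1)%R by rewrite invr_gt0 Gamma_gt0.
pose g := (- (a + 1 / 2))%R.
have p4 : (0 < 4 `^ g :> R)%R by rewrite powR_gt0.
exists ((Gamma sigma)^-1 * (C * 4 `^ g))%R => [|x y x0 y0]; first by rewrite mulr_gt0// mulr_gt0.
rewrite -kernelHE// EFinM -muleA lee_pmul2l ?fin_num_fun//.
have mK s := measurable_besselK_integrand s (x - y).
have mI := measurable_potentialIntegrand_snd sigma (x, y) aN1.
have K0 s (t : R) : (0 <= expR (- t) * t `^ (s - 3 / 2) * expR (- ((x - y) ^+ 2 / (4 * t))))%R.
  by rewrite !mulr_ge0 ?expR_ge0 ?powR_ge0.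
rewrite /besselK -int_scaleR//; [|exact: measurable_Rpos|exact: powR_ge0].
rewrite -int_add//; [|exact: measurable_Rpos|by mfun|by mfun|by move=> t _; rewrite lee_fin|]; last first.
  by move=> t _; rewrite lee_fin mulr_ge0 ?powR_ge0.
rewrite -int_scale//; [|exact: measurable_Rpos|by mfun|by rewrite mulr_ge0// ltW|]; last first.
  by move=> t _; rewrite -EFinD lee_fin addr_ge0// mulr_ge0 ?powR_ge0.
apply: int_le; [exact: measurable_Rpos|by mfun|by mfun|..].
  by move=> t _; rewrite lee_fin potentialIntegrand_ge0.
move=> t /RposP t0; rewrite -EFinD -EFinM lee_fin /potentialIntegrand /= x0 y0 t0 /=.
have /andP[_ h2] := h t x y t0 x0 y0.
apply: (@le_trans _ _ (expR (- t) * (C * heatCmp a t x y) * t `^ (sigma - 1))%R).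
  by rewrite ler_wpM2r ?powR_ge0// ler_wpM2l ?expR_ge0.
rewrite (_ : (sigma - (a + 1 / 2) - 3 / 2 = (sigma - 3 / 2) + g)%R); last by rewrite /g; clear; lra.
rewrite (gt0_powRD (sigma - 3 / 2) g t0).
rewrite (_ : (sigma - 3 / 2 = (sigma - 1) - 1 / 2)%R); last by clear; lra.
rewrite (gt0_powRD (sigma - 1) _ t0).
have := heatCmp_le_sing (erefl g) a1 t0 x0 y0.
have -> : (a + 1 / 2 = - g)%R by rewrite opprK.
set q := heatCmp _ _ _ _; set e1 := expR (- t); set e2 := expR _.
set p1 := (t `^ (- (1 / 2)))%R; set p2 := (t `^ (sigma - 1))%R.
set p3 := (t `^ g)%R; set p5 := ((x * y) `^ _)%R => qle.
rewrite [X in (_ <= X)%R](_ : _ = e1 * (C * (p1 * e2 * (4 `^ g * (1 + p3 * p5)))) * p2)%R; last by ring.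
by rewrite ler_wpM2r ?powR_ge0// ler_wpM2l ?expR_ge0// ler_pM2l.
Qed.

(** Bounding the Gaussian by a power leaves a Gamma integral, finite as long as
    m > 1/2 - s. *)
Lemma besselK_le_powN s (m : R) : (0 <= m)%R -> (0 < s - 1 / 2 + m)%R ->
  exists2 C : R, (0 < C)%R & forall u, u != 0%R ->
  besselK s u <= (C * `|u| `^ (- (2 * m)))%:E.
Proof.
move=> m0 sm; have [C C0 h] := expRN_le_powRN m0.
have G0 := Gamma_gt0 sm.
have p4 : (0 < 4 `^ m :> R)%R by rewrite powR_gt0.
exists (C * 4 `^ m * Gamma (s - 1 / 2 + m))%R => [|u u0]; first by rewrite mulr_gt0// mulr_gt0.
have nu0 : (0 < `|u|)%R by rewrite normr_gt0.
rewrite mulrAC EFinM GammaE// /EGamma.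
have mK := measurable_besselK_integrand s u.
rewrite -int_scaleR//; [|exact: measurable_Rpos|by mfun|by rewrite mulr_ge0 ?powR_ge0// mulr_ge0// ltW|]; last first.
  by move=> t _; rewrite mulr_ge0 ?powR_ge0 ?expR_ge0.
apply: int_le; [exact: measurable_Rpos|by mfun|by mfun|..].
  by move=> t _; rewrite lee_fin !mulr_ge0 ?expR_ge0 ?powR_ge0.
move=> t /RposP t0; rewrite lee_fin.
have v0 : (0 < u ^+ 2 / (4 * t))%R by apply: divr_gt0; [rewrite exprn_even_gt0|rewrite mulr_gt0].
have := h _ v0; rewrite -real_normK ?num_real//.
have -> : ((`|u| ^+ 2 / (4 * t)) `^ (- m) = 4 `^ m * t `^ m * `|u| `^ (- (2 * m)))%R.
  rewrite powRM ?exprn_ge0 ?invr_ge0 ?mulr_ge0 ?(ltW t0)// -powR_mulrn// -powRrM mulrN.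
  rewrite -(powR_inv1 (mulr_ge0 _ (ltW t0)))// -powRrM mulrNN mul1r (powRM _ _ (ltW t0))//.
  by rewrite mulrC.
move=> hh; rewrite (_ : (s - 1 / 2 + m - 1 = (s - 3 / 2) + m)%R); last by clear; lra.
rewrite (gt0_powRD _ m t0).
set e1 := expR (- t); set p1 := (t `^ (s - 3 / 2))%R; move: hh.
set e2 := expR _; set p2 := (t `^ m)%R; set w := (`|u| `^ _)%R => hh.
rewrite [X in (_ <= X)%R](_ : _ = e1 * p1 * (C * (4 `^ m * p2 * w)))%R; last by ring.
by rewrite ler_wpM2l// mulr_ge0 ?expR_ge0 ?powR_ge0.
Qed.

(** The endpoint m = 1/2 - s of [besselK_le_powN]. A single power diverges there,
    so the integral is cut at t = u^2: the Gaussian is used below and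
    discarded above. *)
Lemma besselK_le_crit s : (0 < s)%R -> (s < 1 / 2)%R ->
  exists2 C : R, (0 < C)%R & forall u, u != 0%R ->
  besselK s u <= (C * `|u| `^ (2 * s - 1))%:E.
Proof.
move=> s0 s1; have [C C0 h] := expRN_le_powRN (@ler01 R).
pose A := (C * 4 / (s + 1 / 2) + (1 / 2 - s)^-1)%R.
have A1 : (0 < s + 1 / 2)%R by lra.
have A2 : (0 < 1 / 2 - s)%R by lra.
exists A => [|u u0]; first by rewrite addr_gt0 ?invr_gt0// divr_gt0// mulr_gt0.
have nu0 : (0 < `|u|)%R by rewrite normr_gt0.
pose r : R := (`|u| ^+ 2)%R.
have r0 : (0 < r)%R by rewrite exprn_gt0.
have mK := measurable_besselK_integrand s u.
have K0 (t : R) : (0 <= expR (- t) * t `^ (s - 3 / 2) * expR (- (u ^+ 2 / (4 * t))))%R.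
  by rewrite !mulr_ge0 ?expR_ge0 ?powR_ge0.
have m1 : measurable (`]0%R, r]%classic : set R) by exact: measurable_itv.
have m2 : measurable (`]r, +oo[%classic : set R) by exact: measurable_itv.
have m3 : measurable (`[r, +oo[%classic : set R) by exact: measurable_itv.
have e1 (t : R) : (0 < t)%R -> (expR (- t) <= 1)%R by move=> t0; rewrite expR_le1 oppr_le0 ltW.
have mKE : measurable_fun setT (fun t : R => (expR (- t) * t `^ (s - 3 / 2) * expR (- (u ^+ 2 / (4 * t))))%:E) by mfun.
rewrite /besselK (integral_Rpos_split r0 mKE); last by move=> t; rewrite lee_fin.
have -> : (A * `|u| `^ (2 * s - 1) = C * 4 / (s + 1 / 2) * `|u| `^ (2 * s - 1) +
  (1 / 2 - s)^-1 * `|u| `^ (2 * s - 1))%R by exact: mulrDl.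
rewrite EFinD leeD//.
  apply: (@le_trans _ _ (\int[mu]_(t in `]0%R, r]) (C * 4 * r^-1 * t `^ (s + 1 / 2 - 1))%:E)).
    apply: int_le => //; [by mfun|by move=> t _; rewrite lee_fin|].
    move=> t; rewrite /= in_itv/= => /andP[t0 _]; rewrite lee_fin.
    have v0 : (0 < u ^+ 2 / (4 * t))%R by apply: divr_gt0; [rewrite exprn_even_gt0|rewrite mulr_gt0].
    have := h _ v0; rewrite powR_inv1 ?(ltW v0)// -real_normK ?num_real// -/r => hh.
    rewrite (_ : (s + 1 / 2 - 1 = (s - 3 / 2) + 1)%R); last by clear; lra.
    rewrite (gt0_powRD _ 1 t0) powRr1 ?(ltW t0)//.
    rewrite [X in (_ <= X)%R](_ : _ = 1 * t `^ (s - 3 / 2) * (C * (r / (4 * t))^-1))%R; last first.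
      by field; rewrite !gt_eqF.
    by rewrite ler_pM ?mulr_ge0 ?expR_ge0 ?powR_ge0// ler_wpM2r ?powR_ge0// e1.
  rewrite int_scaleR//; [|by rewrite divr_ge0 ?mulr_ge0 ?(ltW C0) ?(ltW r0)|by move=> t _; exact: powR_ge0].
  rewrite integral_powR_near0// -EFinM lee_fin le_eqVlt; apply/orP; left; apply/eqP.
  rewrite /r -(powR_mulrn 2 (ltW nu0)) -powRrM -powRN.
  rewrite (_ : (2 * s - 1 = - 2 + 2 * (s + 1 / 2))%R); last by clear; lra.
  by rewrite (gt0_powRD (-2) _ nu0); field; rewrite gt_eqF//; lra.
apply: (@le_trans _ _ (\int[mu]_(t in `]r, +oo[) (t `^ (- (1 / 2 - s) - 1))%:E)).
  apply: int_le => //; [by mfun|by move=> t _; rewrite lee_fin|].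
  move=> t; rewrite /= in_itv/= andbT => t1; rewrite lee_fin; have t0 := lt_trans r0 t1.
  rewrite (_ : (- (1 / 2 - s) - 1 = s - 3 / 2)%R); last by clear; lra.
  rewrite mulrAC -[X in (_ <= X)%R]mul1r ler_wpM2r ?powR_ge0//.
  apply: mulr_ile1; [exact: expR_ge0|exact: expR_ge0|exact: e1|apply: e1].
  by apply: divr_gt0; [rewrite exprn_even_gt0|rewrite mulr_gt0].
apply: (@le_trans _ _ (\int[mu]_(t in `[r, +oo[) (t `^ (- (1 / 2 - s) - 1))%:E)).
  apply: int_sub => //; [by mfun|by move=> t _; rewrite lee_fin powR_ge0|].
  by move=> t; rewrite /= !in_itv/= !andbT => /ltW.
rewrite integral_powR_infty// lee_fin le_eqVlt; apply/orP; left; apply/eqP.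
rewrite /r -(powR_mulrn 2 (ltW nu0)) -powRrM mulrC; congr (_ * _ `^ _)%R.
by clear; lra.
Qed.

End PotentialKernel.

(** * Bounds for the potential kernel *)

Section KernelUpper.
Variable R : realType.
Implicit Types (a x y u s sigma delta d g : R).

(** An integrable singularity of order delta at 0, joined to an integrable tail. *)
Definition localG delta u : R := if u <= 1 then u `^ (delta - 1) else u `^ (- 2).

Lemma localG_ge0 delta u : 0 <= localG delta u.
Proof. by rewrite /localG; case: ifP => _; exact: powR_ge0. Qed.

Lemma measurable_localG delta : measurable_fun setT (localG delta).
Proof. by rewrite /localG; apply: measurable_fun_ifT; [apply: measurable_fun_ler; mfun|mfun|mfun]. Qed.

Lemma localG_le_powR delta u : 0 < delta -> 0 < u -> localG delta u <= u `^ (delta - 1).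
Proof.
move=> d0 u0; rewrite /localG; case: (leP u 1) => // u1.
by apply: ler_powR; [exact: ltW|lra].
Qed.

(** The case delta = 2s is the endpoint, the others are interior. *)
Lemma besselK_le_powR s delta : 0 < delta -> delta < 1 -> delta <= 2 * s ->
  exists2 C : R, 0 < C & forall u, u != 0 -> (besselK s u <= (C * `|u| `^ (delta - 1))%:E)%E.
Proof.
move=> d0 d1 ds; have [ds'|/eqP ds'] := eqVneq delta (2 * s).
  rewrite ds'; apply: besselK_le_crit; lra.
have m0 : 0 <= (1 - delta) / 2 by lra.
have sm : 0 < s - 1 / 2 + (1 - delta) / 2.
  have : delta < 2 * s by rewrite lt_neqAle ds andbT; apply/eqP.
  lra.
have [C C0 h] := besselK_le_powN m0 sm; exists C => // u u0.
by apply: le_trans (h u u0) _; rewrite (_ : - (2 * ((1 - delta) / 2)) = delta - 1)//; lra.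
Qed.

Lemma besselK_le_localG s delta : 0 < delta -> delta < 1 -> delta <= 2 * s ->
  exists2 C : R, 0 < C & forall u, u != 0 -> (besselK s u <= (C * localG delta `|u|)%:E)%E.
Proof.
move=> d0 d1 ds; have [C1 C10 h1] := besselK_le_powR d0 d1 ds.
have sm : 0 < s - 1 / 2 + 1 by lra.
have [C2 C20 h2] := besselK_le_powN (@ler01 R) sm.
exists (C1 + C2) => [|u u0]; first exact: addr_gt0.
rewrite /localG; case: ifPn => _.
  apply: le_trans (h1 u u0) _; rewrite lee_fin ler_wpM2r ?powR_ge0//; lra.
apply: le_trans (h2 u u0) _; rewrite mulr1 lee_fin ler_wpM2r ?powR_ge0//; lra.
Qed.

Lemma potentialH_le_localG a sigma delta : - (1 / 2) <= a -> 0 < sigma ->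
  0 < delta -> delta < 1 -> delta <= 2 * sigma ->
  exists2 C : R, 0 < C & forall x y, 0 < x -> 0 < y -> x != y ->
  (potentialH a sigma x y <= (C * localG delta `|x - y|)%:E)%E.
Proof.
move=> a1 s0 d0 d1 ds.
have [C1 C10 h1] := potentialH_le_besselK a1 s0.
have [C2 C20 h2] := besselK_le_localG d0 d1 ds.
exists (C1 * C2) => [|x y x0 y0 xy]; first exact: mulr_gt0.
apply: le_trans (h1 x y x0 y0) _.
rewrite -mulrA EFinM lee_pmul2l// h2//.
by rewrite subr_eq0.
Qed.

Lemma potentialH_le_cst a sigma : - (1 / 2) <= a -> 1 / 2 < sigma ->
  exists2 C : R, 0 < C & forall x y, 0 < x -> 0 < y -> x != y ->
  (potentialH a sigma x y <= C%:E)%E.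
Proof.
move=> a1 s1; have s0 : 0 < sigma by lra.
have [C1 C10 h1] := potentialH_le_besselK a1 s0.
have sm : 0 < sigma - 1 / 2 + 0 by lra.
have [C2 C20 h2] := besselK_le_powN (lexx 0) sm.
exists (C1 * C2) => [|x y x0 y0 xy]; first exact: mulr_gt0.
apply: le_trans (h1 x y x0 y0) _.
rewrite EFinM lee_pmul2l//; have := h2 (x - y).
by rewrite subr_eq0 mulr0 oppr0 powRr0 mulr1; apply.
Qed.

(** Kernels homogeneous of degree d-1, supported on one side of the diagonal and
    singular of order g in the smaller variable. This degree is the one that
    the scaling d = 1/p - 1/q requires. *)
Definition hardyL d g x y : R := if y < x then x `^ (d + g - 1) * y `^ (- g) else 0.
Definition hardyR d g x y : R := if x < y then x `^ (- g) * y `^ (d + g - 1) else 0.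

Lemma hardyL_ge0 d g x y : 0 <= hardyL d g x y.
Proof. by rewrite /hardyL; case: ifP => // _; rewrite mulr_ge0 ?powR_ge0. Qed.

Lemma hardyR_ge0 d g x y : 0 <= hardyR d g x y.
Proof. by rewrite /hardyR; case: ifP => // _; rewrite mulr_ge0 ?powR_ge0. Qed.

(** If x and y are comparable then |x-y|^2 <= xy, and the weight (xy)^(-g) merely
    cancels the gain of 2g in the exponent. Otherwise |x-y| is comparable with
    the larger variable and the product is a Hardy kernel. *)
Lemma weighted_le_localG_hardy delta d g C3 C4 x y (K : \bar R) : 0 < g ->
  delta + 2 * g < 1 -> 0 <= d -> d + 2 * g < 1 -> 0 < C3 -> 0 < C4 ->
  0 < x -> 0 < y -> x != y ->
  (K <= (C3 * localG (delta + 2 * g) `|x - y|)%:E)%E ->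
  (K <= (C4 * `|x - y| `^ (d + 2 * g - 1))%:E)%E ->
  (((x * y) `^ (- g))%:E * K <=
   ((C3 + 2 * C4) * (localG delta `|x - y| + hardyL d g x y + hardyR d g x y))%:E)%E.
Proof.
move=> g0 e2 d0 d2 C30 C40 x0 y0 xy K3 K4.
have uN0 : x - y != 0 by rewrite subr_eq0.
have u0 : 0 < `|x - y| by rewrite normr_gt0.
have L0 := localG_ge0 delta `|x - y|.
have H1 : 0 <= hardyL d g x y by exact: hardyL_ge0.
have H2 : 0 <= hardyR d g x y by exact: hardyR_ge0.
have w0 : (0 <= ((x * y) `^ (- g))%:E)%E by rewrite lee_fin powR_ge0.
have xy0 : 0 < x * y by exact: mulr_gt0.
have pw k : 0 < k -> k / 2 <= `|x - y| -> `|x - y| `^ (d + 2 * g - 1) <= 2 * k `^ (d + 2 * g - 1).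
  move=> k0 ku; have e : d + 2 * g - 1 <= 0 by lra.
  apply: (@le_trans _ _ ((k / 2) `^ (d + 2 * g - 1))); first by apply: le0_ler_powR => //; lra.
  rewrite powRM ?invr_ge0 ?(ltW k0)// mulrC ler_wpM2r ?powR_ge0//.
  rewrite -(powR_inv1 (ler0n R 2)) -powRrM mulN1r -[leRHS](powRr1 (ler0n R 2)).
  by apply: ler_powR; [rewrite ler1n|lra].
have [yx|yx] := ltP (2 * y) x.
  have yx' : y < x by lra.
  apply: le_trans (lee_wpmul2l w0 K4) _; rewrite -EFinM lee_fin.
  have k1 : x / 2 <= `|x - y| by rewrite gtr0_norm ?subr_gt0//; lra.
  apply: (@le_trans _ _ (2 * C4 * hardyL d g x y)); last by clear -L0 H1 H2 C30 C40; nra.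
  rewrite /hardyL yx'.
  apply: (@le_trans _ _ ((x * y) `^ (- g) * (C4 * (2 * x `^ (d + 2 * g - 1))))).
    by rewrite ler_wpM2l ?powR_ge0// ler_pM2l// pw.
  rewrite powRM ?(ltW x0) ?(ltW y0)// le_eqVlt; apply/orP; left; apply/eqP.
  rewrite (_ : d + g - 1 = d + 2 * g - 1 + - g); last by clear; lra.
  by rewrite (gt0_powRD _ (- g) x0); ring.
have [xy2|xy2] := ltP (2 * x) y.
  have yx' : x < y by lra.
  apply: le_trans (lee_wpmul2l w0 K4) _; rewrite -EFinM lee_fin.
  have k1 : y / 2 <= `|x - y| by rewrite distrC gtr0_norm ?subr_gt0//; lra.
  apply: (@le_trans _ _ (2 * C4 * hardyR d g x y)); last by clear -L0 H1 H2 C30 C40; nra.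
  rewrite /hardyR yx'.
  apply: (@le_trans _ _ ((x * y) `^ (- g) * (C4 * (2 * y `^ (d + 2 * g - 1))))).
    by rewrite ler_wpM2l ?powR_ge0// ler_pM2l// pw.
  rewrite powRM ?(ltW x0) ?(ltW y0)// le_eqVlt; apply/orP; left; apply/eqP.
  rewrite (_ : d + g - 1 = d + 2 * g - 1 + - g); last by clear; lra.
  by rewrite (gt0_powRD _ (- g) y0); ring.
apply: le_trans (lee_wpmul2l w0 K3) _; rewrite -EFinM lee_fin.
apply: (@le_trans _ _ (C3 * localG delta `|x - y|)); last by clear -L0 H1 H2 C30 C40; nra.
rewrite mulrCA ler_pM2l//.
have u2 : `|x - y| ^+ 2 <= x * y.
  have [xley|ylex] := leP x y.
    by rewrite distrC ger0_norm ?subr_ge0//; nra.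
  by rewrite gtr0_norm ?subr_gt0//; nra.
have u3 : (x * y) `^ (- g) <= `|x - y| `^ (- (2 * g)).
  rewrite -mulrN powRrM powR_mulrn ?(ltW u0)//.
  by apply: le0_ler_powR => //; [lra|rewrite exprn_gt0].
apply: (@le_trans _ _ (`|x - y| `^ (- (2 * g)) * localG (delta + 2 * g) `|x - y|)).
  by rewrite ler_wpM2r ?localG_ge0.
rewrite /localG; case: ifPn => u1.
  rewrite -gt0_powRD// (_ : - (2 * g) + (delta + 2 * g - 1) = delta - 1)//.
  by clear; lra.
rewrite ler_piMl ?powR_ge0//.
rewrite powRN invf_le1 ?powR_gt0// powR_ge1//; last by lra.
by rewrite ltW// ltNge.
Qed.

(** The exponent delta is used near the diagonal and d away from it; they are
    chosen separately because only d is tied to p and q. *)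
Lemma potentialH_le_sing a sigma delta d g : -1 < a -> a < - (1 / 2) -> 0 < sigma ->
  g = - (a + 1 / 2) -> 0 < delta -> delta <= 2 * sigma -> delta + 2 * g < 1 ->
  0 <= d -> d <= 2 * sigma -> d + 2 * g < 1 ->
  exists2 C : R, 0 < C & forall x y, 0 < x -> 0 < y -> x != y ->
  (potentialH a sigma x y <=
   (C * (localG delta `|x - y| + hardyL d g x y + hardyR d g x y))%:E)%E.
Proof.
move=> a1 a2 s0 gE e0 e1 e2 d0 d1 d2.
have g0 : 0 < g by lra.
have [C1 C10 h1] := potentialH_le_besselK_sing a1 a2 s0.
have e3 : delta < 1 by lra.
have [C2 C20 h2] := besselK_le_localG e0 e3 e1.
have e4 : 0 < delta + 2 * g by lra.
have e5 : delta + 2 * g <= 2 * (sigma + g) by lra.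
have [C3 C30 h3] := besselK_le_localG e4 e2 e5.
have d4 : 0 < d + 2 * g by lra.
have d5 : d + 2 * g <= 2 * (sigma + g) by lra.
have [C4 C40 h4] := besselK_le_powR d4 d2 d5.
(* 2 C4 comes from |x-y| >= max(x,y)/2 away from the diagonal *)
exists (C1 * (C2 + C3 + 2 * C4)) => [|x y x0 y0 xy].
  by rewrite mulr_gt0// !addr_gt0// mulr_gt0.
apply: le_trans (h1 x y x0 y0) _.
rewrite -mulrA EFinM lee_pmul2l//.
have uN0 : x - y != 0 by rewrite subr_eq0.
have -> : a + 1 / 2 = - g by rewrite gE opprK.
rewrite opprK.
have L0 := localG_ge0 delta `|x - y|.
have H1 := hardyL_ge0 d g x y; have H2 := hardyR_ge0 d g x y.
have h := weighted_le_localG_hardy g0 e2 d0 d2 C30 C40 x0 y0 xy (h3 _ uN0) (h4 _ uN0).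
apply: le_trans (leeD (h2 _ uN0) h) _; rewrite -EFinD lee_fin.
clear -L0 H1 H2 C20 C30 C40; nra.
Qed.

End KernelUpper.

Section KernelLower.
Variable R : realType.
Notation mu := (@lebesgue_measure R).
Implicit Types (a x y sigma : R).

(** For e^2/2 <= t <= 1 and |x-y| <= e the Gaussian and e^(-t) are bounded below,
    and xy/2t >= 1/2 keeps the boundary factor away from 0. *)
Lemma potentialH_ge_diag a sigma : -1 < a -> 0 < sigma ->
  exists2 c : R, 0 < c & forall x y e, 0 < e -> e <= 1 -> 1 <= x -> 1 <= y -> `|x - y| <= e ->
  (c%:E * \int[mu]_(t in `[(e ^+ 2 / 2)%R, 1%R]) (t `^ (sigma - 3 / 2))%:E <=
  potentialH a sigma x y)%E.
Proof.
move=> a1 s0; have [c [C [c0 C0 h]]] := heatW_bounds a1.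
have G0 : 0 < (Gamma sigma)^-1 by rewrite invr_gt0 Gamma_gt0.
pose k : R := Num.min 1 ((1 / 3) `^ (a + 1 / 2)).
have k0 : 0 < k by rewrite lt_min ltr01 powR_gt0.
pose q := c * (expR (-1) * expR (-1) * k).
have q0 : 0 < q by rewrite mulr_gt0// mulr_gt0// mulr_gt0 ?expR_gt0.
exists ((Gamma sigma)^-1 * q) => [|x y e e0 e1 x1 y1 xye]; first exact: mulr_gt0.
have x0 : 0 < x by lra.
have y0 : 0 < y by lra.
rewrite -kernelHE// EFinM -muleA lee_pmul2l ?fin_num_fun//.
have mI := measurable_potentialIntegrand_snd sigma (x, y) a1.
have m1 : measurable (`[(e ^+ 2 / 2)%R, 1%R]%classic : set R) by exact: measurable_itv.
have ee0 : 0 < e ^+ 2 by rewrite exprn_gt0.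
rewrite -int_scaleR//; [|exact: ltW|by move=> t _; exact: powR_ge0].
apply: (@le_trans _ _ (\int[mu]_(t in `[(e ^+ 2 / 2)%R, 1%R]) (potentialIntegrand a sigma (x, y, t))%:E)%E); last first.
  apply: int_sub => //; [exact: measurable_Rpos|by mfun|by move=> t _; rewrite lee_fin potentialIntegrand_ge0|].
  move=> t; rewrite /Rpos /= !in_itv/= andbT => /andP[t1 _]; clear -t1 ee0; lra.
apply: int_le => //; [by mfun|by mfun|by move=> t _; rewrite lee_fin mulr_ge0 ?powR_ge0// ltW|].
move=> t; rewrite /= in_itv/= => /andP[t1 t2]; rewrite lee_fin.
have t0 : 0 < t by clear -t1 ee0; lra.
rewrite /potentialIntegrand /= x0 y0 t0 /=.
have /andP[h2 _] := h t x y t0 x0 y0.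
apply: (@le_trans _ _ (expR (- t) * (c * heatCmp a t x y) * t `^ (sigma - 1))); last first.
  by rewrite ler_wpM2r ?powR_ge0// ler_wpM2l ?expR_ge0.
rewrite (_ : sigma - 3 / 2 = (sigma - 1) - 1 / 2); last by clear; lra.
rewrite (gt0_powRD (sigma - 1) _ t0) /heatCmp.
have E1 : expR (-1) <= expR (- t) by rewrite ler_expR lerN2.
have E2 : expR (-1) <= expR (- ((x - y) ^+ 2 / (4 * t))).
  rewrite ler_expR lerN2 ler_pdivrMr ?mulr_gt0// mul1r.
  have : (x - y) ^+ 2 <= e ^+ 2.
    by rewrite -(real_normK (num_real (x - y))) lerXn2r ?nnegrE// ltW.
  clear -t1 t0 ee0; lra.
have E3 : k <= (x * y / (2 * t) / (1 + x * y / (2 * t))) `^ (a + 1 / 2).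
  have z0 : 1 / 2 <= x * y / (2 * t).
    rewrite ler_pdivlMr ?mulr_gt0//; have : 1 <= x * y by clear -x1 y1; nra.
    by clear -t2; lra.
  move: (x * y / (2 * t)) z0 => z z0.
  have z1 : 0 < 1 + z by clear -z0; lra.
  have v1 : 1 / 3 <= z / (1 + z) by rewrite ler_pdivlMr//; clear -z0; lra.
  have v2 : z / (1 + z) <= 1 by rewrite ler_pdivrMr//; clear -z0; lra.
  rewrite /k ge_min; have [b0|b0] := leP 0 (a + 1 / 2).
    by rewrite ge0_ler_powR ?orbT ?nnegrE//; clear -v1; lra.
  have := @le0_ler_powR R (a + 1 / 2) (z / (1 + z)) 1 (ltW b0); rewrite powR1 => -> //.
  by clear -v1; lra.
have p0 : 0 <= t `^ (sigma - 1) * t `^ (- (1 / 2)) by rewrite mulr_ge0 ?powR_ge0.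
set p1 := t `^ (- (1 / 2)) in p0 *; set p2 := t `^ (sigma - 1) in p0 *.
move: E1 E2 E3; set f1 := expR (- t); set f2 := expR (- (_ / _)); set f3 := (_ / _) `^ _ => E1 E2 E3.
have -> : f1 * (c * (p1 * f2 * f3)) * p2 = c * (f1 * f2 * f3) * (p2 * p1) by ring.
rewrite ler_wpM2r// /q ler_pM2l// ler_pM ?mulr_ge0 ?expR_ge0 ?(ltW k0)//.
by rewrite ler_pM ?expR_ge0.
Qed.

(** Already 2 <= t <= 3 contributes this much: there xy/2t is at most x, and the
    exponent a + 1/2 is negative. *)
Lemma potentialH_ge_small a sigma : -1 < a -> a < - (1 / 2) -> 0 < sigma ->
  exists2 c : R, 0 < c & forall x y, 0 < x -> x <= 1 -> 1 <= y -> y <= 2 ->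
  ((c * x `^ (a + 1 / 2))%:E <= potentialH a sigma x y)%E.
Proof.
move=> a1 a2 s0; have [c [C [c0 C0 h]]] := heatW_bounds a1.
have G0 : 0 < (Gamma sigma)^-1 by rewrite invr_gt0 Gamma_gt0.
pose k : R := Num.min 1 (3 `^ (sigma - 3 / 2)).
have k0 : 0 < k by rewrite lt_min ltr01 powR_gt0.
pose q := c * (expR (-3) * expR (-1) * k).
have q0 : 0 < q by rewrite mulr_gt0// mulr_gt0// mulr_gt0 ?expR_gt0.
exists ((Gamma sigma)^-1 * q) => [|x y x0 x1 y1 y2]; first exact: mulr_gt0.
have y0 : 0 < y by lra.
rewrite -kernelHE// -mulrA EFinM lee_pmul2l ?fin_num_fun//.
have mI := measurable_potentialIntegrand_snd sigma (x, y) a1.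
have m1 : measurable (`[2%R, 3%R]%classic : set R) by exact: measurable_itv.
apply: (@le_trans _ _ (\int[mu]_(t in `[2%R, 3%R]) (q * x `^ (a + 1 / 2))%:E)%E).
  rewrite integral_const// lebesgue_measure_itv/= lte_fin ltr_nat/= -EFinB -EFinM lee_fin.
  by rewrite (_ : 3 - 2 = 1) ?mulr1//; clear; lra.
apply: (@le_trans _ _ (\int[mu]_(t in `[2%R, 3%R]) (potentialIntegrand a sigma (x, y, t))%:E)%E); last first.
  apply: int_sub => //; [exact: measurable_Rpos|by mfun|by move=> t _; rewrite lee_fin potentialIntegrand_ge0|].
  by move=> t; rewrite /Rpos /= !in_itv/= andbT => /andP[t1 _]; clear -t1; lra.
apply: int_le => //; [by mfun|by move=> t _; rewrite lee_fin mulr_ge0 ?powR_ge0// ltW|].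
move=> t; rewrite /= in_itv/= => /andP[t1 t2]; rewrite lee_fin.
have t0 : 0 < t by clear -t1; lra.
rewrite /potentialIntegrand /= x0 y0 t0 /=.
have /andP[h2 _] := h t x y t0 x0 y0.
apply: (@le_trans _ _ (expR (- t) * (c * heatCmp a t x y) * t `^ (sigma - 1))); last first.
  by rewrite ler_wpM2r ?powR_ge0// ler_wpM2l ?expR_ge0.
rewrite /heatCmp.
have E1 : expR (-3) <= expR (- t) by rewrite ler_expR lerN2.
have E2 : expR (-1) <= expR (- ((x - y) ^+ 2 / (4 * t))).
  rewrite ler_expR lerN2 ler_pdivrMr ?mulr_gt0// mul1r.
  by clear -t1 x0 x1 y1 y2; nra.
have E3 : x `^ (a + 1 / 2) <= (x * y / (2 * t) / (1 + x * y / (2 * t))) `^ (a + 1 / 2).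
  have xy0 : 0 < x * y by exact: mulr_gt0.
  have z0 : 0 < x * y / (2 * t) by rewrite divr_gt0// mulr_gt0.
  have zx : x * y / (2 * t) <= x.
    by rewrite ler_pdivrMr ?mulr_gt0// ler_pM2l//; clear -t1 y2; lra.
  apply: le0_ler_powR; first by clear -a2; lra.
    by rewrite divr_gt0// addr_gt0.
  by rewrite ler_pdivrMr ?addr_gt0//; clear -zx x0 z0; nra.
have E4 : k <= t `^ (sigma - 1) * t `^ (- (1 / 2)).
  rewrite -gt0_powRD// (_ : sigma - 1 + - (1 / 2) = sigma - 3 / 2); last by clear; lra.
  rewrite /k ge_min; have [b0|b0] := leP 0 (sigma - 3 / 2).
    by rewrite powR_ge1//; clear -t1; lra.
  by rewrite le0_ler_powR ?orbT// ltW.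
move: E1 E2 E3 E4; set p1 := t `^ (- (1 / 2)); set p2 := t `^ (sigma - 1).
set f1 := expR (- t); set f2 := expR (- (_ / _)); set f3 := (_ / _) `^ _; set f4 := x `^ _ => E1 E2 E3 E4.
have -> : f1 * (c * (p1 * f2 * f3)) * p2 = c * (f1 * f2 * (p2 * p1) * f3) by ring.
rewrite /q -mulrA ler_pM2l// ler_pM ?mulr_ge0 ?expR_ge0 ?(ltW k0) ?powR_ge0//.
by rewrite ler_pM ?mulr_ge0 ?expR_ge0 ?(ltW k0)// ler_pM ?expR_ge0.
Qed.

End KernelLower.

(** * A Schur test *)

Section Operators.
Variable R : realType.
Notation mu := (@lebesgue_measure R).
Local Open Scope ereal_scope.
Implicit Types (K : R * R -> \bar R) (f : R -> R) (x y : R).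

Definition opT K f x : \bar R := \int[mu]_(y in @Rpos R) (K (x, y) * (f y)%:E).

(** Strong type (p, q) for nonnegative functions, normalized by the condition
    that the p-th power integral of f be at most 1. *)
Definition strong (p q : R) K := exists2 C : R, (0 < C)%R &
  forall f, measurable_fun setT f -> (forall y, 0 <= f y)%R ->
  \int[mu]_(y in @Rpos R) (f y `^ p)%:E <= 1 ->
  \int[mu]_(x in @Rpos R) (opT K f x `^ q) <= C%:E.

Lemma measurable_opT K f : measurable_fun setT K -> (forall z, 0 <= K z) ->
  measurable_fun setT f -> (forall y, 0 <= f y)%R -> measurable_fun setT (opT K f).
Proof.
move=> mK K0 mf f0.
have mk : measurable_fun setT (fun z : R * R => K z * (f z.2)%:E).
  by apply: emeasurable_funM => //; mfun.
have k0 z : 0 <= K z * (f z.2)%:E by rewrite mule_ge0// lee_fin.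
exact: (measurable_integral_snd (@measurable_Rpos R) mk k0).
Qed.

Lemma opT_ge0 K f x : (forall z, 0 <= K z) -> (forall y, 0 <= f y)%R -> 0 <= opT K f x.
Proof. by move=> K0 f0; apply: integral_ge0 => y _; rewrite mule_ge0// lee_fin. Qed.

Lemma poweR_mono (q : R) (a b : \bar R) : (0 <= q)%R -> 0 <= a -> a <= b -> a `^ q <= b `^ q.
Proof.
move=> q0 a0 ab; apply: gt0_ler_poweR => //; rewrite in_itv /= ?a0 ?leey//=.
by rewrite (le_trans a0 ab).
Qed.

Lemma poweR_le_of_gt (T S : \bar R) (M q : R) : 0 <= T -> 0 <= S -> (0 < M)%R -> (0 < q)%R ->
  (forall s : R, S < s%:E -> T <= (M * s `^ q^-1)%:E) -> T `^ q <= (M `^ q)%:E * S.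
Proof.
move=> T0 S0 M0 q0 h; have Mq0 : (0 < M `^ q)%R by rewrite powR_gt0.
case: S S0 h => [S||//] S0 h; last by rewrite gt0_muley ?leey// lte_fin.
apply/lee_addgt0Pr => e e0; rewrite lee_fin in S0.
pose s := (S + e / M `^ q)%R.
have eM : (0 < e / M `^ q)%R by rewrite divr_gt0.
have s0 : (0 < s)%R by rewrite /s; lra.
have hs : S%:E < s%:E by rewrite lte_fin /s; lra.
apply: le_trans (poweR_mono (ltW q0) T0 (h s hs)) _.
rewrite poweR_EFin powRM ?powR_ge0 ?(ltW M0)// -powRrM mulVf ?gt_eqF// powRr1 ?(ltW s0)//.
by rewrite -EFinM -EFinD lee_fin /s mulrDr mulrCA mulfV ?gt_eqF// mulr1.
Qed.

(** A pointwise bound of (K f)^q by a mixed integral of Phi reduces strong type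
    to the integral of Phi in the other variable, by Tonelli's theorem. The
    bound is asked for every real s above the integral of Phi, so that the
    value 0 and the value oo need no separate treatment. *)
Lemma strong_of_pointwise (p q M A : R) K : (0 < q)%R -> (0 < M)%R -> (0 <= A)%R ->
  measurable_fun setT K -> (forall z, 0 <= K z) ->
  (forall f, measurable_fun setT f -> (forall y, 0 <= f y)%R ->
     \int[mu]_(y in @Rpos R) (f y `^ p)%:E <= 1 ->
     exists Phi : R * R -> R, [/\ measurable_fun setT Phi, (forall z, 0 <= Phi z)%R,
       (forall x s, (0 < x)%R -> \int[mu]_(y in @Rpos R) (Phi (x, y))%:E < s%:E ->
          opT K f x <= (M * s `^ q^-1)%:E) &
       (forall y, (0 < y)%R -> \int[mu]_(x in @Rpos R) (Phi (x, y))%:E <= (A * f y `^ p)%:E)]) ->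
  strong p q K.
Proof.
move=> q0 M0 A0 mK K0 H.
have Mq0 : (0 < M `^ q)%R by rewrite powR_gt0.
exists (M `^ q * A + 1)%R => [|f mf f0 f1]; first by rewrite ltr_wpDl// mulr_ge0// ltW.
have [Phi [mPhi Phi0 h1 h2]] := H f mf f0 f1.
have mRpos := @measurable_Rpos R.
have mPhiE : measurable_fun setT (fun z => (Phi z)%:E) by mfun.
have mT := measurable_opT mK K0 mf f0.
have mS : measurable_fun setT (fun x => \int[mu]_(y in @Rpos R) (Phi (x, y))%:E).
  by apply: (measurable_integral_snd mRpos mPhiE) => z; rewrite lee_fin.
have S0 x : 0 <= \int[mu]_(y in @Rpos R) (Phi (x, y))%:E.
  by apply: integral_ge0 => y _; rewrite lee_fin.
apply: (@le_trans _ _ (\int[mu]_(x in @Rpos R)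
    ((M `^ q)%:E * \int[mu]_(y in @Rpos R) (Phi (x, y))%:E))).
  apply: int_le => //; [exact: (measurableT_comp (measurable_poweR _) mT)|exact: measurable_funeM| |].
    by move=> x _; exact: poweR_ge0.
  move=> x /RposP x0; apply: poweR_le_of_gt => //; first exact: opT_ge0.
  by move=> s hs; exact: h1.
rewrite int_scale//; last exact: ltW.
rewrite (tonelli_setX mRpos mRpos mPhiE); last by move=> z; rewrite lee_fin.
apply: (@le_trans _ _ ((M `^ q)%:E * A%:E)); last by rewrite -EFinM lee_fin lerDl.
rewrite lee_pmul2l// ?lte_fin//.
apply: (@le_trans _ _ (\int[mu]_(y in @Rpos R) (A * f y `^ p)%:E)).
  apply: int_le => //; [| |by move=> y _; apply: integral_ge0 => x _; rewrite lee_fin|].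
  - have mPs : measurable_fun setT (fun z : R * R => (Phi (z.2, z.1))%:E).
      apply/measurable_EFinP; apply: (measurableT_comp mPhi).
      by apply/measurable_fun_pairP; split => /=; [exact: measurable_snd|exact: measurable_fst].
    by apply: (measurable_integral_snd mRpos mPs) => z; rewrite lee_fin.
  - by mfun.
  - by move=> y /RposP y0; exact: h2.
rewrite int_scaleR//; [|by mfun|by move=> y _; exact: powR_ge0].
by rewrite -[leRHS]mule1 lee_wpmul2l.
Qed.

(** The three-term Hoelder inequality at a single point, with the exponents
    a, b, c adding up to 1. *)
Lemma powR3_le_sum (u v w a b c : R) : (0 <= u)%R -> (0 <= v)%R -> (0 <= w)%R ->
  (0 <= a)%R -> (0 <= b)%R -> (0 <= c)%R -> (a + b + c = 1)%R ->
  (u `^ a * v `^ b * w `^ c <= u + v + w)%R.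
Proof.
move=> u0 v0 w0 a0 b0 c0 abc; pose M := (u + v + w)%R.
have uM : (u <= M)%R by rewrite /M; lra.
have vM : (v <= M)%R by rewrite /M; lra.
have wM : (w <= M)%R by rewrite /M; lra.
have M0 : (0 <= M)%R by lra.
have h (t r : R) : (0 <= t)%R -> (t <= M)%R -> (0 <= r)%R -> (t `^ r <= M `^ r)%R.
  by move=> t0 tM r0; apply: ge0_ler_powR; rewrite ?nnegrE.
rewrite -/M; have [Mz|Mz] := eqVneq M 0%R.
  have -> : u = 0%R by lra.
  have -> : v = 0%R by lra.
  have -> : w = 0%R by lra.
  rewrite Mz; have z r : (0 `^ r = (r == 0%R)%:R :> R)%R.
    by have [->|?] := eqVneq r 0%R; [rewrite powRr0|rewrite powR0].
  rewrite !z; case: eqP => [a_|_]; last by rewrite !mul0r.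
  case: eqP => [b_|_]; last by rewrite mulr0 mul0r.
  by case: eqP => [c_|_]; [move: abc; rewrite a_ b_ c_; lra|rewrite mulr0].
have Mp : (0 < M)%R by rewrite lt_neqAle eq_sym Mz.
apply: (@le_trans _ _ (M `^ a * M `^ b * M `^ c)%R).
  by rewrite ler_pM ?mulr_ge0 ?powR_ge0 ?h// ler_pM ?powR_ge0 ?h.
by rewrite -!gt0_powRD// abc powRr1.
Qed.

(** Schur's test for p <= q: the kernel is split as
    a^(1/q) b^(1-1/p), with b integrable in y and a integrable in x. With
    f = f^(p/q) f^(p (1/p-1/q)), Hoelder's inequality with the three exponents
    1/q, 1 - 1/p and 1/p - 1/q gives the pointwise bound; here it appears
    as [powR3_le_sum] for the normalized function a f^p / s. *)
Lemma schur (p q A B : R) (k a b : R * R -> R) : (1 <= p)%R -> (p <= q)%R -> (0 <= A)%R -> (0 <= B)%R ->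
  measurable_fun setT k -> measurable_fun setT a -> measurable_fun setT b ->
  (forall z, 0 <= k z)%R -> (forall z, 0 <= a z)%R -> (forall z, 0 <= b z)%R ->
  (forall x y, 0 < x -> 0 < y -> k (x, y) <= a (x, y) `^ q^-1 * b (x, y) `^ (1 - p^-1))%R ->
  (forall x, (0 < x)%R -> \int[mu]_(y in @Rpos R) (b (x, y))%:E <= B%:E) ->
  (forall y, (0 < y)%R -> \int[mu]_(x in @Rpos R) (a (x, y))%:E <= A%:E) ->
  strong p q (EFin \o k).
Proof.
move=> p1 pq A0 B0 mk ma mb k0 a0 b0 kab hB hA.
have p0 : (0 < p)%R by lra.
have q0 : (0 < q)%R by lra.
have mRpos := @measurable_Rpos R.
have M0 : (0 < 2 + B)%R by lra.
have mkE : measurable_fun setT (EFin \o k) by mfun.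
have k0E z : 0 <= (EFin \o k) z by rewrite lee_fin.
apply: (strong_of_pointwise q0 M0 A0 mkE k0E).
move=> f mf f0 f1; exists (fun z => a z * f z.2 `^ p)%R; split.
- by mfun.
- by move=> z; rewrite mulr_ge0 ?powR_ge0.
- move=> x s x0 hs.
  have ms : measurable_fun setT (fun y => (a (x, y) * f y `^ p)%R).
    by apply: measurable_funM; [apply: (measurableT_comp ma); exact: pair1_measurable|mfun].
  have mb1 : measurable_fun setT (fun y => b (x, y)) by apply: (measurableT_comp mb); exact: pair1_measurable.
  have mk1 : measurable_fun setT (fun y => k (x, y)) by apply: (measurableT_comp mk); exact: pair1_measurable.
  (* s is a strict upper bound of a nonnegative integral, hence positive *)
  have s0 : (0 < s)%R.
    rewrite -lte_fin; apply: le_lt_trans hs; apply: integral_ge0 => y _.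
    by rewrite lee_fin mulr_ge0 ?powR_ge0.
  apply: (@le_trans _ _ (\int[mu]_(y in @Rpos R) (s `^ q^-1 *
      (s^-1 * (a (x, y) * f y `^ p) + b (x, y) + f y `^ p))%:E)).
    apply: int_le => //; [by rewrite /=; mfun|by mfun|by move=> y _; rewrite mule_ge0 ?lee_fin|].
    move=> y /RposP y0; rewrite /= -EFinM lee_fin.
    have u0 : (0 <= s^-1 * (a (x, y) * f y `^ p))%R.
      by rewrite mulr_ge0 ?invr_ge0 ?(ltW s0)// mulr_ge0 ?powR_ge0.
    have c1 : (0 <= q^-1)%R by rewrite invr_ge0 ltW.
    have c2 : (0 <= 1 - p^-1)%R by rewrite subr_ge0 invf_le1.
    have c3 : (0 <= p^-1 - q^-1)%R by rewrite subr_ge0 lef_pV2 ?posrE.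
    have c4 : (q^-1 + (1 - p^-1) + (p^-1 - q^-1) = 1)%R by lra.
    have H3 := powR3_le_sum u0 (b0 (x, y)) (powR_ge0 (f y) p) c1 c2 c3 c4.
    rewrite -(ler_pM2l (powR_gt0 q^-1 s0)) in H3; apply: le_trans H3.
    apply: (@le_trans _ _ (a (x, y) `^ q^-1 * b (x, y) `^ (1 - p^-1) * f y)%R).
      by rewrite ler_wpM2r// kab.
    rewrite le_eqVlt; apply/orP; left; apply/eqP.
    rewrite powRM ?invr_ge0 ?(ltW s0) ?mulr_ge0 ?powR_ge0// powRM ?powR_ge0//.
    rewrite -(powR_inv1 (ltW s0)) -!powRrM mulN1r powRN.
    have sq : (s `^ q^-1 != 0)%R by rewrite gt_eqF// powR_gt0.
    have fE : f y = (f y `^ (p * q^-1) * f y `^ (p * (p^-1 - q^-1)))%R.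
      have [fz|fz] := eqVneq (f y) 0%R.
        rewrite fz powR0 ?mul0r//; by rewrite mulf_neq0 ?invr_eq0 ?gt_eqF.
      have fp : (0 < f y)%R by rewrite lt_neqAle eq_sym fz f0.
      by rewrite -gt0_powRD// -mulrDr addrC subrK mulfV ?gt_eqF// powRr1.
    by rewrite [in LHS]fE; field.
  rewrite int_scaleR//; [|by mfun|exact: powR_ge0|]; last first.
    by move=> y _; rewrite !addr_ge0 ?powR_ge0// mulr_ge0 ?invr_ge0 ?(ltW s0)// mulr_ge0 ?powR_ge0.
  rewrite mulrC EFinM lee_pmul2l ?lte_fin ?powR_gt0//.
  under eq_integral do rewrite EFinD EFinD.
  rewrite int_add//; [|by mfun|by mfun| |by move=> y _; rewrite lee_fin powR_ge0]; last first.
    by move=> y _; rewrite -EFinD lee_fin addr_ge0// mulr_ge0 ?invr_ge0 ?(ltW s0)// mulr_ge0 ?powR_ge0.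
  rewrite int_add//; [|by mfun|by mfun| |by move=> y _; rewrite lee_fin]; last first.
    by move=> y _; rewrite lee_fin mulr_ge0 ?invr_ge0 ?(ltW s0)// mulr_ge0 ?powR_ge0.
  rewrite int_scaleR//; [|by rewrite invr_ge0 ltW|by move=> y _; rewrite mulr_ge0 ?powR_ge0].
  rewrite (_ : (2 + B)%:E = 1 + B%:E + 1); last by rewrite -!EFinD; congr EFin; lra.
  rewrite leeD ?leeD ?hB//.
  by rewrite -lee_pdivlMl ?invr_gt0// invrK mule1 ltW.
- move=> y y0 /=; have ma1 : measurable_fun setT (fun x => a (x, y)).
    by apply: (measurableT_comp ma); exact: pair2_measurable.
  under eq_integral do rewrite mulrC.
  rewrite int_scaleR//; [|exact: powR_ge0].
  by rewrite mulrC EFinM lee_wpmul2l ?lee_fin ?powR_ge0// hA.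
Qed.

End Operators.

(** * Young and Hardy inequalities *)

Section Kernels.
Variable R : realType.
Notation mu := (@lebesgue_measure R).
Implicit Types (f : R -> R) (x y u r a b : R).

(** Every radial kernel below is a power on [0, r] and another power beyond r. *)
Definition twoPow c1 a c2 b r u : R :=
  if u <= r then c1 * u `^ (a - 1) else c2 * u `^ (- b - 1).

Lemma twoPow_ge0 c1 a c2 b r u : 0 <= c1 -> 0 <= c2 -> 0 <= twoPow c1 a c2 b r u.
Proof. by move=> c10 c20; rewrite /twoPow; case: ifP => _; rewrite mulr_ge0 ?powR_ge0. Qed.

Lemma measurable_twoPow c1 a c2 b r : measurable_fun setT (twoPow c1 a c2 b r).
Proof. by rewrite /twoPow; apply: measurable_fun_ifT; [apply: measurable_fun_ler; mfun|mfun|mfun]. Qed.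

Lemma integral_twoPow c1 a c2 b r : 0 <= c1 -> 0 <= c2 -> 0 < a -> 0 < b -> 0 < r ->
  (\int[mu]_(u in @Rpos R) (twoPow c1 a c2 b r u)%:E <=
   (c1 * r `^ a / a + c2 * r `^ (- b) / b)%:E)%E.
Proof.
move=> c10 c20 a0 b0 r0.
have m1 : measurable (`]0, r]%classic : set R) by exact: measurable_itv.
have m2 : measurable (`]r, +oo[%classic : set R) by exact: measurable_itv.
have m3 : measurable (`[r, +oo[%classic : set R) by exact: measurable_itv.
have mT := measurable_twoPow c1 a c2 b r.
have mTE : measurable_fun setT (fun u : R => (twoPow c1 a c2 b r u)%:E) by mfun.
rewrite (integral_Rpos_split r0 mTE); last by move=> t; rewrite lee_fin twoPow_ge0.
rewrite EFinD leeD//.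
  apply: (@le_trans _ _ (\int[mu]_(t in `]0%R, r]) (c1 * t `^ (a - 1))%:E)%E).
    apply: int_le => //; [by mfun|by move=> t _; rewrite lee_fin twoPow_ge0|].
    by move=> t; rewrite /= in_itv/= => /andP[t0 tr]; rewrite lee_fin /twoPow tr.
  rewrite int_scaleR//; [|by move=> t _; exact: powR_ge0].
  by rewrite integral_powR_near0// -EFinM mulrA.
apply: (@le_trans _ _ (\int[mu]_(t in `[r, +oo[) (c2 * t `^ (- b - 1))%:E)%E).
  apply: (@le_trans _ _ (\int[mu]_(t in `]r, +oo[) (c2 * t `^ (- b - 1))%:E)%E).
    apply: int_le => //; [by mfun|by move=> t _; rewrite lee_fin twoPow_ge0|].
    by move=> t; rewrite /= in_itv/= andbT => t0; rewrite lee_fin /twoPow (leNgt t r) t0.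
  apply: int_sub => //; [by mfun|by move=> t _; rewrite lee_fin mulr_ge0 ?powR_ge0|].
  by move=> t; rewrite /= !in_itv/= !andbT => /ltW.
rewrite int_scaleR//; [|by move=> t _; exact: powR_ge0].
by rewrite integral_powR_infty// -EFinM mulrA.
Qed.

Lemma integral_dist_twoPow (D : set R) x c1 a c2 b r : measurable D ->
  0 <= c1 -> 0 <= c2 -> 0 < a -> 0 < b -> 0 < r ->
  (\int[mu]_(y in D) (twoPow c1 a c2 b r `|x - y|)%:E <=
   (2 * (c1 * r `^ a / a + c2 * r `^ (- b) / b))%:E)%E.
Proof.
move=> mD c10 c20 a0 b0 r0.
apply: le_trans (integral_dist_le x mD (measurable_twoPow c1 a c2 b r) _) _.
  by move=> u; exact: twoPow_ge0.
by rewrite EFinM lee_wpmul2l// integral_twoPow.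
Qed.

Lemma localG_powR delta r u : 0 < u ->
  localG delta u `^ r = twoPow 1 ((delta - 1) * r + 1) 1 (2 * r - 1) 1 u.
Proof.
move=> u0; rewrite /localG /twoPow; case: ifP => _; rewrite mul1r -powRrM; congr (_ `^ _); ring.
Qed.

Lemma localG0 delta : delta < 1 -> localG delta 0 = 0 :> R.
Proof. by move=> d1; rewrite /localG ler01 powR0// lt_eqF// subr_lt0. Qed.

Lemma integral_localG (D : set R) delta r : measurable D ->
  0 < delta -> delta < 1 -> 1 <= r -> 0 < (delta - 1) * r + 1 ->
  exists2 B : R, 0 <= B & forall x, (\int[mu]_(y in D) (localG delta `|x - y| `^ r)%:E <= B%:E)%E.
Proof.
move=> mD d0 d1 r1 a0; have b0 : 0 < 2 * r - 1 by lra.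
exists (2 * (1 * 1 `^ ((delta - 1) * r + 1) / ((delta - 1) * r + 1) + 1 * 1 `^ (- (2 * r - 1)) / (2 * r - 1))).
  by rewrite mulr_ge0// addr_ge0// divr_ge0 ?mulr_ge0 ?powR_ge0 ?(ltW a0) ?(ltW b0).
move=> x; apply: le_trans (integral_dist_twoPow x mD ler01 ler01 a0 b0 ltr01).
have mT := measurable_twoPow 1 ((delta - 1) * r + 1) 1 (2 * r - 1) 1.
have mG := @measurable_localG R delta.
apply: int_le => //; [by mfun|by mfun|by move=> y _; rewrite lee_fin powR_ge0|].
move=> y _; rewrite lee_fin; have [xy|xy] := eqVneq (x - y) 0.
  by rewrite xy normr0 localG0// powR0 ?twoPow_ge0// gt_eqF//; lra.
by rewrite localG_powR ?normr_gt0.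
Qed.

Definition distK (g : R -> R) (z : R * R) : R := g `|z.1 - z.2|.

Lemma measurable_distK (g : R -> R) : measurable_fun setT g -> measurable_fun setT (distK g).
Proof. by move=> mg; rewrite /distK; mfun. Qed.

(** Young's inequality is the case a = b = k^r of Schur's test, where
    1/r = 1 - (1/p - 1/q); k^r is integrable because 1/p - 1/q < delta. *)
Lemma young_localG (p q delta : R) : 1 <= p -> p <= q -> 0 < delta -> delta < 1 ->
  p^-1 - q^-1 < delta -> strong p q (EFin \o distK (localG delta)).
Proof.
move=> p1 pq d0 d1 dd; have p0 : 0 < p by lra.
have q0 : 0 < q by lra.
have pi : p^-1 <= 1 by rewrite invf_le1.
have qi : 0 < q^-1 by rewrite invr_gt0.
have pqi : q^-1 <= p^-1 by rewrite lef_pV2 ?posrE.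
pose r := (1 - (p^-1 - q^-1))^-1.
have r0 : 0 < 1 - (p^-1 - q^-1) by lra.
have r1 : 1 <= r by rewrite /r -[leLHS]invr1 lef_pV2 ?posrE//; lra.
have e0 : 0 < (delta - 1) * r + 1.
  rewrite -(ltr_pM2r r0) mul0r mulrDl -mulrA /r mulVf ?gt_eqF//; lra.
have [B B0 hB] := integral_localG (@measurable_Rpos R) d0 d1 r1 e0.
have mG := @measurable_localG R delta.
have mK := measurable_distK mG.
apply: (@schur R p q B B (distK (localG delta)) (fun z => distK (localG delta) z `^ r)
   (fun z => distK (localG delta) z `^ r)) => //; try by mfun.
- by move=> z; exact: localG_ge0.
- by move=> z; exact: powR_ge0.
- by move=> z; exact: powR_ge0.
- move=> x y _ _; rewrite -!powRrM; set w := distK _ _.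
  have [->|wn] := eqVneq w 0; first by rewrite mulr_ge0 ?powR_ge0.
  have w0 : 0 < w by rewrite lt_neqAle eq_sym wn localG_ge0.
  rewrite -gt0_powRD// -mulrDr (_ : q^-1 + (1 - p^-1) = 1 - (p^-1 - q^-1)); last by lra.
  by rewrite /r mulVf ?gt_eqF// powRr1 ?lexx ?(ltW w0).
- by move=> x _; exact: hB.
- by move=> y _; rewrite /distK /=; under eq_integral do rewrite distrC; exact: hB.
Qed.

(** Schur's test with the weights b = x^(th-1) y^(-th) and
    a = y^b' x^(-b'-1). Homogeneity fixes b', and th has to lie strictly between
    g/(1-1/p) and 1; this is where g < 1 - 1/p enters. *)
Lemma strong_hardyL (p q g : R) : 1 < p -> p <= q -> 0 <= g -> g < 1 - p^-1 ->
  strong p q (EFin \o (fun z => hardyL (p^-1 - q^-1) g z.1 z.2)).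
Proof.
move=> p1 pq g0 gp; have p0 : 0 < p by lra.
have q0 : 0 < q by lra.
have P1 : p^-1 < 1 by rewrite invf_lt1.
have P0 : 0 < p^-1 by rewrite invr_gt0.
have Q0 : 0 < q^-1 by rewrite invr_gt0.
pose c : R := 1 - p^-1; have c0 : 0 < c by rewrite /c; lra.
pose th := (g / c + 1) / 2.
have gc1 : g / c < 1 by rewrite ltr_pdivrMr// mul1r.
have gc0 : 0 <= g / c by rewrite divr_ge0// ltW.
have th1 : th < 1 by rewrite /th; lra.
have th0 : 0 < th by rewrite /th; lra.
have thg : g < th * c by rewrite -ltr_pdivrMr// /th; lra.
pose b' := q * (th * c - g).
have b'0 : 0 < b' by rewrite mulr_gt0// subr_gt0.
pose k (z : R * R) := hardyL (p^-1 - q^-1) g z.1 z.2.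
pose a (z : R * R) := if z.2 < z.1 then z.2 `^ b' * z.1 `^ (- b' - 1) else 0.
pose b (z : R * R) := if z.2 < z.1 then z.1 `^ (th - 1) * z.2 `^ (1 - th - 1) else 0.
have iq : 0 <= b'^-1 by rewrite invr_ge0 ltW.
have it : 0 <= (1 - th)^-1 by rewrite invr_ge0; lra.
apply: (@schur R p q b'^-1 (1 - th)^-1 k a b) => //; try exact: ltW.
- by rewrite /k /hardyL; mfun.
- by rewrite /a; mfun.
- by rewrite /b; mfun.
- by move=> z; exact: hardyL_ge0.
- by move=> z; rewrite /a; case: ifP => // _; rewrite mulr_ge0 ?powR_ge0.
- by move=> z; rewrite /b; case: ifP => // _; rewrite mulr_ge0 ?powR_ge0.
- move=> x y x0 y0; rewrite /k /hardyL /a /b /=; case: ifP => [yx|_]; last first.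
    by rewrite mulr_ge0 ?powR_ge0.
  rewrite !powRM ?powR_ge0// -!powRrM -/c.
  rewrite [X in _ <= X](_ : _ = (x `^ ((- b' - 1) * q^-1) * x `^ ((th - 1) * c)) *
     (y `^ (b' * q^-1) * y `^ ((1 - th - 1) * c))); last by ring.
  rewrite -!gt0_powRD// le_eqVlt; apply/orP; left; apply/eqP.
  have bq : b' * q^-1 = th * c - g by rewrite /b' mulrAC mulfV ?gt_eqF// mul1r.
  congr (_ `^ _ * _ `^ _); last by rewrite bq; ring.
  by rewrite mulrBl mulNr bq /c; ring.
- move=> x x0.
  apply: (@le_trans _ _ (\int[mu]_(y in `]0%R, x]) (x `^ (th - 1) * y `^ (1 - th - 1))%:E)%E).
    rewrite /b /= (@integral_if R _ (`]0, x[%classic) (fun y => y < x)); last 2 first.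
    - by move=> y; rewrite /= in_itv/= => /andP[? _]; exact/RposP.
    - by move=> y /RposP y0; rewrite /= in_itv/= y0.
    apply: int_sub => //; [by mfun|by move=> y _; rewrite lee_fin mulr_ge0 ?powR_ge0|].
    by move=> y; rewrite /= !in_itv/= => /andP[-> /ltW].
  rewrite int_scaleR//; [|exact: powR_ge0|by move=> y _; exact: powR_ge0].
  rewrite integral_powR_near0//; last by lra.
  rewrite -EFinM lee_fin mulrA -gt0_powRD// (_ : th - 1 + (1 - th) = 0); last by ring.
  by rewrite powRr0 mul1r.
- move=> y y0.
  apply: (@le_trans _ _ (\int[mu]_(x in `[y, +oo[) (y `^ b' * x `^ (- b' - 1))%:E)%E).
    rewrite /a /= (@integral_if R _ (`]y, +oo[%classic) (fun x => y < x)); last 2 first.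
    - by move=> x; rewrite /= in_itv/= andbT => ?; apply/RposP; exact: lt_trans y0 _.
    - by move=> x /RposP x0; rewrite /= in_itv/= andbT.
    apply: int_sub => //; [by mfun|by move=> x _; rewrite lee_fin mulr_ge0 ?powR_ge0|].
    by move=> x; rewrite /= !in_itv/= !andbT => /ltW.
  rewrite int_scaleR//; [|exact: powR_ge0|by move=> x _; exact: powR_ge0].
  rewrite integral_powR_infty// -EFinM lee_fin mulrA -gt0_powRD// subrr.
  by rewrite powRr0 mul1r.
Qed.

(** The mirror image of [strong_hardyL]: now b = x^e y^(-e-1) with a small e > 0,
    and the room for e is the gap between g and 1/q. *)
Lemma strong_hardyR (p q g : R) : 1 < p -> p <= q -> 0 <= g -> g < q^-1 ->
  strong p q (EFin \o (fun z => hardyR (p^-1 - q^-1) g z.1 z.2)).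
Proof.
move=> p1 pq g0 gq; have p0 : 0 < p by lra.
have q0 : 0 < q by lra.
have P1 : p^-1 < 1 by rewrite invf_lt1.
have P0 : 0 < p^-1 by rewrite invr_gt0.
have Q0 : 0 < q^-1 by rewrite invr_gt0.
pose c : R := 1 - p^-1; have c0 : 0 < c by rewrite /c; lra.
pose e := (q^-1 - g) / c / 2.
have e0 : 0 < e by rewrite !divr_gt0// subr_gt0.
have ec : g + e * c < q^-1.
  have -> : e * c = (q^-1 - g) / 2 by rewrite /e mulrAC divfK// gt_eqF.
  by lra.
pose b' := 1 - q * (g + e * c).
have b'0 : 0 < b' by rewrite /b' subr_gt0 -ltr_pdivlMl// mulr1.
pose k (z : R * R) := hardyR (p^-1 - q^-1) g z.1 z.2.
pose a (z : R * R) := if z.1 < z.2 then z.2 `^ (- b') * z.1 `^ (b' - 1) else 0.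
pose b (z : R * R) := if z.1 < z.2 then z.1 `^ e * z.2 `^ (- e - 1) else 0.
have iq : 0 <= b'^-1 by rewrite invr_ge0 ltW.
have ie : 0 <= e^-1 by rewrite invr_ge0 ltW.
apply: (@schur R p q b'^-1 e^-1 k a b) => //; try exact: ltW.
- by rewrite /k /hardyR; mfun.
- by rewrite /a; mfun.
- by rewrite /b; mfun.
- by move=> z; exact: hardyR_ge0.
- by move=> z; rewrite /a; case: ifP => // _; rewrite mulr_ge0 ?powR_ge0.
- by move=> z; rewrite /b; case: ifP => // _; rewrite mulr_ge0 ?powR_ge0.
- move=> x y x0 y0; rewrite /k /hardyR /a /b /=; case: ifP => [yx|_]; last first.
    by rewrite mulr_ge0 ?powR_ge0.
  rewrite !powRM ?powR_ge0// -!powRrM -/c.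
  rewrite [X in _ <= X](_ : _ = (x `^ ((b' - 1) * q^-1) * x `^ (e * c)) *
     (y `^ (- b' * q^-1) * y `^ ((- e - 1) * c))); last by ring.
  rewrite -!gt0_powRD// le_eqVlt; apply/orP; left; apply/eqP.
  have bq : (b' - 1) * q^-1 = - (g + e * c).
    rewrite (_ : b' - 1 = - (g + e * c) * q); last by rewrite /b'; ring.
    by rewrite -mulrA mulfV ?gt_eqF// mulr1.
  congr (_ `^ _ * _ `^ _); first by rewrite bq; ring.
  have -> : - b' * q^-1 = - ((b' - 1) * q^-1) - q^-1 by ring.
  by rewrite bq /c; ring.
- move=> x x0.
  apply: (@le_trans _ _ (\int[mu]_(y in `[x, +oo[) (x `^ e * y `^ (- e - 1))%:E)%E).
    rewrite /b /= (@integral_if R _ (`]x, +oo[%classic) (fun y => x < y)); last 2 first.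
    - by move=> y; rewrite /= in_itv/= andbT => ?; apply/RposP; exact: lt_trans x0 _.
    - by move=> y /RposP y0; rewrite /= in_itv/= andbT.
    apply: int_sub => //; [by mfun|by move=> y _; rewrite lee_fin mulr_ge0 ?powR_ge0|].
    by move=> y; rewrite /= !in_itv/= !andbT => /ltW.
  rewrite int_scaleR//; [|exact: powR_ge0|by move=> y _; exact: powR_ge0].
  rewrite integral_powR_infty// -EFinM lee_fin mulrA -gt0_powRD// subrr.
  by rewrite powRr0 mul1r.
- move=> y y0.
  apply: (@le_trans _ _ (\int[mu]_(x in `]0%R, y]) (y `^ (- b') * x `^ (b' - 1))%:E)%E).
    rewrite /a /= (@integral_if R _ (`]0, y[%classic) (fun x => x < y)); last 2 first.
    - by move=> x; rewrite /= in_itv/= => /andP[? _]; exact/RposP.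
    - by move=> x /RposP x0; rewrite /= in_itv/= x0.
    apply: int_sub => //; [by mfun|by move=> x _; rewrite lee_fin mulr_ge0 ?powR_ge0|].
    by move=> x; rewrite /= !in_itv/= => /andP[-> /ltW].
  rewrite int_scaleR//; [|exact: powR_ge0|by move=> x _; exact: powR_ge0].
  rewrite integral_powR_near0//.
  rewrite -EFinM lee_fin mulrA -gt0_powRD// addNr.
  by rewrite powRr0 mul1r.
Qed.

End Kernels.

(** * The Hardy-Littlewood-Sobolev inequality *)

Section HLS.
Variable R : realType.
Notation mu := (@lebesgue_measure R).
Implicit Types (f : R -> R) (x y : R).

Definition rieszK (delta : R) : R * R -> R := distK (fun u => u `^ (delta - 1)).

(** The first competitor is the smaller one at large distances u, the second one
    at small values w of the function. *)
Definition hlsMin (p q : R) (u w : R) : R :=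
  if u `^ (- q^-1) <= w `^ (p / q) then u `^ (- q^-1) else w `^ (p / q).

(** Its integral in y dominates the q-th power of the fractional integral, as
    [hls_row] shows, while its integral in x is a multiple of f(y)^p. *)
Definition hlsPhi (p q delta : R) f (z : R * R) : R :=
  rieszK delta z * f z.2 * hlsMin p q `|z.1 - z.2| (f z.2) `^ (q - 1).

Lemma measurable_rieszK delta : measurable_fun setT (rieszK delta).
Proof. by rewrite /rieszK /distK; mfun. Qed.

Lemma measurable_hlsPhi p q delta f : measurable_fun setT f ->
  measurable_fun setT (hlsPhi p q delta f).
Proof.
move=> mf; rewrite /hlsPhi; apply: measurable_funM.
  by apply: measurable_funM; [exact: measurable_rieszK|mfun].
by rewrite /hlsMin; mfun.
Qed.

Lemma rieszK_ge0 delta z : 0 <= rieszK delta z.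
Proof. exact: powR_ge0. Qed.

Lemma hlsPhi_ge0 p q delta f z : (forall y, 0 <= f y) -> 0 <= hlsPhi p q delta f z.
Proof. by move=> f0; rewrite mulr_ge0 ?powR_ge0// mulr_ge0 ?rieszK_ge0. Qed.

Lemma hlsMin_gt0 p q u w : 0 < u -> 0 < w -> 0 < hlsMin p q u w.
Proof. by move=> u0 w0; rewrite /hlsMin; case: ifP => _; exact: powR_gt0. Qed.

(** The minimum in [hlsMin] switches at |x-y| = f(y)^(-p); the nearer part is
    integrable because delta > 0 and the farther part because p > 1. *)
Lemma hls_column (p q delta : R) f : 1 < p -> p < q -> delta = p^-1 - q^-1 ->
  measurable_fun setT f -> (forall y, 0 <= f y) -> forall y,
  (\int[mu]_(x in @Rpos R) (hlsPhi p q delta f (x, y))%:E <=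
   (2 * (delta^-1 + (1 - p^-1)^-1) * f y `^ p)%:E)%E.
Proof.
move=> p1 pq dE mf f0 y.
have p0 : 0 < p by lra.
have q0 : 0 < q by lra.
have P1 : p^-1 < 1 by rewrite invf_lt1.
have th0 : 0 < 1 - p^-1 by lra.
have d0 : 0 < delta by rewrite dE subr_gt0 ltf_pV2.
have Q0 : 0 < q^-1 by rewrite invr_gt0.
have d1 : delta < 1 by lra.
have mPhi := measurable_hlsPhi p q delta mf.
have mPhi1 : measurable_fun setT (fun x => hlsPhi p q delta f (x, y)).
  by apply: (measurableT_comp mPhi); exact: pair2_measurable.
have [fz|fz] := eqVneq (f y) 0.
  under eq_integral do rewrite /hlsPhi /= fz mulr0 mul0r.
  by rewrite integral0 lee_fin mulr_ge0 ?powR_ge0// mulr_ge0// addr_ge0// invr_ge0 ltW.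
have fy : 0 < f y by rewrite lt_neqAle eq_sym fz f0.
pose F := (f y `^ (p / q)) `^ (q - 1).
pose rho := f y `^ (- p).
have rho0 : 0 < rho by exact: powR_gt0.
have F0 : 0 <= F by exact: powR_ge0.
pose g := twoPow F delta 1 (1 - p^-1) rho.
have mg : measurable_fun setT g by exact: measurable_twoPow.
have g0 u : 0 <= g u by exact: twoPow_ge0.
apply: (@le_trans _ _ (\int[mu]_(x in @Rpos R) (f y * g `|y - x|)%:E)%E).
  apply: int_le; [exact: measurable_Rpos|by mfun|by mfun|by move=> x _; rewrite lee_fin hlsPhi_ge0|].
  move=> x _; rewrite lee_fin /hlsPhi /rieszK /distK /= [leLHS](_ : _ = f y * (`|x - y| `^ (delta - 1) *
    hlsMin p q `|x - y| (f y) `^ (q - 1))); last by ring.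
  rewrite ler_pM2l// (distrC y x).
  have [->|] := eqVneq `|x - y| 0; first by rewrite powR0 ?mul0r// lt_eqF// subr_lt0.
  move=> uN; have u0 : 0 < `|x - y| by rewrite lt_neqAle eq_sym uN normr_ge0.
  have [u uE] : exists u : R, `|x - y| = u by exists `|x - y|.
  rewrite uE in u0 *; clear uE uN.
  have hm0 := ltW (hlsMin_gt0 p q u0 fy).
  have q1 : 0 <= q - 1 by lra.
  rewrite /g /twoPow; case: ifPn => ur.
    rewrite mulrC ler_wpM2r ?powR_ge0// /F; apply: ge0_ler_powR; rewrite ?nnegrE ?powR_ge0//.
    by rewrite /hlsMin; case: ifP.
  rewrite mul1r (_ : - (1 - p^-1) - 1 = (delta - 1) + - q^-1 * (q - 1)); last first.
    by rewrite dE; field; rewrite !gt_eqF.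
  rewrite (gt0_powRD (delta - 1) (- q^-1 * (q - 1)) u0).
  rewrite (powRrM u (- q^-1) (q - 1)).
  apply: ler_wpM2l; first exact: powR_ge0.
  apply: ge0_ler_powR; rewrite ?nnegrE ?powR_ge0//.
  by rewrite /hlsMin; case: ifPn => //; rewrite -ltNge => /ltW.
rewrite int_scaleR//; [|exact: measurable_Rpos|by mfun].
apply: (@le_trans _ _ ((f y)%:E * (2 * (F * rho `^ delta / delta + 1 * rho `^ (- (1 - p^-1)) / (1 - p^-1)))%:E)%E).
  rewrite lee_pmul2l//; apply: integral_dist_twoPow => //; exact: measurable_Rpos.
rewrite -EFinM lee_fin.
have E1 : F * rho `^ delta = f y `^ (p - 1).
  rewrite /F /rho -!powRrM -gt0_powRD//; congr (_ `^ _).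
  by rewrite dE; field; rewrite !gt_eqF.
have E2 : rho `^ (- (1 - p^-1)) = f y `^ (p - 1).
  by rewrite /rho -powRrM; congr (_ `^ _); field; rewrite !gt_eqF.
rewrite E1 E2 mul1r.
have E3 : f y `^ p = f y * f y `^ (p - 1) by rewrite mulr_powRB1// ltW.
by rewrite E3 le_eqVlt; apply/orP; left; apply/eqP; ring.
Qed.

(** The integral defining the potential is cut at distance r = lam^(-q) and height
    h = lam^(q/p). The far part is at most a multiple of lam by Hoelder's
    inequality, the near part with f <= h by direct integration. If the whole
    exceeds 2 c lam, the near part with f > h is at least c lam; there [hlsMin]
    is at least lam, so the integral of [hlsPhi] is at least c lam^q. *)
Lemma hls_row (p q delta c lam s : R) f x : 1 < p -> p < q -> delta = p^-1 - q^-1 ->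
  c = 2 * (q * (1 - p^-1)) + 1 + 2 / delta ->
  measurable_fun setT f -> (forall y, 0 <= f y) ->
  (\int[mu]_(y in @Rpos R) (f y `^ p)%:E <= 1)%E ->
  0 < lam -> s = c * lam `^ q ->
  (\int[mu]_(y in @Rpos R) (hlsPhi p q delta f (x, y))%:E < s%:E)%E ->
  (opT (EFin \o rieszK delta) f x <= (2 * c * lam)%:E)%E.
Proof.
move=> p1 pq dE cE mf f0 f1 lam0 sE hs.
have p0 : 0 < p by lra.
have q0 : 0 < q by lra.
have P1 : p^-1 < 1 by rewrite invf_lt1.
have Q0 : 0 < q^-1 by rewrite invr_gt0.
have d0 : 0 < delta by rewrite dE subr_gt0 ltf_pV2.
pose th : R := 1 - p^-1; have th0 : 0 < th by rewrite /th; lra.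
(* the exponent b makes (|x-y|^(-b-1))^th equal to |x-y|^(delta-1) *)
pose b := (q * th)^-1; have b0 : 0 < b by rewrite invr_gt0 mulr_gt0.
pose r := lam `^ (- q); have r0 : 0 < r by exact: powR_gt0.
pose h := lam `^ (q / p); have h0 : 0 < h by exact: powR_gt0.
pose k y := `|x - y| `^ (delta - 1).
pose F1 y := if r < `|x - y| then k y * f y else 0.
pose F2 y := if (`|x - y| <= r) && (f y <= h) then k y * f y else 0.
pose F3 y := if (`|x - y| <= r) && (h < f y) then k y * f y else 0.
have mk : measurable_fun setT k by rewrite /k; mfun.
have mF1 : measurable_fun setT F1 by rewrite /F1; mfun.
have mF2 : measurable_fun setT F2.
  rewrite /F2; apply: measurable_fun_ifT; [|by mfun|by mfun].
  by apply: measurable_and; apply: measurable_fun_ler; mfun.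
have mF3 : measurable_fun setT F3.
  rewrite /F3; apply: measurable_fun_ifT; [|by mfun|by mfun].
  by apply: measurable_and; [apply: measurable_fun_ler; mfun|apply: measurable_fun_ltr; mfun].
have kf0 y : 0 <= k y * f y by rewrite mulr_ge0 ?powR_ge0.
have F10 y : 0 <= F1 y by rewrite /F1; case: ifP.
have F20 y : 0 <= F2 y by rewrite /F2; case: ifP.
have F30 y : 0 <= F3 y by rewrite /F3; case: ifP.
have mRpos := @measurable_Rpos R.
have TE : opT (EFin \o rieszK delta) f x =
  (\int[mu]_(y in @Rpos R) (F1 y)%:E + \int[mu]_(y in @Rpos R) (F2 y)%:E +
   \int[mu]_(y in @Rpos R) (F3 y)%:E)%E.
  rewrite -int_add//; [|by mfun|by mfun|by move=> y _; rewrite lee_fin|by move=> y _; rewrite lee_fin].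
  rewrite -int_add//; [|by mfun|by mfun|by move=> y _; rewrite -EFinD lee_fin addr_ge0|by move=> y _; rewrite lee_fin].
  apply: eq_integral => y _; rewrite /= -EFinM -!EFinD; congr EFin.
  rewrite /F1 /F2 /F3 (_ : rieszK delta (x, y) = k y)// ltNge.
  have [_|_] := boolP (`|x - y| <= r); last by rewrite /= !addr0.
  by rewrite /= add0r ltNge; have [_|_] := boolP (f y <= h); rewrite /= ?add0r ?addr0.
have mT1 := measurable_twoPow 0 1 1 b r.
have mT2 := measurable_twoPow 1 delta 0 1 r.
have I1 : (\int[mu]_(y in @Rpos R) (F1 y)%:E <= ((2 * (q * th) + 1) * lam)%:E)%E.
  pose w := lam `^ (- th^-1).
  have w0 : 0 < w by exact: powR_gt0.
  apply: (@le_trans _ _ (\int[mu]_(y in @Rpos R) (lam * (w * twoPow 0 1 1 b r `|x - y| + f y `^ p))%:E)%E).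
    apply: int_le => //; [by mfun|by mfun|by move=> y _; rewrite lee_fin|].
    move=> y _; rewrite lee_fin /F1 /twoPow; case: ifPn => ry; last first.
      rewrite mulr_ge0 ?(ltW lam0)// addr_ge0 ?powR_ge0// mulr_ge0 ?(ltW w0)//.
      by case: ifP => _; rewrite mulr_ge0 ?powR_ge0.
    rewrite (leNgt `|x - y|) ry /= mul1r.
    have D0 : 0 < `|x - y| by exact: lt_trans ry.
    have u0 : 0 <= w * `|x - y| `^ (- b - 1) by rewrite mulr_ge0 ?powR_ge0 ?ltW.
    have t1 : th + p^-1 + 0 = 1 by rewrite /th; lra.
    have pi : 0 <= p^-1 by rewrite invr_ge0 ltW.
    have := powR3_le_sum u0 (powR_ge0 (f y) p) (lexx 0) (ltW th0) pi (lexx 0) t1.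
    rewrite addr0 powRr0 mulr1 => H3.
    rewrite -(ler_pM2l lam0) in H3; apply: le_trans H3.
    rewrite powRM ?powR_ge0 ?(ltW w0)// -!powRrM mulfV ?gt_eqF// powRr1//.
    rewrite (_ : (- b - 1) * th = delta - 1); last first.
      have bth : b * th = q^-1 by rewrite /b invfM divfK// gt_eqF.
      by rewrite mulrBl mulNr bth mul1r dE /th; ring.
    rewrite mulNr mulVf ?gt_eqF// powR_inv1 ?(ltW lam0)//.
    by rewrite -(mulrA lam^-1) (mulrA lam) mulfV ?gt_eqF// mul1r.
  rewrite int_scaleR//; [|by mfun|exact: ltW|by move=> y _; rewrite addr_ge0 ?powR_ge0// mulr_ge0 ?twoPow_ge0// ltW].
  rewrite mulrC EFinM lee_pmul2l//.
  under eq_integral do rewrite EFinD.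
  rewrite int_add//; [|by mfun|by mfun|by move=> y _; rewrite lee_fin mulr_ge0 ?twoPow_ge0// ltW|by move=> y _; rewrite lee_fin powR_ge0].
  rewrite EFinD leeD//.
  rewrite int_scaleR//; [|by mfun|exact: ltW|by move=> y _; exact: twoPow_ge0].
  apply: (@le_trans _ _ (w%:E * (2 * (0 * r `^ 1 / 1 + 1 * r `^ (- b) / b))%:E)%E).
    by rewrite lee_pmul2l//; apply: integral_dist_twoPow.
  rewrite -EFinM lee_fin mul0r mul0r add0r mul1r.
  have -> : r `^ (- b) = w^-1.
    rewrite /r /w -powRrM -powRN; congr (_ `^ _); rewrite /b; field.
    by rewrite !gt_eqF.
  rewrite le_eqVlt; apply/orP; left; apply/eqP; rewrite /b; field.
  by rewrite !gt_eqF// ?mulr_gt0.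
have I2 : (\int[mu]_(y in @Rpos R) (F2 y)%:E <= (2 / delta * lam)%:E)%E.
  apply: (@le_trans _ _ (\int[mu]_(y in @Rpos R) (h * twoPow 1 delta 0 1 r `|x - y|)%:E)%E).
    apply: int_le => //; [by mfun|by mfun|by move=> y _; rewrite lee_fin|].
    move=> y _; rewrite lee_fin /F2 /twoPow; case: ifPn => [/andP[ry fh]|_]; last first.
      rewrite mulr_ge0 ?(ltW h0)//.
      by case: ifP => _; rewrite mulr_ge0 ?powR_ge0.
    by rewrite ry mul1r mulrC ler_wpM2r ?powR_ge0.
  rewrite int_scaleR//; [|by mfun|exact: ltW|by move=> y _; exact: twoPow_ge0].
  apply: (@le_trans _ _ (h%:E * (2 * (1 * r `^ delta / delta + 0 * r `^ (- 1) / 1))%:E)%E).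
    by rewrite lee_pmul2l//; apply: integral_dist_twoPow.
  rewrite -EFinM lee_fin !mul0r addr0 mul1r.
  have -> : r `^ delta = lam / h.
    transitivity (lam `^ (1 + - (q / p))).
      by rewrite /r -powRrM; congr (_ `^ _); rewrite dE; field; rewrite !gt_eqF.
    by rewrite gt0_powRD// powRr1 ?(ltW lam0)// powRN.
  by rewrite le_eqVlt; apply/orP; left; apply/eqP; field; rewrite !gt_eqF.
rewrite leNgt; apply/negP => Tgt.
have I3 : ((c * lam)%:E <= \int[mu]_(y in @Rpos R) (F3 y)%:E)%E.
  rewrite leNgt; apply/negP => I3lt; move: Tgt; rewrite ltNge => /negP; apply.
  rewrite TE; apply: le_trans (leeD (leeD I1 I2) (ltW I3lt)) _.
  by rewrite -!EFinD lee_fin cE /th le_eqVlt; apply/orP; left; apply/eqP; ring.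
move: hs; rewrite ltNge => /negP; apply.
have lq0 : 0 < lam `^ (q - 1) by exact: powR_gt0.
apply: (@le_trans _ _ ((lam `^ (q - 1))%:E * \int[mu]_(y in @Rpos R) (F3 y)%:E)%E).
  apply: (@le_trans _ _ ((lam `^ (q - 1))%:E * (c * lam)%:E)%E); last by rewrite lee_pmul2l.
  by rewrite -EFinM lee_fin sE mulrCA (mulrC _ lam) mulr_powRB1// ltW.
rewrite -int_scaleR//; [|exact: ltW].
have mPhi := measurable_hlsPhi p q delta mf.
have mPhi1 : measurable_fun setT (fun y => hlsPhi p q delta f (x, y)).
  by apply: (measurableT_comp mPhi); exact: pair1_measurable.
apply: int_le => //; [by mfun|by mfun|by move=> y _; rewrite lee_fin mulr_ge0// ltW|].
move=> y _; rewrite lee_fin /F3; case: ifPn => [/andP[ry fh]|_]; last first.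
  by rewrite mulr0 hlsPhi_ge0.
rewrite /hlsPhi /rieszK /distK /= -/(k y) mulrC.
have [D0|D0] := eqVneq `|x - y| 0.
  by rewrite /k D0 powR0 ?mul0r// lt_eqF// subr_lt0; lra.
have Dp : 0 < `|x - y| by rewrite lt_neqAle eq_sym D0 normr_ge0.
rewrite ler_wpM2l//.
apply: ge0_ler_powR; rewrite ?nnegrE ?(ltW lam0)//; first lra.
  by rewrite ltW// hlsMin_gt0// (lt_trans h0).
rewrite /hlsMin.
have a1 : lam <= `|x - y| `^ (- q^-1).
  have -> : lam = r `^ (- q^-1).
    by rewrite /r -powRrM mulrNN mulfV ?gt_eqF// powRr1// ltW.
  by apply: le0_ler_powR => //; rewrite oppr_le0 ltW.
have a2 : lam <= f y `^ (p / q).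
  have -> : lam = h `^ (p / q).
    by rewrite /h -powRrM mulrA divfK ?gt_eqF// mulfV ?gt_eqF// powRr1// ltW.
  by apply: ge0_ler_powR; rewrite ?nnegrE ?divr_ge0 ?(ltW p0) ?(ltW q0) ?(ltW h0)// ltW.
by case: ifP.
Qed.

(** [hls_row] and [hls_column] are the two hypotheses of [strong_of_pointwise], so
    no interpolation is needed. *)
Lemma hardy_littlewood_sobolev (p q delta : R) : 1 < p -> p < q -> delta = p^-1 - q^-1 ->
  strong p q (EFin \o rieszK delta).
Proof.
move=> p1 pq dE.
have p0 : 0 < p by lra.
have q0 : 0 < q by lra.
have P1 : p^-1 < 1 by rewrite invf_lt1.
have d0 : 0 < delta by rewrite dE subr_gt0 ltf_pV2.
have th0 : 0 < 1 - p^-1 by lra.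
pose c := 2 * (q * (1 - p^-1)) + 1 + 2 / delta.
have c0 : 0 < c.
  by rewrite /c addr_gt0 ?divr_gt0// addr_gt0// mulr_gt0// mulr_gt0.
pose M := 2 * c * c `^ (- q^-1).
have M0 : 0 < M by rewrite /M mulr_gt0 ?powR_gt0// mulr_gt0.
have A0 : 0 <= 2 * (delta^-1 + (1 - p^-1)^-1).
  by rewrite mulr_ge0// addr_ge0// invr_ge0 ltW.
have mK : measurable_fun setT (EFin \o rieszK delta).
  by apply/measurable_EFinP; exact: measurable_rieszK.
have K0 z : (0 <= (EFin \o rieszK delta) z)%E by rewrite lee_fin rieszK_ge0.
apply: (strong_of_pointwise q0 M0 A0 mK K0) => f mf f0 f1.
exists (hlsPhi p q delta f); split.
- exact: measurable_hlsPhi.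
- by move=> z; exact: hlsPhi_ge0.
- move=> x s x0 hs.
  have s0 : 0 < s.
    rewrite -lte_fin; apply: le_lt_trans hs; apply: integral_ge0 => y _.
    by rewrite lee_fin hlsPhi_ge0.
  pose lam := (s / c) `^ q^-1.
  have lam0 : 0 < lam by rewrite powR_gt0// divr_gt0.
  have sE : s = c * lam `^ q.
    rewrite /lam -powRrM mulVf ?gt_eqF// powRr1 ?divr_ge0 ?ltW//.
    by rewrite mulrC divfK// gt_eqF.
  apply: le_trans (hls_row p1 pq dE (erefl c) mf f0 f1 lam0 sE hs) _.
  rewrite lee_fin /M /lam powRM ?invr_ge0 ?(ltW s0) ?(ltW c0)//.
  rewrite -(powR_inv1 (ltW c0)) -powRrM mulN1r.
  by rewrite le_eqVlt; apply/orP; left; apply/eqP; ring.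
- by move=> y _; exact: hls_column.
Qed.

End HLS.

(** * Norms and reduction to nonnegative functions *)

Section Norms.
Variable R : realType.
Notation mu := (@lebesgue_measure R).
Local Open Scope ereal_scope.
Implicit Types (f : R -> R) (g h : R -> \bar R) (x y : R) (p q : \bar R).

Lemma lebesgue_setT_gt0 : 0 < mu setT.
Proof.
apply: (@lt_le_trans _ _ (mu `[0%R, 1%R]%classic)).
  by rewrite lebesgue_measure_itv /= lte_fin ltr01 sube0 lte01.
by apply: le_measure; rewrite ?inE//.
Qed.

Lemma abse_patch g (D : set R) x : `|(g \_ D) x| = ((abse \o g) \_ D) x.
Proof. by rewrite /patch; case: ifP => //= _; rewrite normr0. Qed.

Lemma normLp_real (r : R) g : r != 0%R ->
  normLp r%:E g = (\int[mu]_(x in @Rpos R) `|g x| `^ r) `^ r^-1.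
Proof.
move=> r0; rewrite /normLp unlock /=; congr (_ `^ _).
rewrite [RHS]integral_mkcond; apply: eq_integral => x _.
by rewrite abse_patch /patch; case: ifP => // _; rewrite poweR0r.
Qed.

Lemma normLpy g : normLp +oo g = ess_sup mu (abse \o (g \_ @Rpos R)).
Proof. by rewrite /normLp unlock /= lebesgue_setT_gt0. Qed.

Lemma normLp_ge0 p g : 0 <= normLp p g.
Proof. exact: Lnorm_ge0. Qed.

Lemma eq_normLp p g h : (forall x, (0 < x)%R -> g x = h x) -> normLp p g = normLp p h.
Proof.
move=> gh; congr Lnorm; apply/funext => x; rewrite /patch.
by case: ifPn => // /set_mem /RposP; exact: gh.
Qed.

(** An exponent in [1, oo] is either a real number at least 1 or infinite. *)
Variant exponent_spec : \bar R -> Type :=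
  | InftyExponent : exponent_spec +oo
  | RealExponent r of (1 <= r)%R : exponent_spec r%:E.

Lemma exponentP p : 1 <= p -> exponent_spec p.
Proof.
case: p => [r|_|//]; first by rewrite lee_fin; exact: RealExponent.
exact: InftyExponent.
Qed.

Lemma measurable_poweR_abse (r : R) g : measurable_fun (@Rpos R) g ->
  measurable_fun (@Rpos R) (fun x => `|g x| `^ r).
Proof.
by move=> mg; apply: (measurableT_comp (measurable_poweR r)); exact: measurableT_comp.
Qed.

Lemma normLp_mono p g h : 1 <= p -> measurable_fun (@Rpos R) g ->
  measurable_fun (@Rpos R) h -> (forall x, (0 < x)%R -> `|g x| <= `|h x|) ->
  normLp p g <= normLp p h.
Proof.
move=> p1 mg mh gh; case: (exponentP p1) => [|r r1].
  rewrite !normLpy; apply: le_ess_sup; apply: nearW => x /=.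
  by rewrite !abse_patch /patch; case: ifPn => // /set_mem /RposP; exact: gh.
have r0 : (0 < r)%R by lra.
rewrite !normLp_real ?gt_eqF//; apply: poweR_mono; first by rewrite invr_ge0 ltW.
  by apply: integral_ge0 => x _; exact: poweR_ge0.
apply: ge0_le_integral => //; [exact: measurable_Rpos|by move=> x _; exact: poweR_ge0| | |].
- exact: measurable_poweR_abse.
- exact: measurable_poweR_abse.
- by move=> x /RposP x0; apply: poweR_mono; [exact: ltW|exact: abse_ge0|exact: gh].
Qed.

Lemma normLp_scale p (c : R) g : 1 <= p -> (0 < c)%R -> measurable_fun (@Rpos R) g ->
  normLp p (fun x => c%:E * g x) = c%:E * normLp p g.
Proof.
move=> p1 c0 mg; case: (exponentP p1) => [|r r1].
  rewrite !normLpy -ess_sup_pZl//; congr ess_sup; apply/funext => x /=.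
  rewrite !abse_patch /patch; case: ifP => // _; last by rewrite mule0.
  by rewrite [LHS]abseM gee0_abs// lee_fin ltW.
have r0 : (0 < r)%R by lra.
rewrite !normLp_real ?gt_eqF//.
under eq_integral.
  move=> x _; rewrite abseM poweRM// gee0_abs ?lee_fin ?(ltW c0)// poweR_EFin; over.
rewrite ge0_integralZl ?lee_fin ?powR_ge0//; [|exact: measurable_Rpos| |]; last first.
- by move=> x _; exact: poweR_ge0.
- exact: measurable_poweR_abse.
rewrite poweRM ?lee_fin ?powR_ge0//; last by apply: integral_ge0 => x _; exact: poweR_ge0.
by rewrite poweR_EFin -powRrM mulfV ?gt_eqF// powRr1// ltW.
Qed.

Lemma normLp_lty_ae p g : 1 <= p -> measurable_fun (@Rpos R) g -> normLp p g < +oo ->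
  {ae mu, forall x, @Rpos R x -> `|g x| < +oo}.
Proof.
move=> p1 mg; case: (exponentP p1) => [|r r1].
  rewrite normLpy => hg; have := ess_sup_ge mu (abse \o (g \_ @Rpos R)).
  apply: filterS => x hx x0.
  by apply: le_lt_trans hg; apply: le_trans hx => /=; rewrite abse_patch /patch mem_set.
have r0 : (0 < r)%R by lra.
rewrite normLp_real ?gt_eqF// => hg.
have I0 : 0 <= \int[mu]_(x in @Rpos R) `|g x| `^ r.
  by apply: integral_ge0 => x _; exact: poweR_ge0.
have lty (S : \bar R) : 0 <= S -> S `^ r^-1 < +oo -> S < +oo.
  by case: S => [s _ _|_|//]; [exact: ltry|rewrite /= invr_eq0 gt_eqF].
have hI := lty _ I0 hg.
have : mu.-integrable (@Rpos R) (fun x => `|g x| `^ r).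
  apply/(integrableP mu (@Rpos R) (fun x => `|g x| `^ r)); split.
    exact: measurable_poweR_abse.
  by under eq_integral do rewrite gee0_abs ?poweR_ge0//.
move=> hint; have hae := (fun mD => integrable_ae mD hint).
have := hae (@measurable_Rpos R); apply: filterS => x hx x0; move: (hx x0).
by case: (g x) => [s _| |] /=; rewrite ?ltry// gt_eqF.
Qed.

End Norms.
Section Reduction.
Variable R : realType.
Notation mu := (@lebesgue_measure R).
Local Open Scope ereal_scope.
Implicit Types (f : R -> R) (g h : R -> \bar R) (x y : R) (p q : \bar R) (K : R * R -> \bar R).

(** The norm inequality for nonnegative functions, normalized by ||f||_p <= 1.
    It makes sense for all exponents in [1, oo], unlike [strong]. *)
Definition opBounded p q K := exists2 C : R, (0 < C)%R &
  forall f, measurable_fun setT f -> (forall y, (0 <= f y)%R) ->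
  normLp p (EFin \o f) <= 1 -> normLp q (opT K f) <= C%:E.

Lemma normLp_le1 (p : R) f : (1 <= p)%R -> (forall y, 0 <= f y)%R ->
  normLp p%:E (EFin \o f) <= 1 -> \int[mu]_(y in @Rpos R) (f y `^ p)%:E <= 1.
Proof.
move=> p1 f0; have p0 : (0 < p)%R by lra.
rewrite normLp_real ?gt_eqF//.
rewrite (_ : integral _ _ _ = \int[mu]_(y in @Rpos R) (f y `^ p)%:E); last first.
  by apply: eq_integral => y _; rewrite /= ger0_norm.
have I0 : 0 <= \int[mu]_(y in @Rpos R) (f y `^ p)%:E.
  by apply: integral_ge0 => y _; rewrite lee_fin powR_ge0.
move=> /(poweR_mono (ltW p0) (poweR_ge0 _ _)).
by rewrite -poweRrM mulVf ?gt_eqF// poweRe1// poweR_EFin powR1.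
Qed.

Lemma strong_opBounded (p q : R) K : (1 <= p)%R -> (1 <= q)%R -> (forall z, 0 <= K z) ->
  strong p q K -> opBounded p%:E q%:E K.
Proof.
move=> p1 q1 K0 [C C0 h]; have p0 : (0 < p)%R by lra.
have q0 : (0 < q)%R by lra.
exists (C `^ q^-1)%R => [|f mf f0]; first exact: powR_gt0.
move=> /(normLp_le1 p1 f0) hf1; rewrite normLp_real ?gt_eqF//.
rewrite -poweR_EFin; apply: poweR_mono; first by rewrite invr_ge0 ltW.
  by apply: integral_ge0 => x _; exact: poweR_ge0.
apply: le_trans (h f mf f0 hf1); rewrite le_eqVlt; apply/orP; left; apply/eqP.
by apply: eq_integral => x _; rewrite gee0_abs// opT_ge0.
Qed.

Lemma opT_scale K f (c : R) x : measurable_fun setT K -> (forall z, 0 <= K z) ->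
  measurable_fun setT f -> (forall y, 0 <= f y)%R -> (0 <= c)%R ->
  opT K (fun y => c * f y)%R x = c%:E * opT K f x.
Proof.
move=> mK K0 mf f0 c0; rewrite /opT.
have mK1 : measurable_fun setT (fun y => K (x, y)).
  by apply: (measurableT_comp mK); exact: pair1_measurable.
under eq_integral do rewrite EFinM muleCA.
rewrite int_scale//; first exact: measurable_Rpos.
  by apply: emeasurable_funM => //; mfun.
by move=> y _; rewrite mule_ge0// lee_fin.
Qed.

Lemma ae_imply (P Q : R -> Prop) : (forall x, P x -> Q x) ->
  {ae mu, forall x, P x} -> {ae mu, forall x, Q x}.
Proof. by move=> PQ; apply: (@filterS _ _ (ae_filter_ringOfSetsType mu)). Qed.

Lemma mule_maxr0 (k : \bar R) (r : R) : 0 <= k ->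
  k * (Num.max r 0)%:E = maxe (k * r%:E) 0.
Proof.
move=> k0; case: (leP 0%R r) => r0.
  by rewrite max_l// mule_ge0// lee_fin.
rewrite mule0 max_r// mule_ge0_le0// lee_fin; exact: ltW.
Qed.

(** Everything is controlled by K applied to |f|: finiteness of its norm makes it
    finite almost everywhere, which is the convergence of the integral, and
    |J f| <= K |f|. Scaling by any s > ||f||_p instead of ||f||_p itself avoids
    a division by zero when f vanishes. *)
Lemma opBounded_potentialJ (a sigma : R) p q : (-1 < a)%R -> (0 < sigma)%R ->
  1 <= p -> 1 <= q -> opBounded p q (kernelH a sigma) ->
  potentialJ_bounded a sigma p q.
Proof.
move=> a1 s0 p1 q1 [C C0 hC]; exists C => f [mf nf].
set K := kernelH a sigma.
have mRpos := @measurable_Rpos R.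
have mK : measurable_fun setT K by exact: measurable_kernelH.
have K0 z : 0 <= K z by exact: kernelH_ge0.
have mK1 x : measurable_fun setT (fun y => K (x, y)).
  by apply: (measurableT_comp mK); exact: pair1_measurable.
have mfr : measurable_fun (@Rpos R) f by exact/measurable_EFinP.
pose ext (u : R -> R) y := if (0 < y)%R then u y else 0%R.
have extE (u : R -> R) y : (0 < y)%R -> ext u y = u y by rewrite /ext => ->.
have mext (u : R -> R) : measurable_fun (@Rpos R) u -> measurable_fun setT (ext u).
  move=> mu'; rewrite (_ : ext u = u \_ @Rpos R).
    by apply/(measurable_restrictT _ mRpos).
  apply/funext => y; rewrite /ext /patch; case: ifPn => [/RposP|] y0; first by rewrite mem_set.
  by rewrite memNset// => /RposP; apply/negP.
pose g := ext (fun y => `|f y|)%R.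
have mg : measurable_fun setT g by apply: mext; exact: measurableT_comp.
have g0 y : (0 <= g y)%R by rewrite /g /ext; case: ifP.
have ng : normLp p (EFin \o g) = normLp p (EFin \o f).
  rewrite /normLp -[RHS]Lnorm_abse; congr Lnorm; apply/funext => y.
  rewrite /= abse_patch /patch; case: ifPn => // /set_mem /RposP y0.
  by rewrite /= /g extE.
have nu0 := normLp_ge0 p (EFin \o f).
have nuE : normLp p (EFin \o f) = (fine (normLp p (EFin \o f)))%:E.
  by rewrite fineK// fin_numE -leeNy_eq -ltNge (lt_le_trans _ nu0)//= lt_eqF.
set nu := fine _ in nuE; rewrite nuE lee_fin in nu0.
have mT := measurable_opT mK K0 mg g0.
have mTr : measurable_fun (@Rpos R) (opT K g) by exact: measurable_funTS.
have nT : normLp q (opT K g) <= (C * nu)%:E.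
  (* C s exceeds C nu by e *)
  apply/lee_addgt0Pr => e e0; pose s := (nu + e / C)%R.
  have eC : (0 < e / C)%R by rewrite divr_gt0.
  have s_gt0 : (0 < s)%R by rewrite /s; lra.
  have mgs : measurable_fun setT (fun y => s^-1 * g y)%R by mfun.
  have gs0 y : (0 <= s^-1 * g y)%R by rewrite mulr_ge0// invr_ge0 ltW.
  have := hC _ mgs gs0.
  have mgE : measurable_fun (@Rpos R) (EFin \o g) by apply: measurable_funTS; mfun.
  rewrite (_ : EFin \o (fun y => s^-1 * g y)%R = (fun y => s^-1%:E * (EFin \o g) y)) //.
  rewrite normLp_scale ?invr_gt0// ng nuE -EFinM lee_fin mulrC ler_pdivrMr// mul1r.
  have -> : (nu <= s)%R by rewrite /s; lra.
  move=> /(_ isT).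
  rewrite (_ : opT K (fun y => s^-1 * g y)%R = (fun x => s^-1%:E * opT K g x)); last first.
    by apply/funext => x; rewrite opT_scale// invr_ge0 ltW.
  rewrite normLp_scale ?invr_gt0// lee_pdivrMl// => h; apply: le_trans h _.
  by rewrite -EFinM -EFinD lee_fin /s mulrDl -(mulrA e) mulVf ?gt_eqF// mulr1 (mulrC nu).
have nTy : normLp q (opT K g) < +oo by apply: le_lt_trans nT _; exact: ltry.
have mHf x : (0 < x)%R -> measurable_fun (@Rpos R) (fun y => potentialH a sigma x y * (f y)%:E).
  move=> x0; apply: (@eq_measurable_fun _ _ _ _ _ (fun y => K (x, y) * (f y)%:E)).
    by move=> y /set_mem /RposP y0; rewrite /K kernelHE.
  apply: emeasurable_funM; last exact: mf.
  by apply: measurable_funTS; exact: mK1.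
have absE x : (0 < x)%R ->
    \int[mu]_(y in @Rpos R) `|potentialH a sigma x y * (f y)%:E| = opT K g x.
  move=> x0; apply: eq_integral => y /set_mem /RposP y0.
  by rewrite -kernelHE// abseM gee0_abs// /g extE.
pose fp := ext (fun y => Num.max (f y) 0)%R.
pose fn := ext (fun y => Num.max (- f y) 0)%R.
have mfp : measurable_fun setT fp.
  by apply: mext; apply: measurable_maxr => //; exact: measurable_cst.
have mfn : measurable_fun setT fn.
  apply: mext; apply: measurable_maxr; last exact: measurable_cst.
  exact: measurableT_comp.
have fp0 y : (0 <= fp y)%R by rewrite /fp /ext; case: ifP; rewrite // le_max lexx orbT.
have fn0 y : (0 <= fn y)%R by rewrite /fn /ext; case: ifP; rewrite // le_max lexx orbT.
have mJ : measurable_fun (@Rpos R) (potentialJ a sigma f).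
  apply: (@eq_measurable_fun _ _ _ _ _ (fun x => opT K fp x - opT K fn x)); last first.
    by apply: emeasurable_funB; apply: measurable_funTS; [exact: (measurable_opT mK K0 mfp fp0)|exact: (measurable_opT mK K0 mfn fn0)].
  move=> x /set_mem /RposP x0; rewrite /potentialJ integralE.
  congr (_ - _); apply: eq_integral => y /set_mem /RposP y0.
    by rewrite funeposE -kernelHE// /fp extE// mule_maxr0.
  by rewrite funenegE -kernelHE// /fn extE// mule_maxr0// EFinN muleN.
have JT x : (0 < x)%R -> `|potentialJ a sigma f x| <= `|opT K g x|.
  move=> x0; rewrite [leRHS]gee0_abs ?opT_ge0// -absE//.
  by apply: le_abse_integral => //; exact: mHf.
have nJ : normLp q (potentialJ a sigma f) <= normLp q (opT K g) by exact: normLp_mono.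
split; last 2 first.
- split; [exact: mJ|exact: le_lt_trans nJ nTy].
- by rewrite nuE -EFinM; exact: le_trans nJ nT.
apply: ae_imply (normLp_lty_ae q1 mTr nTy) => x hx x0.
have xp : (0 < x)%R by exact/RposP.
apply/(integrableP mu (@Rpos R) (fun y => potentialH a sigma x y * (f y)%:E)).
by split; [exact: mHf|rewrite absE// -(gee0_abs (opT_ge0 x K0 g0)) hx].
Qed.
End Reduction.

(** * Domination, sums and bounds into the sup norm *)

Section Closure.
Variable R : realType.
Notation mu := (@lebesgue_measure R).
Local Open Scope ereal_scope.
Implicit Types (f : R -> R) (x y : R) (p q : \bar R) (K : R * R -> \bar R).

(** The diagonal is removed from the domain of integration: the kernel may be
    infinite there, but for fixed x it is a single point. *)
Lemma opT_le K (k : R * R -> R) (c : R) f x : measurable_fun setT K -> (forall z, 0 <= K z) ->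
  measurable_fun setT k -> (forall z, 0 <= k z)%R -> (0 <= c)%R ->
  (forall y, (0 < y)%R -> x != y -> K (x, y) <= (c * k (x, y))%:E) ->
  measurable_fun setT f -> (forall y, 0 <= f y)%R ->
  opT K f x <= c%:E * opT (EFin \o k) f x.
Proof.
move=> mK K0 mk k0 c0 Kk mf f0.
have mRx : measurable (@Rpos R `\ x) by apply: measurableD => //; exact: measurable_Rpos.
have mK1 : measurable_fun setT (fun y => K (x, y)).
  by apply: (measurableT_comp mK); exact: pair1_measurable.
have mk1 : measurable_fun setT (fun y => k (x, y)).
  by apply: (measurableT_comp mk); exact: pair1_measurable.
have mKf : measurable_fun setT (fun y => K (x, y) * (f y)%:E).
  by apply: emeasurable_funM => //; mfun.
have mkf : measurable_fun setT (fun y => (k (x, y))%:E * (f y)%:E) by mfun.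
rewrite /opT -int_scale//; [|exact: measurable_Rpos|]; last first.
  by move=> y _; rewrite mule_ge0// lee_fin.
rewrite -(integral_setD1 mRx); last exact: measurable_funTS.
rewrite -[leRHS](integral_setD1 mRx); last by apply: measurable_funTS; exact: measurable_funeM.
apply: int_le => //; first exact: measurable_funeM.
  by move=> y _; rewrite mule_ge0// lee_fin.
move=> y [/RposP y0 /eqP yx]; rewrite [leRHS]muleA; apply: lee_wpmul2r; rewrite ?lee_fin// -EFinM.
by apply: Kk => //; rewrite eq_sym.
Qed.

Lemma opBounded_le p q K (k : R * R -> R) (c : R) : 1 <= q -> measurable_fun setT K ->
  (forall z, 0 <= K z) -> measurable_fun setT k -> (forall z, 0 <= k z)%R -> (0 < c)%R ->
  (forall x y, (0 < x)%R -> (0 < y)%R -> x != y -> K (x, y) <= (c * k (x, y))%:E) ->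
  opBounded p q (EFin \o k) -> opBounded p q K.
Proof.
move=> q1 mK K0 mk k0 c0 Kk [C C0 h]; exists (c * C)%R => [|f mf f0 nf]; first exact: mulr_gt0.
have mkE : measurable_fun setT (EFin \o k) by mfun.
have k0E z : 0 <= (EFin \o k) z by rewrite lee_fin.
have mT := measurable_opT mK K0 mf f0.
have mTk := measurable_opT mkE k0E mf f0.
apply: (@le_trans _ _ (normLp q (fun x => c%:E * opT (EFin \o k) f x))).
  apply: normLp_mono => //; [exact: measurable_funTS| |].
    by apply: measurable_funTS; exact: measurable_funeM.
  move=> x x0; rewrite !gee0_abs ?opT_ge0//; last by rewrite mule_ge0 ?opT_ge0// lee_fin ltW.
  by apply: opT_le => //; [exact: ltW|move=> y; exact: Kk].
rewrite normLp_scale//; last exact: measurable_funTS.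
by rewrite EFinM lee_pmul2l// h.
Qed.

Lemma strong_add (p q : R) (k k' : R * R -> R) : (0 < q)%R ->
  measurable_fun setT k -> (forall z, 0 <= k z)%R ->
  measurable_fun setT k' -> (forall z, 0 <= k' z)%R ->
  strong p q (EFin \o k) -> strong p q (EFin \o k') ->
  strong p q (EFin \o (fun z => k z + k' z)%R).
Proof.
move=> q0 mk k0 mk' k'0 [C C0 h] [C' C'0 h'].
exists (2 `^ q * (C + C'))%R => [|f mf f0 nf]; first by rewrite mulr_gt0 ?powR_gt0 ?addr_gt0.
have mRpos := @measurable_Rpos R.
have mkE : measurable_fun setT (EFin \o k) by mfun.
have k0E z : 0 <= (EFin \o k) z by rewrite lee_fin.
have mkE' : measurable_fun setT (EFin \o k') by mfun.
have k0E' z : 0 <= (EFin \o k') z by rewrite lee_fin.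
have mT := measurable_opT mkE k0E mf f0.
have mT' := measurable_opT mkE' k0E' mf f0.
have mq (g : R -> \bar R) : measurable_fun setT g -> measurable_fun setT (fun x => g x `^ q).
  by move=> mg; exact: (measurableT_comp (measurable_poweR q)).
have TD x : opT (EFin \o (fun z => k z + k' z)%R) f x =
    opT (EFin \o k) f x + opT (EFin \o k') f x.
  rewrite /opT -int_add//; last 4 first.
  - apply: emeasurable_funM; last by mfun.
    by apply: (measurableT_comp mkE); exact: pair1_measurable.
  - apply: emeasurable_funM; last by mfun.
    by apply: (measurableT_comp mkE'); exact: pair1_measurable.
  - by move=> y _; rewrite mule_ge0// lee_fin.
  - by move=> y _; rewrite mule_ge0// lee_fin.
  by apply: eq_integral => y _; rewrite /= EFinD muleDl.
have pD (u v : \bar R) : 0 <= u -> 0 <= v ->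
    (u + v) `^ q <= (2 `^ q)%:E * (u `^ q + v `^ q).
  move=> u0 v0; pose w : \bar R := maxe u v.
  have w0 : 0 <= w by rewrite /w le_max u0.
  apply: (@le_trans _ _ ((2%:E * w) `^ q)).
    apply: poweR_mono; [exact: ltW|exact: adde_ge0|].
    rewrite mule_natl mule2n.
    by rewrite leeD// /w le_max lexx ?orbT.
  rewrite poweRM ?lee_fin// poweR_EFin lee_pmul2l// ?lte_fin ?powR_gt0//.
  by rewrite /w /maxe; case: ifP => _; rewrite ?leeDl ?leeDr ?poweR_ge0.
under eq_integral do rewrite TD.
apply: (@le_trans _ _ (\int[mu]_(x in @Rpos R) ((2 `^ q)%:E *
    (opT (EFin \o k) f x `^ q + opT (EFin \o k') f x `^ q)))).
  apply: int_le => //.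
  - by apply: mq; exact: emeasurable_funD.
  - by apply: measurable_funeM; apply: emeasurable_funD; exact: mq.
  - by move=> x _; exact: poweR_ge0.
  - by move=> x _; apply: pD; exact: opT_ge0.
rewrite int_scale ?powR_ge0//; last 2 first.
- by apply: emeasurable_funD; exact: mq.
- by move=> x _; rewrite adde_ge0// poweR_ge0.
rewrite EFinM lee_pmul2l// ?lte_fin ?powR_gt0//.
rewrite int_add//; [|exact: mq|exact: mq|by move=> x _; exact: poweR_ge0|by move=> x _; exact: poweR_ge0].
rewrite [leRHS]EFinD; apply: leeD; [exact: h|exact: h'].
Qed.

Lemma opBounded_infty_infty (k : R * R -> R) (B : R) : measurable_fun setT k ->
  (forall z, 0 <= k z)%R -> (0 <= B)%R ->
  (forall x, (0 < x)%R -> \int[mu]_(y in @Rpos R) (k (x, y))%:E <= B%:E) ->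
  opBounded +oo +oo (EFin \o k).
Proof.
move=> mk k0 B0 hB; exists (B + 1)%R => [|f mf f0]; first by lra.
rewrite !normLpy => /ess_supP nf; apply/ess_supP; apply: nearW => x /=.
rewrite abse_patch /patch; case: ifPn => [/set_mem /RposP x0|_]; last by rewrite lee_fin; lra.
rewrite /= gee0_abs; last by apply: opT_ge0.
apply: (@le_trans _ _ (\int[mu]_(y in @Rpos R) (k (x, y))%:E)); last first.
  by apply: le_trans (hB x x0) _; rewrite lee_fin; lra.
have mk1 : measurable_fun setT (fun y => k (x, y)).
  by apply: (measurableT_comp mk); exact: pair1_measurable.
apply: ae_ge0_le_integral => //; [exact: measurable_Rpos| | | | |].
- by move=> y _; rewrite mule_ge0// lee_fin.
- by apply: measurable_funTS; rewrite /=; mfun.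
- by move=> y _; rewrite lee_fin.
- by apply: measurable_funTS; mfun.
apply: ae_imply nf => y /= hy y0; move: hy; rewrite abse_patch /patch mem_set//= ger0_norm//.
by rewrite lee_fin -EFinM lee_fin => hy; rewrite -[leRHS]mulr1 ler_wpM2l.
Qed.

(** Hoelder's inequality for fixed x in the form k f <= b^(1-1/p) f <= f^p + b.
    For p = 1 the choice b = 0 is allowed, since 0^0 = 1. *)
Lemma opBounded_real_infty (p : R) (k b : R * R -> R) (B : R) : (1 <= p)%R ->
  measurable_fun setT k -> (forall z, 0 <= k z)%R ->
  measurable_fun setT b -> (forall z, 0 <= b z)%R -> (0 <= B)%R ->
  (forall x y, (0 < x)%R -> (0 < y)%R -> (k (x, y) <= b (x, y) `^ (1 - p^-1))%R) ->
  (forall x, (0 < x)%R -> \int[mu]_(y in @Rpos R) (b (x, y))%:E <= B%:E) ->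
  opBounded p%:E +oo (EFin \o k).
Proof.
move=> p1 mk k0 mb b0 B0 kb hB; exists (1 + B)%R => [|f mf f0]; first by lra.
have p0 : (0 < p)%R by lra.
move=> /(normLp_le1 p1 f0) hf1; rewrite normLpy; apply/ess_supP; apply: nearW => x /=.
rewrite abse_patch /patch; case: ifPn => [/set_mem /RposP x0|_]; last by rewrite lee_fin; lra.
rewrite /= gee0_abs; last by apply: opT_ge0.
have mk1 : measurable_fun setT (fun y => k (x, y)).
  by apply: (measurableT_comp mk); exact: pair1_measurable.
have mb1 : measurable_fun setT (fun y => b (x, y)).
  by apply: (measurableT_comp mb); exact: pair1_measurable.
have mRpos := @measurable_Rpos R.
apply: (@le_trans _ _ (\int[mu]_(y in @Rpos R) ((f y `^ p)%:E + (b (x, y))%:E))).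
  apply: int_le => //; [by rewrite /=; mfun|by apply: emeasurable_funD; mfun|by move=> y _; rewrite mule_ge0// lee_fin|].
  move=> y /RposP y0; rewrite /= -EFinM -EFinD lee_fin.
  have c1 : (0 <= p^-1)%R by rewrite invr_ge0 ltW.
  have c2 : (0 <= 1 - p^-1)%R by rewrite subr_ge0 invf_le1.
  have c3 : (p^-1 + (1 - p^-1) + 0 = 1)%R by lra.
  have := powR3_le_sum (powR_ge0 (f y) p) (b0 (x, y)) (lexx 0%R) c1 c2 (lexx 0%R) c3.
  rewrite powRr0 mulr1 addr0 -powRrM mulfV ?gt_eqF// powRr1//; apply: le_trans.
  by rewrite mulrC ler_wpM2l// kb.
rewrite int_add//; [|by mfun|by mfun|by move=> y _; rewrite lee_fin powR_ge0|by move=> y _; rewrite lee_fin].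
rewrite [leRHS]EFinD; apply: leeD => //; exact: hB.
Qed.
End Closure.

(** * Sufficiency *)

Section Sufficiency.
Variable R : realType.
Notation mu := (@lebesgue_measure R).
Implicit Types (a sigma p q : R).

Lemma regular_infty_infty a sigma : - (1 / 2) <= a -> 0 < sigma ->
  opBounded +oo%E +oo%E (kernelH a sigma).
Proof.
move=> a2 s0; have a1 : -1 < a by lra.
pose delta : R := Num.min sigma (1 / 2).
have d0 : 0 < delta by rewrite lt_min s0 /=; lra.
have d1 : delta < 1 by rewrite gt_min; apply/orP; right; lra.
have d2 : delta <= 2 * sigma by rewrite ge_min; apply/orP; left; lra.
have [C C0 hC] := potentialH_le_localG a2 s0 d0 d1 d2.
have e0 : 0 < (delta - 1) * 1 + 1 by lra.
have [B B0 hB] := integral_localG (@measurable_Rpos R) d0 d1 (lexx 1) e0.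
have mk := measurable_distK (@measurable_localG R delta).
have k0 (z : R * R) : 0 <= distK (localG delta) z by exact: localG_ge0.
apply: (opBounded_le (k := distK (localG delta)) (c := C)) => //; first exact: leey.
- exact: measurable_kernelH.
- by move=> z; exact: kernelH_ge0.
- by move=> x y x0 y0 xy; rewrite kernelHE// hC.
apply: (opBounded_infty_infty mk k0 B0) => x x0; apply: le_trans (hB x).
rewrite le_eqVlt; apply/orP; left; apply/eqP; apply: eq_integral => y _.
by rewrite powRr1 ?localG_ge0.
Qed.

(** For p = 1 the condition reads sigma > 1/2 and the kernel is bounded. For
    p > 1 any delta with 1/p < delta < min(2 sigma, 1) puts the local kernel in
    the dual space. *)
Lemma regular_real_infty a sigma p : - (1 / 2) <= a -> 0 < sigma -> 1 <= p ->
  p^-1 < 2 * sigma -> opBounded p%:E +oo%E (kernelH a sigma).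
Proof.
move=> a2 s0 p1 ps; have a1 : -1 < a by lra.
have mK := @measurable_kernelH R a sigma a1.
have K0 z : (0 <= kernelH a sigma z)%E by exact: kernelH_ge0.
have [pE|pn] := eqVneq p 1.
  have s2 : 1 / 2 < sigma by move: ps; rewrite pE invr1; lra.
  have [C C0 hC] := potentialH_le_cst a2 s2.
  apply: (opBounded_le (k := fun=> 1) (c := C)) => //; first exact: leey.
    by move=> x y x0 y0 xy; rewrite kernelHE// mulr1 hC.
  apply: (opBounded_real_infty (b := fun=> 0) (B := 0)) => //.
    by move=> x y _ _; rewrite pE invr1 subrr powRr0.
  by move=> x _; rewrite integral0.
have pgt : 1 < p by rewrite lt_neqAle eq_sym pn.
have P0 : 0 < p^-1 by rewrite invr_gt0; lra.
have P1 : p^-1 < 1 by rewrite invf_lt1//; lra.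
pose m : R := Num.min (2 * sigma) 1.
have Pm : p^-1 < m by rewrite lt_min ps P1.
have m1 : m <= 1 by rewrite ge_min lexx orbT.
have ms : m <= 2 * sigma by rewrite ge_min lexx.
pose delta : R := (p^-1 + m) / 2.
have d0 : 0 < delta by rewrite /delta; lra.
have d1 : delta < 1 by rewrite /delta; lra.
have d2 : delta <= 2 * sigma by rewrite /delta; lra.
have dP : p^-1 < delta by rewrite /delta; lra.
have [C C0 hC] := potentialH_le_localG a2 s0 d0 d1 d2.
pose r : R := (1 - p^-1)^-1.
have P1' : 0 < 1 - p^-1 by lra.
have r1 : 1 <= r by rewrite /r invf_ge1//; lra.
have e0 : 0 < (delta - 1) * r + 1.
  rewrite -(pmulr_lgt0 _ P1') mulrDl mul1r -mulrA mulVf ?gt_eqF// mulr1; lra.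
have [B B0 hB] := integral_localG (@measurable_Rpos R) d0 d1 r1 e0.
have mk := measurable_distK (@measurable_localG R delta).
have k0 (z : R * R) : 0 <= distK (localG delta) z by exact: localG_ge0.
apply: (opBounded_le (k := distK (localG delta)) (c := C)) => //; first exact: leey.
  by move=> x y x0 y0 xy; rewrite kernelHE// hC.
apply: (opBounded_real_infty (b := fun z => distK (localG delta) z `^ r) (B := B)) => //.
- by mfun.
- by move=> z; exact: powR_ge0.
- by move=> x y x0 y0; rewrite -powRrM mulVf ?gt_eqF// powRr1.
- by move=> x x0; exact: hB.
Qed.

(** Off the critical line delta lies strictly between 1/p - 1/q and
    min(2 sigma, 1); on it delta = 2 sigma is forced. *)
Lemma regular_real a sigma p q : - (1 / 2) <= a -> 0 < sigma -> 1 <= p -> p <= q ->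
  p^-1 - q^-1 < 2 * sigma \/ (p^-1 - q^-1 = 2 * sigma /\ 1 < p) ->
  opBounded p%:E q%:E (kernelH a sigma).
Proof.
move=> a2 s0 p1 pq hd; have a1 : -1 < a by lra.
have q1 : 1 <= q by lra.
have q1E : (1 <= q%:E)%E by rewrite lee_fin.
have mK := @measurable_kernelH R a sigma a1.
have K0 z : (0 <= kernelH a sigma z)%E by exact: kernelH_ge0.
have P1 : p^-1 <= 1 by rewrite invf_le1//; lra.
have Q0 : 0 < q^-1 by rewrite invr_gt0; lra.
have PQ : q^-1 <= p^-1 by rewrite lef_pV2// posrE; lra.
case: hd => [dlt|[dE pgt]].
  pose m : R := Num.min (2 * sigma) 1.
  have dm : p^-1 - q^-1 < m by rewrite lt_min dlt /=; lra.
  have m1 : m <= 1 by rewrite ge_min lexx orbT.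
  have ms : m <= 2 * sigma by rewrite ge_min lexx.
  pose delta : R := (p^-1 - q^-1 + m) / 2.
  have d0 : 0 < delta by rewrite /delta; lra.
  have d1 : delta < 1 by rewrite /delta; lra.
  have d2 : delta <= 2 * sigma by rewrite /delta; lra.
  have dd : p^-1 - q^-1 < delta by rewrite /delta; lra.
  have [C C0 hC] := potentialH_le_localG a2 s0 d0 d1 d2.
  have mk := measurable_distK (@measurable_localG R delta).
  have k0 (z : R * R) : 0 <= distK (localG delta) z by exact: localG_ge0.
  apply: (opBounded_le (k := distK (localG delta)) (c := C)) => //.
    by move=> x y x0 y0 xy; rewrite kernelHE// hC.
  by apply: strong_opBounded => //; exact: young_localG.
have d0 : 0 < 2 * sigma by lra.
have d1 : 2 * sigma < 1 by rewrite -dE; lra.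
have pltq : p < q.
  rewrite lt_neqAle pq andbT; apply/eqP => pE; move: dE; rewrite pE subrr; lra.
have [C C0 hC] := potentialH_le_localG a2 s0 d0 d1 (lexx _).
have mk := @measurable_rieszK R (2 * sigma).
have k0 (z : R * R) : 0 <= rieszK (2 * sigma) z by exact: rieszK_ge0.
apply: (opBounded_le (k := rieszK (2 * sigma)) (c := C)) => //.
  move=> x y x0 y0 xy; rewrite kernelHE//; apply: le_trans (hC x y x0 y0 xy) _.
  rewrite lee_fin ler_pM2l//; apply: localG_le_powR => //.
  by rewrite normr_gt0 subr_eq0.
apply: strong_opBounded => //.
exact: hardy_littlewood_sobolev.
Qed.

(** The local part is treated as in [regular_real], with the smaller range
    delta + 2g < 1. The condition d + 2g < 1 on the Hardy part, d = 1/p - 1/q,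
    is the sum of g < 1 - 1/p and g < 1/q. *)
Lemma singular_real a sigma p q : -1 < a -> a < - (1 / 2) -> 0 < sigma ->
  1 < p -> p <= q -> p^-1 - q^-1 <= 2 * sigma ->
  - (a + 1 / 2) < 1 - p^-1 -> - (a + 1 / 2) < q^-1 ->
  opBounded p%:E q%:E (kernelH a sigma).
Proof.
move=> a1 a2 s0 p1 pq hd gP gQ; pose g : R := - (a + 1 / 2).
rewrite -/g in gP gQ; have g0 : 0 < g by rewrite /g; lra.
have q1 : 1 <= q by lra.
have p1' : 1 <= p by lra.
have q1E : (1 <= q%:E)%E by rewrite lee_fin.
have mK := @measurable_kernelH R a sigma a1.
have K0 z : (0 <= kernelH a sigma z)%E by exact: kernelH_ge0.
have q0 : 0 < q by lra.
have PQ : q^-1 <= p^-1 by rewrite lef_pV2// posrE; lra.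
pose d : R := p^-1 - q^-1.
have d0 : 0 <= d by rewrite /d; lra.
have d2g : d + 2 * g < 1 by rewrite /d; lra.
have [delta [k [dl0 dl2 dl2g mk [k0 gk sk]]]] : exists delta : R, exists k : R * R -> R,
  [/\ 0 < delta, delta <= 2 * sigma, delta + 2 * g < 1, measurable_fun setT k &
   [/\ forall z, 0 <= k z,
     forall x y : R, x != y -> localG delta `|x - y| <= k (x, y) & strong p q (EFin \o k)]].
  have [dlt|dge] := ltP d (2 * sigma).
    pose m : R := Num.min (2 * sigma) (1 - 2 * g).
    have dm : d < m by rewrite lt_min dlt /=; lra.
    have m1 : m <= 1 - 2 * g by rewrite ge_min lexx orbT.
    have ms : m <= 2 * sigma by rewrite ge_min lexx.
    pose delta : R := (d + m) / 2.
    exists delta, (distK (localG delta)); split; [| | | |split].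
    - by rewrite /delta; lra.
    - by rewrite /delta; lra.
    - by rewrite /delta; lra.
    - exact: measurable_distK (@measurable_localG R delta).
    - by move=> z; exact: localG_ge0.
    - by [].
    - by apply: young_localG; rewrite // -?/d /delta; lra.
  have dE : d = 2 * sigma by apply/eqP; rewrite eq_le dge hd.
  have dpos : 0 < d by lra.
  exists d, (rieszK d); split => //; [exact: measurable_rieszK|split].
  - by move=> z; exact: rieszK_ge0.
  - by move=> x y xy; apply: localG_le_powR => //; rewrite normr_gt0 subr_eq0.
  - apply: hardy_littlewood_sobolev => //.
    rewrite lt_neqAle pq andbT; apply/eqP => pE; move: dpos; rewrite /d pE subrr; lra.
have [C C0 hC] := potentialH_le_sing a1 a2 s0 erefl dl0 dl2 dl2g d0 hd d2g.
pose hL (z : R * R) := hardyL d g z.1 z.2; pose hR (z : R * R) := hardyR d g z.1 z.2.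
have mhL : measurable_fun setT hL by rewrite /hL /hardyL; mfun.
have mhR : measurable_fun setT hR by rewrite /hR /hardyR; mfun.
have hL0 z : 0 <= hL z by exact: hardyL_ge0.
have hR0 z : 0 <= hR z by exact: hardyR_ge0.
have mkL : measurable_fun setT (fun z => k z + hL z) by exact: measurable_funD.
have kL0 z : 0 <= k z + hL z by exact: addr_ge0.
have kLR0 z : 0 <= k z + hL z + hR z by exact: addr_ge0.
apply: (opBounded_le (k := fun z => k z + hL z + hR z) (c := C)) => //.
- exact: measurable_funD.
- move=> x y x0 y0 xy; rewrite kernelHE//; apply: le_trans (hC x y x0 y0 xy) _.
  by rewrite lee_fin ler_pM2l// !lerD2r; exact: gk.
apply: (strong_opBounded p1' q1); first by move=> z; rewrite lee_fin kLR0.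
have sL : strong p q (EFin \o hL) by apply: strong_hardyL => //; exact: ltW.
have sR : strong p q (EFin \o hR) by apply: strong_hardyR => //; exact: ltW.
exact: (strong_add q0 mkL kL0 mhR hR0 (strong_add q0 mk k0 mhL hL0 sk sL) sR).
Qed.
End Sufficiency.

(** * Test functions *)

Section TestFunctions.
Variable R : realType.
Notation mu := (@lebesgue_measure R).
Local Open Scope ereal_scope.
Implicit Types (f : R -> R) (g h : R -> \bar R) (x y u v s t : R) (p q : \bar R)
  (K : R * R -> \bar R).

(** [opBounded] without normalization, for explicit test functions. *)
Definition opBoundedBy (C : R) p q K := forall f, measurable_fun setT f ->
  (forall y, (0 <= f y)%R) -> normLp p (EFin \o f) < +oo ->
  normLp q (opT K f) <= C%:E * normLp p (EFin \o f).

Lemma potentialJ_opBoundedBy (a sigma : R) p q : potentialJ_bounded a sigma p q ->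
  exists2 C : R, (0 < C)%R & opBoundedBy C p q (kernelH a sigma).
Proof.
move=> [C hC]; exists (`|C| + 1)%R => [|f mf f0 nf]; first by rewrite ltr_wpDl.
have mfE : measurable_fun (@Rpos R) (EFin \o f) by apply: measurable_funTS; mfun.
have [_ _ h] := hC f (conj mfE nf).
rewrite (_ : normLp q (opT _ _) = normLp q (potentialJ a sigma f)); last first.
  apply: eq_normLp => x x0; apply: eq_integral => y /set_mem /RposP y0.
  by rewrite kernelHE.
apply: le_trans h _; apply: lee_wpmul2r; first exact: normLp_ge0.
by rewrite lee_fin (le_trans (ler_norm C))// lerDl.
Qed.

Lemma Rpos_itvcc u v : (0 < u)%R -> `[u, v]%classic `<=` @Rpos R.
Proof. by move=> u0 x; rewrite /= in_itv /= => /andP[ux _]; apply/RposP; lra. Qed.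

Lemma lebesgue_itvcc u v : (u < v)%R -> mu `[u, v]%classic = (v - u)%:E.
Proof. by move=> uv; rewrite lebesgue_measure_itv /= lte_fin uv -EFinD. Qed.

Lemma einv_real (r : R) : (1 <= r)%R -> (r%:E)^-1 = (r^-1)%:E.
Proof. by move=> r1; rewrite inver gt_eqF//; lra. Qed.

(** With the convention that 1/p = 0 for p = oo, one formula covers every p; this
    lets the test function arguments treat all exponents at once. *)
Lemma normLp_indic p u v : 1 <= p -> (0 < u)%R -> (u < v)%R ->
  normLp p (EFin \o \1_(`[u, v]%classic)) = ((v - u) `^ fine p^-1)%:E.
Proof.
move=> p1 u0 uv; have mI : measurable `[u, v]%classic by [].
case: (exponentP p1) => [|r r1].
  rewrite normLpy invey /= powRr0; apply/eqP; rewrite eq_le; apply/andP; split.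
    apply/ess_supP; apply: nearW => x /=; rewrite abse_patch /patch.
    case: ifPn => _ /=; last by rewrite lee_fin.
    by rewrite lee_fin ger0_norm// indicE lern1 leq_b1.
  rewrite leNgt; apply/negP => h.
  set s := ess_sup _ _ in h.
  have hs := ess_sup_ge mu (abse \o ((EFin \o (\1_(`[u, v]%classic) : R -> R)) \_ @Rpos R)).
  have : mu.-negligible `[u, v]%classic.
    apply: negligibleS hs => x /= xI; apply/negP; rewrite -ltNge; apply: lt_le_trans h _.
    rewrite abse_patch /patch mem_set; last exact: (Rpos_itvcc u0 xI).
    by rewrite /= indicE mem_set//= normr1.
  move=> [B [mB B0 IB]]; have : mu `[u, v]%classic <= mu B by apply: le_measure; rewrite ?inE.
  rewrite B0 lebesgue_itvcc// lee_fin; lra.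
have r0 : (0 < r)%R by lra.
rewrite normLp_real ?gt_eqF// einv_real//= -poweR_EFin; congr (_ `^ _).
rewrite -lebesgue_itvcc// -[in RHS](setIidl (Rpos_itvcc u0 (v := v))).
rewrite -integral_indic//; last exact: measurable_Rpos.
apply: eq_integral => x _ /=; congr EFin; rewrite indicE.
by case: (x \in _); rewrite /= ?normr1 ?powR1// normr0 powR0// gt_eqF.
Qed.

Lemma opT_ge K f (E : set R) (g : R -> R) x : measurable_fun setT K -> (forall z, 0 <= K z) ->
  measurable_fun setT f -> (forall y, 0 <= f y)%R ->
  measurable E -> E `<=` @Rpos R -> measurable_fun setT g -> (forall y, E y -> 0 <= g y)%R ->
  (forall y, E y -> (g y)%:E <= K (x, y) * (f y)%:E) ->
  \int[mu]_(y in E) (g y)%:E <= opT K f x.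
Proof.
move=> mK K0 mf f0 mE EP mg g0 gK.
have mKf : measurable_fun setT (fun y => K (x, y) * (f y)%:E).
  apply: emeasurable_funM; last by mfun.
  by apply: (measurableT_comp mK); exact: pair1_measurable.
apply: (@le_trans _ _ (\int[mu]_(y in E) (K (x, y) * (f y)%:E))).
  by apply: int_le => //; mfun.
by apply: int_sub => //; [exact: measurable_Rpos|move=> y _; rewrite mule_ge0// lee_fin].
Qed.

Lemma opT_indic_ge K (k u v s t : R) x : measurable_fun setT K -> (forall z, 0 <= K z) ->
  (0 < s)%R -> (u <= s)%R -> (t <= v)%R -> (s < t)%R -> (0 <= k)%R ->
  (forall y, (s <= y)%R -> (y <= t)%R -> k%:E <= K (x, y)) ->
  (k * (t - s))%:E <= opT K \1_(`[u, v]%classic) x.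
Proof.
move=> mK K0 s0 us tv st k0 hk.
rewrite EFinM -lebesgue_itvcc// -integral_const//.
apply: (opT_ge (g := fun=> k)) => //; first exact: Rpos_itvcc.
move=> y /=; rewrite in_itv /= => /andP[sy yt]; rewrite indicE mem_set; last first.
  by rewrite /= in_itv /=; apply/andP; split; lra.
by rewrite mule1 hk.
Qed.

Lemma normLp_ge_box q g (c s t : R) : 1 <= q -> measurable_fun (@Rpos R) g ->
  (0 < s)%R -> (s < t)%R -> (0 < c)%R -> (forall x, (0 < x)%R -> 0 <= g x) ->
  (forall x, (s <= x)%R -> (x <= t)%R -> c%:E <= g x) ->
  (c * (t - s) `^ fine q^-1)%:E <= normLp q g.
Proof.
move=> q1 mg s0 st c0 g0 hc.
rewrite EFinM -(normLp_indic q1 s0 st) -normLp_scale//; last first.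
  by apply: measurable_funTS; apply/measurable_EFinP; exact: measurable_indic.
apply: normLp_mono => //.
  by apply: measurable_funTS; apply: measurable_funeM; apply/measurable_EFinP; exact: measurable_indic.
move=> x x0; rewrite [leRHS]gee0_abs ?g0// abseM gee0_abs ?lee_fin ?(ltW c0)//=.
rewrite indicE; case: (boolP (x \in _)) => [/set_mem|_] /=.
  by rewrite in_itv /= => /andP[sx xt]; rewrite normr1 mule1 hc.
by rewrite normr0 mule0 g0.
Qed.

(** Boundedness tested on one indicator against a lower bound of its image on
    another interval; the exponents of the two lengths are compared
    afterwards, by [exponent_le]. *)
Lemma box_test (C : R) p q K (c u v s t : R) : 1 <= p -> 1 <= q ->
  measurable_fun setT K -> (forall z, 0 <= K z) -> opBoundedBy C p q K ->
  (0 < u)%R -> (u < v)%R -> (0 < s)%R -> (s < t)%R -> (0 < c)%R ->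
  (forall x, (s <= x)%R -> (x <= t)%R -> c%:E <= opT K \1_(`[u, v]%classic) x) ->
  (c * (t - s) `^ fine q^-1 <= C * (v - u) `^ fine p^-1)%R.
Proof.
move=> p1 q1 mK K0 hC u0 uv s0 st c0 hc.
have mI : measurable_fun setT (\1_(`[u, v]%classic) : R -> R) by exact: measurable_indic.
have I0 y : (0 <= \1_(`[u, v]%classic) y :> R)%R by rewrite indicE ler0n.
have := hC _ mI I0; rewrite normLp_indic// ltry => /(_ isT).
rewrite -EFinM => h; rewrite -lee_fin; apply: le_trans h.
have mT := measurable_opT mK K0 mI I0.
apply: normLp_ge_box => //; first exact: measurable_funTS.
by move=> x _; exact: opT_ge0.
Qed.

Lemma exponent_le (c C a b : R) : (0 < c)%R -> (0 < C)%R ->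
  (forall e : R, (0 < e)%R -> (e <= 1)%R -> (c * e `^ a <= C * e `^ b)%R) -> (b <= a)%R.
Proof.
move=> c0 C0 h; rewrite leNgt; apply/negP => ab.
have ba : (0 < b - a)%R by lra.
pose w : R := (c / (2 * C))%R; have w0 : (0 < w)%R by rewrite divr_gt0// mulr_gt0.
pose e : R := (Num.min 1 (w `^ (b - a)^-1))%R.
have e0 : (0 < e)%R by rewrite lt_min ltr01 powR_gt0.
have e1 : (e <= 1)%R by rewrite ge_min lexx.
have ew : (e `^ (b - a) <= w)%R.
  apply: (@le_trans _ _ ((w `^ (b - a)^-1) `^ (b - a))%R).
    by apply: ge0_ler_powR; rewrite ?nnegrE ?powR_ge0 ?(ltW ba) ?(ltW e0)// ge_min lexx orbT.
  by rewrite -powRrM mulVf ?gt_eqF// powRr1// ltW.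
have := h e e0 e1; apply/negP; rewrite -ltNge.
rewrite (_ : (e `^ b = e `^ (b - a) * e `^ a)%R); last by rewrite -gt0_powRD// subrK.
rewrite mulrA ltr_pM2r ?powR_gt0//.
apply: (@le_lt_trans _ _ (C * w)%R); first by rewrite ler_pM2l.
by rewrite /w invfM mulrCA (mulrC 2^-1%R) !mulrA mulfK ?gt_eqF//; lra.
Qed.

(** For a = 1/2N the integral of u^(a-1) over [t, 1] is (1 - t^a)/a, which equals N when
    t^a = 1/2; and u^(-1) is larger than u^(a-1). *)
Lemma integral_inv_unbounded (M : R) : exists t : R, [/\ (0 < t)%R, (t < 1)%R &
  M%:E <= \int[mu]_(u in `[t, 1%R]) (u `^ (-1))%:E].
Proof.
pose N : R := (`|M| + 1)%R; have N0 : (0 < N)%R by rewrite ltr_wpDl.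
pose a : R := (2 * N)^-1%R; have a0 : (0 < a)%R by rewrite invr_gt0 mulr_gt0.
pose t : R := (2^-1 `^ a^-1)%R.
have t0 : (0 < t)%R by rewrite powR_gt0// invr_gt0.
have ta : (t `^ a = 2^-1)%R by rewrite -powRrM mulVf ?gt_eqF// powRr1// invr_ge0.
have t1 : (t < 1)%R.
  rewrite ltNge; apply/negP => t1; have := powR_ge1 t1 (ltW a0); rewrite ta; lra.
exists t; split => //.
apply: (@le_trans _ _ (\int[mu]_(u in `[t, 1%R]) (u `^ (a - 1))%:E)).
  rewrite integral_powR_itv ?gt_eqF// powR1 ta lee_fin.
  rewrite (_ : ((1 - 2^-1) / a = N)%R).
    by rewrite (le_trans (ler_norm M))// lerDl.
  by rewrite /a invrK; field.
apply: int_le => //; [by mfun|by mfun|by move=> u _; rewrite lee_fin powR_ge0|].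
move=> u /=; rewrite in_itv /= => /andP[tu u1]; rewrite lee_fin.
by apply: ger_powR; rewrite ?u1 ?andbT; lra.
Qed.
End TestFunctions.

(** * Necessity *)

Section Necessity.
Variable R : realType.
Notation mu := (@lebesgue_measure R).
Local Open Scope ereal_scope.
Implicit Types (f : R -> R) (g h : R -> \bar R) (x y u v s t : R) (p q : \bar R)
  (K : R * R -> \bar R).

Lemma gt0_powRS (x r : R) : (0 < x)%R -> (x `^ (r + 1) = x `^ r * x)%R.
Proof. by move=> x0; rewrite gt0_powRD// powRr1// ltW. Qed.

(** In [potentialH_ge_diag] the part e^2/2 <= t <= e^2 alone has the size
    e^(2 sigma-1). *)
Lemma kernelH_ge_powR (a sigma : R) : (-1 < a)%R -> (0 < sigma)%R ->
  exists2 c : R, (0 < c)%R & forall x y e : R, (0 < e)%R -> (e <= 1)%R -> (1 <= x)%R ->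
    (1 <= y)%R -> (`|x - y| <= e)%R -> (c * e `^ (2 * sigma - 1))%:E <= kernelH a sigma (x, y).
Proof.
move=> a1 s0; have [c c0 hc] := potentialH_ge_diag a1 s0.
pose r : R := (sigma - 3 / 2)%R; pose k : R := Num.min 1%R (2^-1 `^ r)%R.
have k0 : (0 < k)%R by rewrite lt_min ltr01 powR_gt0// invr_gt0.
exists (c * (k / 2))%R => [|x y e e0 e1 x1 y1 xy]; first by rewrite mulr_gt0// divr_gt0.
have x0 : (0 < x)%R by lra.
have y0 : (0 < y)%R by lra.
rewrite kernelHE//; apply: le_trans (hc x y e e0 e1 x1 y1 xy).
rewrite -mulrA EFinM lee_pmul2l// ?lte_fin// -/r.
pose w : R := (e ^+ 2)%R; have w0 : (0 < w)%R by rewrite /w exprn_gt0.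
have w1 : (w <= 1)%R by rewrite /w expr_le1// ltW.
have w2 : (w / 2 < w)%R by lra.
apply: (@le_trans _ _ (\int[mu]_(t in `[(w / 2)%R, w]) (k * w `^ r)%:E)).
  rewrite integral_const// lebesgue_itvcc// -EFinM lee_fin le_eqVlt; apply/orP; left; apply/eqP.
  have -> : (e `^ (2 * sigma - 1) = w `^ r * w)%R.
    rewrite -gt0_powRS// /w -powR_mulrn ?(ltW e0)// -powRrM.
    by congr (_ `^ _)%R; rewrite /r; lra.
  lra.
apply: (@le_trans _ _ (\int[mu]_(t in `[(w / 2)%R, w]) (t `^ r)%:E)).
  apply: int_le => //; [by mfun|by move=> t _; rewrite lee_fin mulr_ge0 ?powR_ge0// ltW|].
  move=> t /=; rewrite in_itv /= => /andP[t1 t2]; have t0 : (0 < t)%R by lra.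
  rewrite lee_fin mulrC.
  have tw0 : (0 < t / w)%R by rewrite divr_gt0.
  rewrite (_ : (t `^ r = w `^ r * (t / w) `^ r)%R); last first.
    by rewrite -powRM ?(ltW w0) ?(ltW tw0)// mulrCA mulfV ?gt_eqF// mulr1.
  rewrite ler_pM2l ?powR_gt0//.
  have tw1 : (t / w <= 1)%R by rewrite ler_pdivrMr// mul1r.
  have tw2 : (2^-1 <= t / w)%R by rewrite ler_pdivlMr//; lra.
  have [r0|r0] := leP 0%R r.
    rewrite ge_min; apply/orP; right.
    by apply: ge0_ler_powR; rewrite ?nnegrE ?invr_ge0 ?(ltW tw0).
  rewrite ge_min; apply/orP; left; apply: (@le_trans _ _ (1 `^ r)%R); first by rewrite powR1.
  by apply: le0_ler_powR => //; exact: ltW.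
apply: int_sub => //; [by mfun|by move=> t _; rewrite lee_fin powR_ge0|].
move=> t /=; rewrite !in_itv /= => /andP[t1 t2]; apply/andP; split => //.
exact: le_trans t2 w1.
Qed.

Lemma integral_le_normLp (q B : R) g (E : set R) (h : R -> R) : (1 <= q)%R -> (0 <= B)%R ->
  measurable_fun setT g -> (forall x, 0 <= g x) -> measurable E -> E `<=` @Rpos R ->
  measurable_fun setT h -> (forall x, E x -> 0 <= h x)%R ->
  (forall x, E x -> (h x)%:E <= g x) -> normLp q%:E g <= B%:E ->
  \int[mu]_(x in E) (h x `^ q)%:E <= (B `^ q)%:E.
Proof.
move=> q1 B0 mg g0 mE EP mh h0 hg; have q0 : (0 < q)%R by lra.
rewrite normLp_real ?gt_eqF// => nB.
have mgq : measurable_fun setT (fun x => `|g x| `^ q).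
  by apply: (measurableT_comp (measurable_poweR q)); exact: measurableT_comp.
apply: (@le_trans _ _ (\int[mu]_(x in @Rpos R) `|g x| `^ q)).
  apply: (@le_trans _ _ (\int[mu]_(x in E) `|g x| `^ q)).
    apply: int_le => //; [by mfun|by move=> x _; rewrite lee_fin powR_ge0|].
    move=> x Ex; rewrite -poweR_EFin; apply: poweR_mono; [exact: ltW|by rewrite lee_fin h0|].
    by rewrite gee0_abs// hg.
  by apply: int_sub => //; [exact: measurable_Rpos|move=> x _; exact: poweR_ge0].
have := poweR_mono (ltW q0) (poweR_ge0 _ _) nB.
rewrite -poweRrM mulVf ?gt_eqF// poweRe1//.
by apply: integral_ge0 => x _; exact: poweR_ge0.
Qed.

Lemma integral_shift1 (g : R -> R) (t : R) : measurable_fun setT g -> (forall u, 0 <= g u)%R ->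
  \int[mu]_(y in `[(1 + t)%R, 2%R]) (g (y - 1)%R)%:E = \int[mu]_(u in `[t, 1%R]) (g u)%:E.
Proof.
move=> mg g0; rewrite (@ge0_integral_shift R 1%R)//; [|by mfun|by move=> y; rewrite lee_fin].
rewrite (_ : [set x | _] = `[t, 1%R]%classic); last first.
  by apply/seteqP; split => x /=; rewrite !in_itv /= => /andP[? ?]; apply/andP; split; lra.
by apply: eq_integral => x _; rewrite addrK.
Qed.

Section Fixed.
Variables (a sigma C : R) (p q : \bar R).
Hypotheses (a1 : (-1 < a)%R) (s0 : (0 < sigma)%R) (C0 : (0 < C)%R).
Hypotheses (p1 : 1 <= p) (q1 : 1 <= q).
Hypothesis hC : opBoundedBy C p q (kernelH a sigma).

Let K := kernelH a sigma.
Let mK : measurable_fun setT K. Proof. exact: measurable_kernelH. Qed.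
Let K0 z : 0 <= K z. Proof. exact: kernelH_ge0. Qed.

(** Indicators of [M, 2M+1] with M large. The kernel is bounded below within
    distance 1 of the diagonal, so the image is bounded below on
    [M, 2M]. *)
Lemma necessary_upper : (fine q^-1 <= fine p^-1)%R.
Proof.
have [c c0 hc] := kernelH_ge_powR a1 s0.
set P := fine p^-1; set Q := fine q^-1.
have P0 : (0 <= P)%R.
  rewrite /P; case: (exponentP p1) => [|r r1]; first by rewrite invey.
  by rewrite einv_real//= invr_ge0; lra.
suff : (- P <= - Q)%R by rewrite lerN2.
apply: (@exponent_le R c (C * 2 `^ P)) => //; first by rewrite mulr_gt0 ?powR_gt0.
move=> e e0 e1; pose M : R := e^-1%R.
have M1 : (1 <= M)%R by rewrite /M invf_ge1.
have MN r : (M `^ r = e `^ (- r))%R by rewrite /M -powR_inv1 ?(ltW e0)// -powRrM mulN1r.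
have := @box_test R C p q K c M (2 * M + 1) M (2 * M) p1 q1 mK K0 hC.
rewrite -/P -/Q -!MN => hb; have {}hb : (c * (2 * M - M) `^ Q <= C * (2 * M + 1 - M) `^ P)%R.
  apply: hb => //; try lra.
  move=> x x1 x2; have x3 : (x < x + 1)%R by lra.
  have := @opT_indic_ge R K c M (2 * M + 1) x (x + 1) x mK K0.
  rewrite (_ : (c * (x + 1 - x))%R = c); last by lra.
  apply => //; try lra.
  move=> y y1 y2; have := hc x y 1%R ltr01 (lexx _).
  rewrite powR1 mulr1; apply; try lra.
  by rewrite ler_norml; apply/andP; split; lra.
rewrite (_ : (2 * M - M)%R = M) in hb; last by lra.
apply: le_trans hb _; rewrite -mulrA ler_pM2l// -powRM//; last by lra.
by apply: ge0_ler_powR; rewrite ?nnegrE//; lra.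
Qed.

(** Indicators of [1, 1+e] with e small: the image is at least a multiple of
    e^(2 sigma) on the same interval. *)
Lemma necessary_lower : (fine p^-1 - 2 * sigma <= fine q^-1)%R.
Proof.
have [c c0 hc] := kernelH_ge_powR a1 s0.
set P := fine p^-1; set Q := fine q^-1.
suff : (P <= 2 * sigma + Q)%R by lra.
apply: (@exponent_le R c C) => // e e0 e1.
have e1' : (1 < 1 + e)%R by lra.
have := @box_test R C p q K (c * e `^ (2 * sigma)) 1 (1 + e) 1 (1 + e) p1 q1 mK K0 hC.
rewrite (_ : (1 + e - 1)%R = e); last by lra.
rewrite -/P -/Q gt0_powRD// mulrA; apply => //; first by rewrite mulr_gt0// powR_gt0.
move=> x x1 x2.
have := @opT_indic_ge R K (c * e `^ (2 * sigma - 1)) 1 (1 + e) 1 (1 + e) x mK K0.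
rewrite (_ : (c * e `^ (2 * sigma - 1) * (1 + e - 1) = c * e `^ (2 * sigma))%R); last first.
  rewrite -mulrA; congr (_ * _)%R.
  rewrite (_ : (1 + e - 1)%R = e); last by lra.
  by rewrite -gt0_powRS// subrK.
apply => //; first by rewrite mulr_ge0 ?powR_ge0// ltW.
move=> y y1 y2; apply: hc => //.
by rewrite ler_norml; apply/andP; split; lra.
Qed.

(** For sigma = 1/2 the two excluded points coincide at (1, 0), and the kernel is
    logarithmically infinite on the diagonal. *)
Lemma necessary_not_one_infty : sigma = (1 / 2)%R -> p = 1 -> q = +oo -> False.
Proof.
move=> sE pE qE.
have [c c0 hc] := potentialH_ge_diag a1 s0.
have [t [t0 t1 ht]] := integral_inv_unbounded (C / c + 1).
have tt : (1 < 1 + t)%R by lra.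
have := @box_test R C p q K (c * (C / c + 1) * t) 1 (1 + t) 1 (1 + t) p1 q1 mK K0 hC.
rewrite (_ : (1 + t - 1)%R = t); last by lra.
have Cc : (0 < C / c)%R by rewrite divr_gt0.
have Cc1 : (0 < C / c + 1)%R by lra.
rewrite qE pE invey einv_real//= invr1 powRr0 powRr1 ?(ltW t0)// mulr1.
have -> : (c * (C / c + 1) * t <= C * t)%R = false.
  rewrite ler_pM2r// mulrDr mulr1 mulrCA mulfV ?gt_eqF// mulr1; apply/negbTE.
  by rewrite -ltNge; lra.
have hcc : (0 < c * (C / c + 1))%R by exact: mulr_gt0.
suff h x : (1 <= x)%R -> (x <= 1 + t)%R ->
    (c * (C / c + 1) * t)%:E <= opT K \1_(`[1%R, (1 + t)%R]%classic) x.
  by move/(_ ltr01 tt ltr01 tt (mulr_gt0 hcc t0) h).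
move=> x1 x2.
have := @opT_indic_ge R K (c * (C / c + 1)) 1 (1 + t) 1 (1 + t) x mK K0.
rewrite (_ : (1 + t - 1)%R = t); last by lra.
apply => //; first exact: ltW.
move=> y y1 y2; rewrite /K kernelHE; [|lra|lra].
apply: (le_trans _ (hc x y t t0 (ltW t1) x1 y1 _)); last first.
  by rewrite ler_norml; apply/andP; split; lra.
rewrite EFinM; apply: lee_wpmul2l; first by rewrite lee_fin ltW.
apply: le_trans ht _.
rewrite (_ : (sigma - 3 / 2 = -1)%R); last by rewrite sE; lra.
apply: int_sub => //; [by mfun|by move=> u _; rewrite lee_fin powR_ge0|].
move=> u /=; rewrite !in_itv /= => /andP[u1 u2]; apply/andP; split => //.
apply: le_trans u1; rewrite expr2 ler_pdivrMr//.
by rewrite ler_pM2l//; lra.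
Qed.

(** The function (y-1)^(-2 sigma) on [1+t, 2] has the logarithmic integral L as the p-th power of its
    norm, while its image is at least c L on [1, 1+t]. As L tends to infinity,
    c L <= C L^(2 sigma) fails. *)
Lemma necessary_not_critical_infty (r : R) : (2 * sigma < 1)%R -> (1 <= r)%R ->
  p = r%:E -> (r^-1 = 2 * sigma)%R -> q = +oo -> False.
Proof.
move=> s1 r1 pE rE qE; have [c c0 hc] := kernelH_ge_powR a1 s0.
have r0 : (0 < r)%R by lra.
have d0 : (0 < 1 - 2 * sigma)%R by lra.
have Cc : (0 < C / c)%R by rewrite divr_gt0.
(* L >= M makes L^(1 - 2 sigma) larger than C / c *)
pose M : R := ((C / c + 1) `^ (1 - 2 * sigma)^-1)%R.
have M0 : (0 < M)%R by rewrite powR_gt0; lra.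
have [t [t0 t1 ht]] := integral_inv_unbounded M.
have tt : (1 + t < 2)%R by lra.
pose D : set R := `[(1 + t)%R, 2%R]%classic.
have DP : D `<=` @Rpos R by apply: Rpos_itvcc; lra.
have mD : measurable D by exact: measurable_itv.
pose f (y : R) : R := (\1_D y * (y - 1) `^ (- (2 * sigma)))%R.
have mf : measurable_fun setT f.
  by apply: measurable_funM; [exact: measurable_indic|mfun].
have f0 y : (0 <= f y)%R by rewrite /f mulr_ge0 ?powR_ge0// indicE ler0n.
pose L := fine (\int[mu]_(u in `[t, 1%R]) (u `^ (-1))%:E).
have LE : \int[mu]_(u in `[t, 1%R]) (u `^ (-1))%:E = L%:E.
  rewrite fineK// fin_numE; apply/andP; split.
    rewrite gt_eqF//; apply: lt_le_trans (integral_ge0 _ _); first exact: ltNyr.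
    by move=> u _; rewrite lee_fin powR_ge0.
  rewrite lt_eqF//; apply: (@le_lt_trans _ _ (\int[mu]_(u in `[t, 1%R]) (t `^ (-1))%:E)).
    apply: int_le => //; [by mfun|by move=> u _; rewrite lee_fin powR_ge0|].
    by move=> u /=; rewrite in_itv /= => /andP[tu _]; rewrite lee_fin le0_ler_powR.
  by rewrite integral_const// lebesgue_itvcc// -EFinM ltry.
have mV : measurable_fun setT (fun u : R => u `^ (-1))%R by mfun.
have V0 (u : R) : (0 <= u `^ (-1))%R by exact: powR_ge0.
have LD : \int[mu]_(y in D) ((y - 1) `^ (-1))%:E = L%:E.
  by rewrite -LE; exact: (integral_shift1 t mV V0).
rewrite LE lee_fin in ht; have L0 : (0 < L)%R by lra.
have nf : normLp p (EFin \o f) = (L `^ (2 * sigma))%:E.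
  rewrite pE normLp_real ?gt_eqF// rE -poweR_EFin; congr (_ `^ _).
  rewrite -LD.
  rewrite integral_mkcond [RHS]integral_mkcond; apply: eq_integral => y _; rewrite /patch.
  rewrite /= /f indicE; case: (boolP (y \in D)) => yD.
    rewrite mem_set; last exact: (DP _ (set_mem yD)).
    rewrite mul1r ger0_norm ?powR_ge0// -powRrM -rE; congr (_ `^ _)%:E.
    by rewrite mulNr mulVf// gt_eqF.
  by rewrite mul0r normr0 powR0 ?gt_eqF//; case: ifP.
have := hC mf f0; rewrite nf ltry => /(_ isT) h.
have : (c * L)%:E <= (C * L `^ (2 * sigma))%:E.
  rewrite [leRHS]EFinM; apply: le_trans h; rewrite qE.
  have := @normLp_ge_box R +oo (opT K f) (c * L) 1 (1 + t) (leey _).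
  rewrite invey powRr0 mulr1; apply; [| |lra|exact: mulr_gt0|by move=> x _; exact: opT_ge0|].
  - by apply: measurable_funTS; exact: measurable_opT.
  - exact: ltr01.
  move=> x x1 x2; rewrite EFinM -LD.
  rewrite -int_scaleR//; [|by mfun|exact: ltW].
  apply: (@opT_ge R K f D) => //; [by mfun|by move=> y _; rewrite mulr_ge0 ?powR_ge0// ltW|].
  move=> y Dy; have := Dy; rewrite /D /= in_itv /= => /andP[y1 y2].
  have y0 : (0 < y - 1)%R by lra.
  rewrite /f indicE mem_set// mul1r.
  rewrite (_ : (c * (y - 1) `^ (-1))%R = (c * (y - 1) `^ (2 * sigma - 1) * (y - 1) `^ (- (2 * sigma)))%R).
    rewrite EFinM; apply: lee_wpmul2r; first by rewrite lee_fin powR_ge0.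
    apply: hc; try lra.
    by rewrite ler_norml; apply/andP; split; lra.
  by rewrite -mulrA -gt0_powRD//; congr (_ * _ `^ _)%R; lra.
apply/negP; rewrite lee_fin -ltNge.
have -> : (c * L = c * L `^ (1 - 2 * sigma) * L `^ (2 * sigma))%R.
  by rewrite -mulrA -gt0_powRD// subrK powRr1// ltW.
rewrite ltr_pM2r ?powR_gt0// mulrC -ltr_pdivrMr//.
apply: (@lt_le_trans _ _ (M `^ (1 - 2 * sigma))%R).
  by rewrite /M -powRrM mulVf ?gt_eqF// powRr1; lra.
by apply: ge0_ler_powR; rewrite ?nnegrE ?(ltW M0) ?(ltW L0)// ltW.
Qed.

(** The common end of the borderline cases with q finite. *)
Lemma log_contradiction (r c B : R) : (1 <= r)%R -> (0 < c)%R -> (0 <= B)%R ->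
  (forall t : R, (0 < t)%R -> (t < 1)%R ->
    \int[mu]_(u in `[t, 1%R]) (c `^ r * u `^ (-1))%:E <= (B `^ r)%:E) -> False.
Proof.
move=> r1 c0 B0 h; have cr : (0 < c `^ r)%R by rewrite powR_gt0.
have [t [t0 t1 ht]] := integral_inv_unbounded (B `^ r / c `^ r + 1)%R.
have mV : measurable_fun setT (fun u : R => u `^ (-1))%R by mfun.
have := h t t0 t1; rewrite (int_scaleR _ mV (ltW cr))//; last by move=> u _; exact: powR_ge0.
move=> h1; have : (c `^ r)%:E * (B `^ r / c `^ r + 1)%:E <= (B `^ r)%:E.
  by apply: le_trans h1; rewrite lee_pmul2l// lte_fin.
rewrite -EFinM lee_fin mulrDr mulrCA mulfV ?gt_eqF// !mulr1; apply/negP.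
by rewrite -ltNge ltrDl.
Qed.

(** Indicators of [1, 1+t], divided by t, form an approximate identity. Their
    images dominate c (x-1)^(2 sigma-1) for x >= 1+t, and the q-th power of this
    function is a multiple of 1/(x-1). *)
Lemma necessary_not_one_critical (r : R) : (1 <= r)%R -> p = 1 -> q = r%:E ->
  (r^-1 = 1 - 2 * sigma)%R -> False.
Proof.
move=> r1 pE qE rE; have [c c0 hc] := kernelH_ge_powR a1 s0.
have r0 : (0 < r)%R by lra.
have re : ((2 * sigma - 1) * r = -1)%R.
  by rewrite -opprB -rE mulNr mulVf// gt_eqF.
apply: (@log_contradiction r c C r1 c0 (ltW C0)) => t t0 t1.
have tt : (1 < 1 + t)%R by lra.
have ct0 : (0 < c * t)%R by exact: mulr_gt0.
pose h (x : R) : R := (c * t * (x - 1) `^ (2 * sigma - 1))%R.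
have mI : measurable_fun setT (\1_(`[1%R, (1 + t)%R]%classic) : R -> R) by exact: measurable_indic.
have I0 y : (0 <= \1_(`[1%R, (1 + t)%R]%classic) y :> R)%R by rewrite indicE ler0n.
have := hC mI I0; rewrite normLp_indic// ltry => /(_ isT).
rewrite pE qE einv_real//= invr1 (_ : (1 + t - 1)%R = t); last by lra.
rewrite powRr1 ?(ltW t0)// -EFinM => nB.
have h0 x : (0 <= h x)%R by rewrite mulr_ge0 ?powR_ge0// ltW.
have mT := measurable_opT mK K0 mI I0.
have T0 x := @opT_ge0 R K _ x K0 I0.
have IP : `[(1 + t)%R, 2%R]%classic `<=` @Rpos R by apply: Rpos_itvcc; lra.
have := @integral_le_normLp r (C * t) _ `[(1 + t)%R, 2%R]%classic h r1 _ mT T0 _ IP.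
move=> /(_ _ _ _ _ _ nB) H.
have {H} : \int[mu]_(x in `[(1 + t)%R, 2%R]) (h x `^ r)%:E <= ((C * t) `^ r)%:E.
  apply: H => //; [by rewrite mulr_ge0// ltW|by rewrite /h; mfun|].
  move=> x /=; rewrite in_itv /= => /andP[x1 x2].
  have := @opT_indic_ge R K (c * (x - 1) `^ (2 * sigma - 1)) 1 (1 + t) 1 (1 + t) x mK K0.
  rewrite (_ : (c * (x - 1) `^ (2 * sigma - 1) * (1 + t - 1) = h x)%R); last first.
    by rewrite /h (_ : (1 + t - 1)%R = t); [rewrite -!mulrA; congr (_ * _)%R; rewrite mulrC|lra].
  apply => //; first by rewrite mulr_ge0 ?powR_ge0// ltW.
  move=> y y1 y2; apply: hc; try lra.
  by rewrite ler_norml; apply/andP; split; lra.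
rewrite (@integral_shift1 (fun u => (c * t * u `^ (2 * sigma - 1)) `^ r)%R); last 2 first.
- by mfun.
- by move=> u; exact: powR_ge0.
rewrite (powRM _ (ltW C0) (ltW t0)) => H.
have tr : (0 < t `^ r)%R by rewrite powR_gt0.
rewrite -(lee_pmul2r (x := (t `^ r)%:E)) ?lte_fin// -EFinM; apply: le_trans H.
rewrite muleC -int_scaleR//; [|by mfun|exact: ltW|]; last first.
  by move=> u _; rewrite mulr_ge0 ?powR_ge0.
rewrite le_eqVlt; apply/orP; left; apply/eqP; apply: eq_integral => u _.
rewrite powRM ?powR_ge0// ?(ltW ct0)// -powRrM re powRM ?(ltW c0) ?(ltW t0)//.
by congr EFin; ring.
Qed.

(** The image of the indicator of [1, 2] dominates c x^(-g) on (0, 1]. Testing on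
    [e/2, e] gives g <= 1/q, and equality is excluded by the divergence of the
    integral of 1/x. *)
Lemma necessary_singular : (a < - (1 / 2))%R ->
  (- a - 1 / 2 < fine q^-1)%R.
Proof.
move=> a2; have [c c0 hc] := potentialH_ge_small a1 a2 s0.
pose g : R := (- a - 1 / 2)%R; rewrite -/g.
have gE : (a + 1 / 2 = - g)%R by rewrite /g; lra.
have one2 : (1 < 2 :> R)%R by lra.
have hT x : (0 < x)%R -> (x <= 1)%R -> (c * x `^ (- g))%:E <= opT K \1_(`[1%R, 2%R]%classic) x.
  move=> x0 x1; have := @opT_indic_ge R K (c * x `^ (- g)) 1 2 1 2 x mK K0.
  rewrite (_ : (2 - 1 = 1)%R); last by lra.
  rewrite mulr1; apply => //; first by rewrite mulr_ge0 ?powR_ge0// ltW.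
  by move=> y y1 y2; rewrite /K kernelHE//; [rewrite -gE; exact: hc|lra].
have gQ : (g <= fine q^-1)%R.
  suff : (0 <= fine q^-1 - g)%R by lra.
  set Q := fine q^-1.
  apply: (@exponent_le R (c * 2^-1 `^ Q) C) => //; first by rewrite mulr_gt0 ?powR_gt0// invr_gt0.
  move=> e e0 e1.
  have := @box_test R C p q K (c * e `^ (- g)) 1 2 (e / 2) e p1 q1 mK K0 hC.
  rewrite -/Q (_ : (2 - 1 = 1)%R); last by lra.
  rewrite (_ : (e - e / 2 = 2^-1 * e)%R); last by lra.
  rewrite powR1 powRr0 powRM ?invr_ge0 ?(ltW e0)// => h.
  rewrite (_ : (c * 2^-1 `^ Q * e `^ (Q - g))%R = (c * e `^ (- g) * (2^-1 `^ Q * e `^ Q))%R).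
    apply: h => //; [lra|lra|by rewrite mulr_gt0 ?powR_gt0|].
    move=> x x1 x2; apply: (le_trans _ (hT x _ _)); [|lra|lra].
    rewrite lee_fin ler_pM2l//; apply: le0_ler_powR => //; [rewrite /g|]; lra.
  by rewrite gt0_powRD//; ring.
rewrite lt_neqAle gQ andbT; apply/eqP => gQE.
have g0 : (0 < g)%R by rewrite /g; lra.
case: (exponentP q1) gQE hC => [|r r1] gQE hCr; first by rewrite invey /= in gQE; lra.
rewrite einv_real//= in gQE; have r0 : (0 < r)%R by lra.
have mI : measurable_fun setT (\1_(`[1%R, 2%R]%classic) : R -> R) by exact: measurable_indic.
have I0 y : (0 <= \1_(`[1%R, 2%R]%classic) y :> R)%R by rewrite indicE ler0n.
have := hCr _ mI I0; rewrite normLp_indic// ltry => /(_ isT).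
rewrite (_ : (2 - 1 = 1)%R); last by lra.
rewrite powR1 mule1 => nB.
apply: (@log_contradiction r c C r1 c0 (ltW C0)) => t t0 t1.
have mT := measurable_opT mK K0 mI I0.
have T0 x := @opT_ge0 R K _ x K0 I0.
pose h (x : R) : R := (c * x `^ (- g))%R.
have h0 x : (0 <= h x)%R by rewrite mulr_ge0 ?powR_ge0// ltW.
have H : \int[mu]_(x in `[t, 1%R]) (h x `^ r)%:E <= (C `^ r)%:E.
  apply: (integral_le_normLp r1 (ltW C0) mT T0) => //; [exact: Rpos_itvcc|by rewrite /h; mfun|].
  by move=> x /=; rewrite in_itv /= => /andP[x1 x2]; apply: hT; lra.
apply: le_trans H; rewrite le_eqVlt; apply/orP; left; apply/eqP; apply: eq_integral => u _.
rewrite /h powRM ?powR_ge0// ?(ltW c0)// -powRrM; congr (_ * _ `^ _)%:E.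
by rewrite gQE mulNr mulVf// gt_eqF.
Qed.

End Fixed.
End Necessity.

(** * The characterization *)

Lemma einv_fine (R : realType) (p : \bar R) : (1 <= p)%E -> (p^-1 = (fine p^-1)%:E)%E.
Proof. by case/exponentP => [|r r1]; [rewrite invey|rewrite einv_real]. Qed.

Lemma einv_eq0 (R : realType) (p : \bar R) : (1 <= p)%E -> (p^-1 = 0)%E -> p = +oo%E.
Proof.
case/exponentP => [//|r r1]; rewrite einv_real// => -[] /eqP.
by rewrite invr_eq0 => /eqP rE; rewrite rE ler10 in r1.
Qed.

Lemma einv_eq1 (R : realType) (p : \bar R) : (1 <= p)%E -> (p^-1 = 1)%E -> p = 1%E.
Proof.
case/exponentP => [|r r1]; first by rewrite invey => -[] /eqP; rewrite eq_sym oner_eq0.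
by rewrite einv_real// => -[] /eqP; rewrite invr_eq1 => /eqP ->.
Qed.

Theorem theorem2p12 (R : realType) (alpha sigma : R) (p q : \bar R)
    (halpha : -1 < alpha) (hsigma : 0 < sigma)
    (hp : (1 <= p)%E) (hq : (1 <= q)%E) :
  (- (1 / 2) <= alpha ->
     (potentialJ_bounded alpha sigma p q <->
      ((p^-1 - (2 * sigma)%:E <= q^-1)%E /\ (q^-1 <= p^-1)%E) /\
      ~ [set ((2 * sigma)%:E, 0%E); (1%E, (1 - 2 * sigma)%:E)]
          ((p^-1)%E, (q^-1)%E))) /\
  (alpha < - (1 / 2) -> ((2 / (2 * alpha + 3))%:E < p)%E ->
     (potentialJ_bounded alpha sigma p q <->
      ((p^-1 - (2 * sigma)%:E <= q^-1)%E /\ (q^-1 <= p^-1)%E) /\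
      ((- alpha - 1 / 2)%:E < q^-1)%E)).
Proof.
have necessary : potentialJ_bounded alpha sigma p q ->
    (p^-1 - (2 * sigma)%:E <= q^-1)%E /\ (q^-1 <= p^-1)%E.
  move=> /potentialJ_opBoundedBy[C C0 hC].
  rewrite (einv_fine hp) (einv_fine hq) -EFinB !lee_fin; split.
    exact: necessary_lower C0 hp hq hC.
  exact: necessary_upper C0 hp hq hC.
split => [ha|ha hpa]; split.
- move=> hb; split; first exact: necessary.
  have [C C0 hC] := potentialJ_opBoundedBy hb; case=> -[hP hQ].
    have qE := einv_eq0 hq hQ.
    case: (exponentP hp) hP hC => [|r r1]; first by rewrite invey => -[]; lra.
    rewrite einv_real// => -[rE] hC.
    have rle : r^-1 <= 1 by rewrite invf_le1//; lra.
    have [s1|s1] := ltP (2 * sigma) 1.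
      exact: (necessary_not_critical_infty halpha hsigma C0 hC s1 r1 erefl rE qE).
    have rE1 : r^-1 = 1 by apply/eqP; rewrite eq_le rle rE.
    have sE : sigma = 1 / 2 by lra.
    apply: (necessary_not_one_infty halpha hsigma C0 _ hq hC sE _ qE); first by rewrite lee_fin.
    by congr EFin; apply/eqP; rewrite -invr_eq1 rE1.
  have pE := einv_eq1 hp hP.
  case: (exponentP hq) hQ hC => [|r r1].
    rewrite invey => -[s1] hC; have sE : sigma = 1 / 2 by lra.
    exact: (necessary_not_one_infty halpha hsigma C0 hp (leey _) hC sE pE erefl).
  rewrite einv_real// => -[rE] hC.
  exact: (necessary_not_one_critical halpha hsigma C0 hp hC r1 pE erefl rE).
- move=> [[h1 h2] h3]; apply: opBounded_potentialJ => //.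
  case: (exponentP hp) (exponentP hq) h1 h2 h3 => [|r r1] [|s s1].
  + by move=> _ _ _; exact: regular_infty_infty.
  + by rewrite invey einv_real// => _; rewrite lee_fin invr_le0 => ? _; lra.
  + rewrite invey einv_real// -EFinB !lee_fin => h1 _ h3.
    apply: regular_real_infty => //; rewrite lt_neqAle; apply/andP; split; last by lra.
    by apply/eqP => rE; apply: h3; left; rewrite rE.
  + rewrite !einv_real// -EFinB !lee_fin => h1 h2 h3.
    have rs : r <= s by move: h2; rewrite lef_pV2// posrE; lra.
    apply: regular_real => //.
    have [dlt|dge] := ltP (r^-1 - s^-1) (2 * sigma); [by left|right].
    have dE : r^-1 - s^-1 = 2 * sigma by lra.
    split => //; rewrite lt_neqAle r1 andbT; apply/eqP => rE.
    by apply: h3; right; rewrite -dE -rE invr1; congr (_, _%:E); lra.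
- move=> hb; split; first exact: necessary.
  have [C C0 hC] := potentialJ_opBoundedBy hb.
  rewrite (einv_fine hq) lte_fin; exact: necessary_singular C0 hp hq hC ha.
- move=> [[h1 h2] h3]; apply: opBounded_potentialJ => //.
  have a3 : 0 < 2 * alpha + 3 by lra.
  case: (exponentP hp) (exponentP hq) hpa h1 h2 h3 => [|r r1] [|s s1] hpa.
  + by rewrite invey lte_fin; lra.
  + by rewrite invey einv_real// => _; rewrite lee_fin invr_le0 => ? _; lra.
  + by rewrite invey lte_fin; lra.
  + rewrite !einv_real// -EFinB !lee_fin lte_fin => h1 h2 h3.
    rewrite lte_fin ltr_pdivrMr// in hpa.
    have rgt : 1 < r.
      rewrite ltNge; apply/negP => r2; have rE : r = 1 by lra.
      by move: hpa; rewrite rE; lra.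
    have r0 : 0 < r by lra.
    have rs : r <= s by move: h2; rewrite lef_pV2// posrE; lra.
    apply: singular_real => //; [lra| |lra].
    have : r^-1 < alpha + 3 / 2 by rewrite invf_plt ?posrE//; last lra; rewrite -div1r ltr_pdivrMr; lra.
    lra.
Qed.
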